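(* Let $F:\mathbb{C}\to\mathbb{C}$ be an entire function, $F\not\equiv 0$, and let $a_+\neq a_-$ be two equilibria of $\dot{x}=F(x)$ such that there is at least one heteroclinic orbit connecting them, i.e. an orbit $\Gamma$ with $w_+(\Gamma)=\{a_+\}$ and $w_-(\Gamma)=\{a_-\}$. Let $\mathcal{H}$ be the heteroclinic region of $F$ between $a_+$ and $a_-$. Then $\mathcal{H}$ is connected, path-connected and simply connected, and $\mathcal{H}$ is a strip canonical region.
   Context: Consider the autonomous planar system $\dot{x}=F(x)$, $x\in\mathbb{C}$, $t\in\mathbb{R}$, with flow $\Phi(t,x)$ on the maximal interval of existence; $\Gamma(x)$ is the (full) orbit through $x$. $w_+(\Gamma)$ (resp. $w_-(\Gamma)$) is the positive (resp. negative) limit set of an orbit $\Gamma$, i.e. the set of all limits in $\mathbb{C}$ along sequences of times tending to the right (resp. left) endpoint of the maximal interval of existence. Equilibria are the zeros of $F$. The heteroclinic region between $a_+$ and $a_-$ is $\mathcal{H}:=\mathcal{H}_+\cap\mathcal{H}_-$ with $\mathcal{H}_{+}:=\{x\in\mathbb{C}:w_{+}(\Gamma(x))=\{a_{+}\}\}$ and $\mathcal{H}_{-}:=\{x\in\mathbb{C}:w_{-}(\Gamma(x))=\{a_{-}\}\}$. Canonical regions are understood in the sense of Markus and Neumann. An open flow-invariant set is called parallel of strip type if there is a homeomorphism from it onto $\mathbb{R}\times(0,1)$ mapping orbits, with orientation, onto the orbits of the system $\dot{u}=1,\ \dot{v}=0$; it is parallel of annular type if it is analogously equivalent to a region foliated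 by concentric circles, and of spiral/radial type if it is equivalent to $\mathbb{R}^2\setminus\{0\}$ with radial flow. An orbit $\Gamma$ that is neither an equilibrium nor periodic is ordinary if it has an open flow-invariant parallel neighborhood $N$ such that all orbits in $N$ have the same positive and the same negative limit set as $\Gamma$, and $\partial N$ consists of $w_+(\Gamma)\cup w_-(\Gamma)$ together with exactly two further orbits having the same positive and negative limit sets as $\Gamma$; a periodic orbit is ordinary if it has an annular neighborhood filled with periodic orbits. All other orbits (in particular all equilibria) are separatrices. A canonical region is a connected component of the complement of the closure of the union of all separatrices; it is a strip canonical region if it is parallel of strip type. *)

(* Defs.v *)
From HB Require Import structures.
From mathcomp Require Import all_boot all_order all_algebra.
From mathcomp Require Import all_classical all_reals all_analysis.
From mathcomp Require Import complex.

Set Implicit Arguments.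
Unset Strict Implicit.
Unset Printing Implicit Defensive.

Import Order.TTheory GRing.Theory Num.Theory.
Import numFieldNormedType.Exports.

Local Open Scope classical_set_scope.
Local Open Scope ring_scope.

(* The topology, norm and C-module structure of the complex numbers are the
   ones every numFieldType carries on its regular module, hence the ^o. *)
Notation plane R := (R[i]%type^o) (only parsing).

Section planar_topology.
Context {R : realType}.
Local Notation C := (plane R).
Implicit Types (A : set C) (g : R -> C).

Definition boundary A : set C := closure A `\` interior A.

Definition path_in A g (x y : C) : Prop :=
  [/\ {within `[0, 1], continuous g}, g @` `[0, 1] `<=` A, g 0 = x & g 1 = y].

Definition path_connected A : Prop :=
  forall x y, A x -> A y -> exists g, path_in A g x y.

(* Based null-homotopy of the loop g inside A: the first coordinate is the
   deformation parameter, the second one runs along the loop. *)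
Definition null_homotopic_in A g : Prop :=
  exists h : R * R -> C,
    [/\ {within `[0, 1] `*` `[0, 1], continuous h},
        h @` (`[0, 1] `*` `[0, 1]) `<=` A,
        forall t, 0 <= t <= 1 -> h (0, t) = g t,
        forall t, 0 <= t <= 1 -> h (1, t) = g 0 &
        forall s, 0 <= s <= 1 -> h (s, 0) = g 0 /\ h (s, 1) = g 0].

Definition simply_connected A : Prop :=
  path_connected A /\
  forall x g, path_in A g x x -> null_homotopic_in A g.

End planar_topology.

Section dynamics.
Context {R : realType}.
Local Notation C := (plane R).
Implicit Types (F G : C -> C) (x y : C) (U W N : set C).

Definition entire F : Prop := forall z : C, derivable F z 1.

(* g' = F(g), g(0) = x on the open interval I, written componentwise under the
   identification of the plane with R^2. *)
Definition solution F x (I : set R) (g : R -> C) : Prop :=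
  [/\ open I, is_interval I, I 0, g 0 = x &
      forall t, I t ->
        is_derive t 1 (fun s => complex.Re (g s)) (complex.Re (F (g t))) /\
        is_derive t 1 (fun s => complex.Im (g s)) (complex.Im (F (g t)))].

(* When F is locally Lipschitz, solutions agree on common intervals, so the
   maximal interval of existence is the union of all intervals carrying a
   solution, and the value of the flow is the common value of all solutions. *)
Definition max_interval F x : set R :=
  [set t | exists I g, solution F x I g /\ I t].

Definition flow F x (t : R) : C :=
  xget x [set y | exists I g, [/\ solution F x I g, I t & g t = y]].

Definition orbit F x : set C := flow F x @` max_interval F x.

(* w_+(Gamma(x)) and w_-(Gamma(x)); the endpoints of the maximal interval may be
   infinite, and limits are taken in the plane (a divergent orbit has none). *)
Definition pos_limit_set F x : set C :=
  [set y | exists s : nat -> R,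
    [/\ forall n, max_interval F x (s n),
        (s n)%:E @[n --> \oo] --> ereal_sup (EFin @` max_interval F x) &
        flow F x (s n) @[n --> \oo] --> y]].

Definition neg_limit_set F x : set C :=
  [set y | exists s : nat -> R,
    [/\ forall n, max_interval F x (s n),
        (s n)%:E @[n --> \oo] --> ereal_inf (EFin @` max_interval F x) &
        flow F x (s n) @[n --> \oo] --> y]].

Definition same_limit_sets F x y : Prop :=
  pos_limit_set F y = pos_limit_set F x /\
  neg_limit_set F y = neg_limit_set F x.

Definition equilibrium F x : Prop := F x = 0.

Definition periodic F x : Prop :=
  ~ equilibrium F x /\
  exists T, [/\ 0 < T, max_interval F x T & flow F x T = x].

Definition heteroclinic_region F (ap am : C) : set C :=
  [set x | pos_limit_set F x = [set ap]] `&`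
  [set x | neg_limit_set F x = [set am]].

Definition flow_invariant F U : Prop := forall x, U x -> orbit F x `<=` U.

(* A homeomorphism h from U onto W (with inverse k) taking orbits of F onto
   orbits of G; preserving the orientation means that along each orbit h is an
   increasing change tau of the time parameter. *)
Definition orbit_equivalent F U G W : Prop :=
  exists h k : C -> C,
    [/\ {within U, continuous h}, {within W, continuous k},
        forall x, U x -> W (h x) /\ k (h x) = x,
        forall y, W y -> U (k y) /\ h (k y) = y &
        forall x, U x -> exists tau : R -> R,
          [/\ forall s t, max_interval F x s -> max_interval F x t ->
                s < t -> tau s < tau t,
              tau @` max_interval F x = max_interval G (h x) &
              forall t, max_interval F x t ->
                h (flow F x t) = flow G (h x) (tau t)]].

Definition parallel_to G W F U : Prop :=
  [/\ open U, flow_invariant F U & orbit_equivalent F U G W].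

(* u' = 1, v' = 0 on R x (0,1), with z = u + iv. *)
Definition parallel_strip F U : Prop :=
  parallel_to (fun=> 1) [set z : C | 0 < complex.Im z < 1] F U.

(* The rotation z' = iz, whose orbits in the punctured plane are the circles
   centred at 0; the clockwise rotation is equivalent to it by conjugation. *)
Definition parallel_annular F U : Prop :=
  parallel_to (fun z : C => ('i%C : C) * z) [set z : C | z != 0] F U.

(* The radial flow z' = z; the inward one is equivalent to it by inversion. *)
Definition parallel_radial F U : Prop :=
  parallel_to (fun z : C => z) [set z : C | z != 0] F U.

Definition parallel F U : Prop :=
  [\/ parallel_strip F U, parallel_annular F U | parallel_radial F U].

(* The clause excluding y1, y2 from the limit sets renders that their orbits are
   further ones, i.e. not already part of w_+ and w_-. *)
Definition ordinary_nonperiodic F x : Prop :=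
  [/\ ~ equilibrium F x, ~ periodic F x &
      exists N, [/\ parallel F N, N x,
        forall y, N y -> same_limit_sets F x y &
        exists y1 y2,
          [/\ orbit F y1 <> orbit F y2,
              same_limit_sets F x y1, same_limit_sets F x y2,
              (orbit F y1 `|` orbit F y2) `&`
                (pos_limit_set F x `|` neg_limit_set F x) = set0 &
              boundary N = pos_limit_set F x `|` neg_limit_set F x
                             `|` orbit F y1 `|` orbit F y2]]].

Definition ordinary_periodic F x : Prop :=
  periodic F x /\
  exists N, [/\ parallel_annular F N, N x & forall y, N y -> periodic F y].

Definition ordinary F x : Prop :=
  ordinary_nonperiodic F x \/ ordinary_periodic F x.

Definition separatrices F : set C :=
  \bigcup_(x in [set x | ~ ordinary F x]) orbit F x.

Definition canonical_region F U : Prop :=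
  exists2 x, (~` closure (separatrices F)) x &
    U = connected_component (~` closure (separatrices F)) x.

Definition strip_canonical_region F U : Prop :=
  canonical_region F U /\ parallel_strip F U.

End dynamics.

(* Main.v *)
(* Solve [x' = F x] in complex time. The complex-time solution through a
   heteroclinic point exists on a strip around the real axis, and every point of
   the strip is again mapped to a heteroclinic point, since complex times commute
   and near an equilibrium a short complex time at most doubles the distance to
   it. On the maximal strip the solution [S] is injective: a real
   period would force [ap = am], a nonreal one would make a real linear
   functional of [S] attain its maximum. The strip is not a half plane, by
   injectivity near a circle around [ap], and on each boundary line [S] tends to
   infinity at some point. Joining these two points inside the strip by a cut,
   along which a function climbs from 0 to 1, gives a continuous circle-valued
   function on the plane; it lifts to the reals, and the lift would take
   incompatible values at [ap] and [am] if some heteroclinic orbit avoided the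
   image of [S]. So the heteroclinic region is the homeomorphic image of a strip
   on which the flow is translation; substrips show that all its orbits are
   ordinary, and no other ordinary orbit accumulates on it. *)
Require Import Defs.
From mathcomp Require Import all_boot all_order all_algebra.
From mathcomp Require Import all_classical all_reals all_analysis.
From mathcomp Require Import complex.
From mathcomp Require Import ring lra.
Import Order.TTheory GRing.Theory Num.Theory.
Import numFieldNormedType.Exports.
Local Open Scope classical_set_scope.
Local Open Scope ring_scope.
Set Implicit Arguments.
Unset Strict Implicit.
Unset Printing Implicit Defensive.
Import ComplexField.Normc.

(** * The modulus and differentiability of curves and complex functions *)

(** Moving by an imaginary time commutes with the real flow, so the orbits near a heteroclinic one
    are its translates in complex time, and the parallel strip comes with its coordinate. Local
    solutions are inverses of a primitive of [1 / F], whence the need for primitives. The orbit is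
    not compact, so a uniform complex lifetime along it is not automatic: near the ends it comes
    from [|F w| <= L |w - a|], which gives the lifetime [1 / (2 L)] at every distance from [a],
    provided that no other zero of [F] is near. Isolation of zeros is obtained by dividing out
    finitely many zeros; the quotient is only known to be continuous there, so Goursat's theorem is
    proved with exceptional points. That the strip misses no heteroclinic orbit is a separation
    statement. Escape to infinity at both ends of the cut leaves its image no limit points outside
    the image of the strip, so the function climbing across the cut, extended by 0, is continuous
    modulo 1 on the plane; a lift over a large square then replaces a Jordan curve argument. *)

Section complex_norm.
Context {R : realType}.
Local Notation C := R[i].
Implicit Types (x y z : C) (t : R).

Local Open Scope complex_scope.

Lemma nmD x y : normc (x + y) <= normc x + normc y.
Proof. exact: le_normcD. Qed.

Lemma nmN x : normc (- x) = normc x.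
Proof. exact: normcN. Qed.

Lemma nmBC x y : normc (x - y) = normc (y - x).
Proof. by rewrite -nmN opprB. Qed.

Lemma nm_tri y x z : normc (x - z) <= normc (x - y) + normc (y - z).
Proof. by rewrite (_ : x - z = (x - y) + (y - z)) ?nmD //; ring. Qed.

Lemma nm_le_add y x : normc x <= normc (x - y) + normc y.
Proof. by have := nmD (x - y) y; rewrite subrK. Qed.

Lemma nm_ge0 x : 0 <= normc x.
Proof. by case: x => a b /=; rewrite sqrtr_ge0. Qed.

Lemma nm00 : normc (0 : C) = 0.
Proof. exact: (@normc0 R). Qed.

Lemma nm_eq0 x : (normc x == 0) = (x == 0).
Proof.
by apply/eqP/eqP => [/eq0_normc//|->]; exact: nm00.
Qed.

Lemma nm_gt0 x : (0 < normc x) = (x != 0).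
Proof. by rewrite lt_def nm_eq0 nm_ge0 andbT. Qed.

Lemma nm_real t : normc t%:C = `|t|.
Proof. by rewrite /= expr0n /= addr0 sqrtr_sqr. Qed.

Lemma nm_Re x : `|complex.Re x| <= normc x.
Proof.
case: x => a b /=; rewrite -sqrtr_sqr ler_wsqrtr // lerDl; exact: sqr_ge0.
Qed.

Lemma nm_Im x : `|complex.Im x| <= normc x.
Proof.
case: x => a b /=; rewrite -sqrtr_sqr ler_wsqrtr // lerDr; exact: sqr_ge0.
Qed.

Lemma nm_le_ReIm x : normc x <= `|complex.Re x| + `|complex.Im x|.
Proof.
case: x => a b /=.
rewrite -[leRHS]ger0_norm ?addr_ge0 // -sqrtr_sqr ler_wsqrtr //.
by rewrite sqrrD !real_normK ?num_real // addrAC lerDl mulrn_wge0 // mulr_ge0.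
Qed.

Lemma nm_sqr x : normc x ^+ 2 = complex.Re x ^+ 2 + complex.Im x ^+ 2.
Proof.
by case: x => a b /=; rewrite sqr_sqrtr // addr_ge0 // sqr_ge0.
Qed.

Lemma complex_eqP x y : complex.Re x = complex.Re y ->
  complex.Im x = complex.Im y -> x = y.
Proof. by case: x y => a b [c d] /= -> ->. Qed.

Lemma ReD x y : complex.Re (x + y) = complex.Re x + complex.Re y.
Proof. by case: x y => a b [c d]. Qed.
Lemma ImD x y : complex.Im (x + y) = complex.Im x + complex.Im y.
Proof. by case: x y => a b [c d]. Qed.
Lemma ReN x : complex.Re (- x) = - complex.Re x.
Proof. by case: x. Qed.
Lemma ImN x : complex.Im (- x) = - complex.Im x.
Proof. by case: x. Qed.
Lemma ReM x y : complex.Re (x * y) =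
  complex.Re x * complex.Re y - complex.Im x * complex.Im y.
Proof. by case: x y => a b [c d]. Qed.
Lemma ImM x y : complex.Im (x * y) =
  complex.Re x * complex.Im y + complex.Im x * complex.Re y.
Proof. by case: x y => a b [c d]. Qed.

Definition ReImE := (ReD, ImD, ReN, ImN, ReM, ImM).

End complex_norm.

Section derivatives.
Context {R : realType}.
Local Notation C := R[i].
Local Open Scope complex_scope.

(* Covers at once curves (A = R, io = the embedding of R) and complex
   differentiability (A = C, io = id). *)
Definition gder (A : zmodType) (io : A -> C) (g : A -> C) (t : A) (d : C) :=
  forall e : R, 0 < e -> exists2 r : R, 0 < r &
    forall h, normc (io h) < r ->
      normc (g (t + h) - g t - d * io h) <= e * normc (io h).

Definition rder (g : R -> C) t d := gder (real_complex R) g t d.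
Definition cder (f : C -> C) z d := gder id f z d.

Section generic.
Context (A : zmodType) (io : A -> C).
Implicit Types (g f : A -> C) (t : A) (d c : C).
Local Notation gder := (@gder A io).

Lemma gder_bound g t d : gder g t d -> exists2 r : R, 0 < r &
  forall h, normc (io h) < r -> normc (g (t + h) - g t) <= (normc d + 1) * normc (io h).
Proof.
move=> /(_ _ ltr01)[r r0 H]; exists r => // h /H {}H.
have := nm_le_add (d * io h) (g (t + h) - g t); rewrite normcM; lra.
Qed.

Lemma gder_cont g t d : gder g t d -> forall e : R, 0 < e -> exists2 r : R, 0 < r &
  forall h, normc (io h) < r -> normc (g (t + h) - g t) < e.
Proof.
move=> /gder_bound[r r0 H] e e0.
have d1 : 0 < normc d + 1 by have := nm_ge0 d; lra.
exists (Num.min r (e / (normc d + 1))); first by rewrite lt_min r0 divr_gt0.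
move=> h; rewrite lt_min => /andP[/H H1 H2].
by apply: (le_lt_trans H1); rewrite mulrC -ltr_pdivlMr.
Qed.

Lemma gder_ext g f t d (r : R) : 0 < r ->
  (forall h, normc (io h) < r -> g (t + h) = f (t + h)) -> g t = f t ->
  gder g t d -> gder f t d.
Proof.
move=> r0 gf gft Hg e /Hg[s s0 H]; exists (Num.min r s); first by rewrite lt_min r0.
by move=> h; rewrite lt_min => /andP[/gf <- /H]; rewrite gft.
Qed.

Lemma gder_cst c t : gder (fun=> c) t 0.
Proof.
move=> e e0; exists 1 => // h _; rewrite subrr mul0r subrr nm00.
by rewrite mulr_ge0 ?nm_ge0 // ltW.
Qed.

Lemma gderD f g t d c : gder f t d -> gder g t c ->
  gder (fun x => f x + g x) t (d + c).
Proof.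
move=> Hf Hg e e0; have e2 : 0 < e / 2 by lra.
have [r r0 H1] := Hf _ e2; have [s s0 H2] := Hg _ e2.
exists (Num.min r s); first by rewrite lt_min r0.
move=> h; rewrite lt_min => /andP[/H1 {}H1 /H2 {}H2].
have := nmD (f (t + h) - f t - d * io h) (g (t + h) - g t - c * io h).
rewrite (_ : _ + (g _ - _ - _) = f (t + h) + g (t + h) - (f t + g t) - (d + c) * io h).
  by have := nm_ge0 (io h); nra.
ring.
Qed.

Lemma gder_comp (f : C -> C) g t d D : cder f (g t) D -> gder g t d ->
  gder (fun x => f (g x)) t (D * d).
Proof.
move=> Hf Hg e e0.
have [r r0 H1] := gder_bound Hg.
have d1 : 0 < normc d + 1 by have := nm_ge0 d; lra.
have D1 : 0 < normc D + 1 by have := nm_ge0 D; lra.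
have [s s0 H2] := Hf (e / 2 / (normc d + 1)) ltac:(by rewrite !divr_gt0).
have [u u0 H3] := Hg (e / 2 / (normc D + 1)) ltac:(by rewrite !divr_gt0).
exists (Num.min r (Num.min u (s / (normc d + 1)))).
  by rewrite !lt_min r0 u0 divr_gt0.
move=> h; rewrite !lt_min => /and3P[/H1 {}H1 /H3 {}H3 hs].
have gs : normc (g (t + h) - g t) < s.
  by apply: le_lt_trans H1 _; rewrite mulrC -ltr_pdivlMr.
have := H2 _ gs; rewrite [g t + _]addrC subrK => {}H2.
set a := normc (f _ - _ - _) in H2.
have -> : f (g (t + h)) - f (g t) - D * d * io h =
  (f (g (t + h)) - f (g t) - D * (g (t + h) - g t)) +
   D * (g (t + h) - g t - d * io h) by ring.
apply: le_trans (nmD _ _) _; rewrite normcM -/a.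
have n0 := nm_ge0 (io h).
have A1 : a <= e / 2 * normc (io h).
  apply: le_trans H2 _.
  have -> : e / 2 * normc (io h) = e / 2 / (normc d + 1) * ((normc d + 1) * normc (io h)).
    by field; lra.
  by apply: ler_wpM2l => //; rewrite ltW // !divr_gt0.
have A2 : normc D * normc (g (t + h) - g t - d * io h) <= e / 2 * normc (io h).
  have -> : e / 2 * normc (io h) = (normc D + 1) * (e / 2 / (normc D + 1) * normc (io h)).
    by field; lra.
  by apply: ler_pM => //; rewrite ?nm_ge0 //; lra.
lra.
Qed.

Lemma cder_scale c (z : C) : cder (fun x => c * x) z c.
Proof.
move=> e e0; exists 1 => // h _.
rewrite (_ : c * (z + h) - c * z - c * h = 0); last by ring.
by rewrite nm00 mulr_ge0 ?nm_ge0 // ltW.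
Qed.

Lemma gderZ c g t d : gder g t d -> gder (fun x => c * g x) t (c * d).
Proof. by move=> H; apply: gder_comp H; exact: cder_scale. Qed.

Lemma gderN g t d : gder g t d -> gder (fun x => - g x) t (- d).
Proof.
move=> /(gderZ (-1)) H; rewrite -mulN1r.
by rewrite (_ : (fun x => - g x) = (fun x => -1 * g x)) //; apply/funext => x; rewrite mulN1r.
Qed.

Lemma gderB f g t d c : gder f t d -> gder g t c ->
  gder (fun x => f x - g x) t (d - c).
Proof. by move=> Hf /gderN; exact: gderD. Qed.

Lemma gderD_cst g t d c : gder g t d -> gder (fun x => g x + c) t d.
Proof. by move=> H; rewrite -[d]addr0; apply: gderD H _; exact: gder_cst. Qed.

End generic.

Lemma cder_sqr (z : C) : cder (fun x => x * x) z (2 * z).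
Proof.
move=> e e0; exists e => // h he.
rewrite (_ : _ - _ = h * h); last by ring.
by rewrite normcM; have := nm_ge0 h; nra.
Qed.

Lemma cder_inv (z : C) : z != 0 -> cder (fun x => x^-1) z (- z^-2).
Proof.
move=> z0 e e0.
have nz : 0 < normc z by rewrite nm_gt0.
(* The remainder is [h ^ 2 / (z ^ 2 (z + h))]; with [|z + h| >= |z| / 2] the second bound on [h]
   makes it at most [e |h|]. *)
exists (Num.min (normc z / 2) (e * normc z ^+ 3 / 2)).
  by rewrite lt_min !divr_gt0 // mulr_gt0 // exprn_gt0.
move=> h; rewrite lt_min => /andP[h1 h2].
have zh : normc z / 2 <= normc (z + h).
  by have := nm_le_add (z + h) z; rewrite (_ : z - (z + h) = - h); [rewrite nmN; lra|ring].
have zh0 : z + h != 0 by rewrite -nm_gt0; lra.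
have -> : (z + h)^-1 - z^-1 - (- z^-2) * h = h * h * (z ^-2 * (z + h)^-1).
  by field; rewrite z0 zh0.
rewrite !normcM !normcV !normcM.
rewrite -/(normc _) mulrC mulrA -[_ * _ * normc h]mulrA.
set n := normc h in h1 h2 *; set a := normc z in nz zh h1 h2 *.
have b0 : 0 < normc (z + h) by lra.
have n0 : 0 <= n by exact: nm_ge0.
rewrite -invfM -[X in _ <= X]mulrC.
rewrite mulrA [n * e]mulrC; apply: ler_wpM2r => //.
rewrite mulrC ler_pdivrMr; last by rewrite !mulr_gt0.
have : e * a ^+ 3 / 2 <= e * (a * a * normc (z + h)).
  rewrite (_ : e * a ^+ 3 / 2 = e * (a * a * (a / 2))); last by field.
  by rewrite ler_pM2l // ler_pM2l // mulr_gt0.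
lra.
Qed.

Lemma gder_mul (A : zmodType) (io : A -> C) f g t d c :
  gder io f t d -> gder io g t c ->
  gder io (fun x => f x * g x) t (d * g t + f t * c).
Proof.
(* By polarisation only the derivative of the square is needed. *)
move=> Hf Hg.
have Hs := gder_comp (g := fun x => f x + g x) (cder_sqr (f t + g t)) (gderD Hf Hg).
have Hd := gder_comp (g := fun x => f x - g x) (cder_sqr (f t - g t)) (gderB Hf Hg).
have := gderZ (4^-1) (gderB Hs Hd).
have -> : (fun x : A => f x * g x) = fun x =>
    4^-1 * ((f x + g x) * (f x + g x) - (f x - g x) * (f x - g x)).
  by apply/funext => x; field.
set a := (X in gder _ _ _ X -> _); set b := (X in _ -> gder _ _ _ X).
by have -> : a = b by rewrite /a /b; field.
Qed.

Lemma rder_id (t : R) : rder (real_complex R) t 1.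
Proof.
move=> e e0; exists 1 => // h _.
rewrite (_ : _ - _ = 0) ?nm00; last by rewrite rmorphD /=; ring.
by rewrite mulr_ge0 ?nm_ge0 // ltW.
Qed.

Lemma rder_affine (u v : C) (t : R) : rder (fun s => u + s%:C * v) t v.
Proof.
have := gderD (gder_cst (real_complex R) u t) (gderZ v (rder_id t)).
rewrite add0r mulr1.
by under [fun s => _]funext do rewrite (mulrC v).
Qed.

Lemma cder_shift (f : C -> C) c z d : cder f (z + c) d -> cder (fun x => f (x + c)) z d.
Proof.
by move=> H e /H[r r0 {}H]; exists r => // h /H; rewrite (_ : z + c + h = z + h + c) //; ring.
Qed.

Lemma cder_curve (f : C -> C) (g : R -> C) t d D : cder f (g t) D -> rder g t d ->
  rder (fun s => f (g s)) t (D * d).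
Proof. exact: gder_comp. Qed.

Lemma rder_reparam (g : R -> C) (a b t : R) d : rder g (a + t * b) d ->
  rder (fun s => g (a + s * b)) t (b%:C * d).
Proof.
move=> Hg e e0; have b1 : 0 < `|b| + 1 by have := normr_ge0 b; lra.
have [r r0 H] := Hg (e / (`|b| + 1)) ltac:(by rewrite divr_gt0).
exists (r / (`|b| + 1)); first by rewrite divr_gt0.
move=> h; rewrite nm_real => hr.
have := H (h * b); rewrite nm_real normrM.
have -> : a + t * b + h * b = a + (t + h) * b by ring.
move=> H1; have {H1} := H1 _.
rewrite ltr_pdivlMr // in hr.
have h0 := normr_ge0 h; have := normr_ge0 b => nb H1.
have -> : b%:C * d * h%:C = d * (h * b)%:C by rewrite rmorphM /=; ring.
apply: le_trans (H1 _) _; first nra.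
rewrite mulrA [_ * `|h|]mulrC -mulrA mulrC.
apply: ler_wpM2r => //.
rewrite mulrAC ler_pdivrMr //; nra.
Qed.

End derivatives.

(** * Induction along segments and over quartered rectangles *)

Section real_tools.
Context {R : realType}.
Implicit Types (f : R -> R) (a b t : R).

(** The supremum of the points up to which [P] holds is reached by the limit clause and passed by
    the step clause. This takes the place of compactness of segments in the arguments along
    orbits. *)
Lemma real_ind a b (P : R -> Prop) : P a ->
  (forall s, a <= s < b -> (forall u, a <= u <= s -> P u) ->
     exists2 r : R, 0 < r & forall s', s < s' < s + r -> s' <= b -> P s') ->
  (forall s, a < s <= b -> (forall s', a <= s' < s -> P s') -> P s) ->
  forall s, a <= s <= b -> P s.
Proof.
move=> Pa Pstep Plim.
pose A : set R := [set s | a <= s <= b /\ forall u, a <= u <= s -> P u].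
move=> s0 /andP[as0 s0b].
have ab : a <= b by exact: le_trans s0b.
have Aa : A a.
  by split; [rewrite lexx|move=> u /andP[au ua]; rewrite (_ : u = a) //; apply/eqP; rewrite eq_le au ua].
have hA : has_sup A by split; [exists a|exists b => x [/andP[]]].
set c := sup A.
have ac : a <= c by apply: ub_le_sup Aa; exact: hA.2.
have cb : c <= b by apply: ge_sup; [exists a|move=> x [/andP[]]].
have Plt u : a <= u < c -> P u.
  move=> /andP[au uc]; have cu0 : 0 < c - u by lra.
  have [x [_ Ax] ux] := sup_adherent cu0 hA.
  by apply: Ax; rewrite au /=; rewrite opprB addrC subrK in ux; exact: ltW.
have Pc : P c.
  have [ca|ca] := eqVneq a c; first by rewrite -ca.
  by apply: Plim => //; rewrite lt_neqAle ca ac.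
have Ac : forall u, a <= u <= c -> P u.
  move=> u /andP[au]; rewrite le_eqVlt => /orP[/eqP->//|uc].
  by apply: Plt; rewrite au.
have [cb'|bc] := ltP c b; last by apply: Ac; rewrite as0 (le_trans s0b).
have [r r0 Hr] := Pstep c ltac:(by rewrite ac) Ac.
pose d := Num.min b (c + r / 2).
have cd : c < d by rewrite /d lt_min cb' /=; lra.
have Ad : A d.
  split; first by rewrite (le_trans ac (ltW cd)) /d ge_min lexx.
  move=> u /andP[au ud]; have [uc|cu] := leP u c; first by apply: Ac; rewrite au.
  move: ud; rewrite /d le_min => /andP[ub ucr]; apply: Hr => //.
  by apply/andP; split => //; lra.
have := ub_le_sup hA.2 Ad; rewrite -/c; lra.
Qed.

Lemma is_deriveP f t d : is_derive t 1 f d <->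
  forall e : R, 0 < e -> exists2 r : R, 0 < r &
    forall h, `|h| < r -> `|f (t + h) - f t - d * h| <= e * `|h|.
Proof.
split=> [[df fd] e e0|H].
  have : h^-1 *: (f (h *: 1 + t) - f t) @[h --> 0^'] --> d by rewrite -fd; exact: df.
  move=> /cvgrPdist_le/(_ e e0)[r /= r0 Hr]; exists r => // h hr.
  have [->|h0] := eqVneq h 0; first by rewrite addr0 subrr mulr0 subrr !normr0 mulr0.
  have := Hr h; rewrite /= sub0r normrN => /(_ hr h0).
  rewrite /GRing.scale /= mulr1 (addrC h t) => H.
  rewrite (_ : _ - _ = - (d - h^-1 * (f (t + h) - f t)) * h); last by field.
  by rewrite normrM normrN ler_wpM2r.
have H' : h^-1 *: (f (h *: 1 + t) - f t) @[h --> 0^'] --> d.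
  apply/cvgrPdist_le => e /H[r r0 Hr]; exists r => //= h.
  rewrite /= sub0r normrN => hr h0; rewrite /GRing.scale /= mulr1 (addrC h t).
  have := Hr h hr.
  rewrite (_ : d - _ = - (f (t + h) - f t - d * h) / h); last by field.
  by rewrite normrM normrN normfV ler_pdivrMr ?normr_gt0.
by split; [apply/cvg_ex; exists d|exact: cvg_lim H'].
Qed.

Definition econt f t := forall e : R, 0 < e -> exists2 r : R, 0 < r &
    forall h, `|h| < r -> `|f (t + h) - f t| < e.

Lemma econtP f t : econt f t <-> {for t, continuous f}.
Proof.
split=> [H|H e e0].
  apply/cvgrPdist_lt => e /H[r r0 Hr]; exists r => //= s.
  by rewrite /= distrC => /Hr; rewrite (addrC t) subrK distrC.
have /cvgrPdist_lt/(_ e e0)[r /= r0 Hr] := H.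
exists r => // h hr; have := Hr (t + h); rewrite /= opprD addNKr normrN => /(_ hr).
by rewrite distrC.
Qed.

Lemma MVT_le f df a b : a < b -> (forall s, a <= s <= b -> is_derive s 1 f (df s)) ->
  exists2 c, a <= c <= b & f b - f a = df c * (b - a).
Proof.
move=> ab H; have [||c] := @MVT R f df a b ab.
- by move=> x; rewrite in_itv /= => /andP[x1 x2]; apply: H; rewrite !ltW.
- apply: derivable_within_continuous => x; rewrite in_itv /= => xab.
  by have [] := H _ xab.
- rewrite in_itv /= => /andP[c1 c2] ->; exists c => //; by rewrite !ltW.
Qed.

Lemma antiderivative f a b : a < b -> (forall x, econt f x) ->
  exists G, forall x, a < x < b -> is_derive x 1 G (f x).
Proof.
move=> ab cf.
pose mu := @lebesgue_measure R.
exists (fun x => (\int[mu]_(t in `[a, x]) f t)%R) => x /andP[ax xb].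
have cfx y : {for y, continuous f} by apply/econtP.
have [] := @continuous_FTC1_closed R f a x b xb _ ax (cfx x).
  apply: continuous_compact_integrable; first exact: segment_compact.
  by apply: continuous_subspaceT => y; exact: cfx.
move=> H1 H2; split; first exact: H1.
by rewrite -H2 derive1E.
Qed.

(* Quartering preserves the side ratio, hence the exact side lengths in the
   local hypothesis. *)
Lemma rect_ind (a b c d : R) (P : R -> R -> R -> R -> Prop) : a < b -> c < d ->
  (forall a b m c d n, a < m < b -> c < n < d ->
    P a m c n -> P m b c n -> P a m n d -> P m b n d -> P a b c d) ->
  (forall x y, a <= x <= b -> c <= y <= d -> exists2 r : R, 0 < r &
    forall (k : nat) a' b' c' d', a <= a' -> b' <= b -> c <= c' -> d' <= d ->
      a' <= x <= b' -> c' <= y <= d' -> a' < b' -> c' < d' ->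
      b' - a' = (b - a) / 2 ^+ k -> d' - c' = (d - c) / 2 ^+ k ->
      b' - a' < r -> d' - c' < r -> P a' b' c' d') ->
  P a b c d.
Proof.
move=> ab cd Pq Ploc; apply: contrapT => nP.
(* A rectangle violating [P] has a quarter violating it. Choosing such quarters for ever gives
   nested rectangles around a point [(x, y)], where the local hypothesis contradicts the
   violation. *)
pose T := (R * R * (R * R))%type.
pose bad (q : T) := ~ P q.1.1 q.1.2 q.2.1 q.2.2.
pose half (p : R * R) (s : bool) := if s then (p.1, (p.1 + p.2) / 2) else ((p.1 + p.2) / 2, p.2).
have stepE (q : T) : exists q' : T, q.1.1 < q.1.2 -> q.2.1 < q.2.2 -> bad q ->
    bad q' /\ exists s u, q' = (half q.1 s, half q.2 u).
  case: q => [[x1 x2] [y1 y2]] /=.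
  have [B|nB] := pselect (exists s u, bad (half (x1, x2) s, half (y1, y2) u)).
    by have [s [u H]] := B; exists (half (x1, x2) s, half (y1, y2) u) => _ _ _; split => //; exists s, u.
  exists ((x1, x2), (y1, y2)) => x12 y12 B; exfalso; apply: B => /=.
  have G s u : P (half (x1,x2) s).1 (half (x1,x2) s).2 (half (y1,y2) u).1 (half (y1,y2) u).2.
    by apply: contrapT => nG; apply: nB; exists s, u.
  apply: (Pq _ _ ((x1 + x2) / 2) _ _ ((y1 + y2) / 2)); [lra|lra| | | | ].
  - exact: (G true true).
  - exact: (G false true).
  - exact: (G true false).
  - exact: (G false false).
have [f Hf] := boolp.choice stepE.
pose q n := iter n f ((a, b), (c, d)).
have qP n : [/\ (q n).1.2 - (q n).1.1 = (b - a) / 2 ^+ n,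
    (q n).2.2 - (q n).2.1 = (d - c) / 2 ^+ n & bad (q n)].
  elim: n => [|n [I1 I2 I3]]; first by rewrite /= expr0 !divr1.
  have p2 : 0 < (2 : R) ^+ n by rewrite exprn_gt0.
  have q1 : (q n).1.1 < (q n).1.2 by rewrite -subr_gt0 I1 divr_gt0 ?subr_gt0.
  have q2 : (q n).2.1 < (q n).2.2 by rewrite -subr_gt0 I2 divr_gt0 ?subr_gt0.
  have [B [s [u E]]] := Hf (q n) q1 q2 I3.
  split; last exact: B.
    rewrite /q iterS -/(q n) E /= exprS invfM mulrCA -I1.
    by case: (s) => /=; lra.
  rewrite /q iterS -/(q n) E /= exprS invfM mulrCA -I2.
  by case: (u) => /=; lra.
have lt1 n : (q n).1.1 < (q n).1.2.
  by have [I1 _ _] := qP n; rewrite -subr_gt0 I1 divr_gt0 ?subr_gt0 ?exprn_gt0.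
have lt2 n : (q n).2.1 < (q n).2.2.
  by have [_ I1 _] := qP n; rewrite -subr_gt0 I1 divr_gt0 ?subr_gt0 ?exprn_gt0.
have nest n : [/\ (q n).1.1 <= (q n.+1).1.1, (q n.+1).1.2 <= (q n).1.2,
    (q n).2.1 <= (q n.+1).2.1 & (q n.+1).2.2 <= (q n).2.2].
  have [_ _ I3] := qP n; have l1 := lt1 n; have l2 := lt2 n.
  have [B [s [u E]]] := Hf (q n) l1 l2 I3.
  by rewrite /q iterS -/(q n) E /=; case: (s); case: (u) => /=; split; lra.
have mono n k : [/\ (q n).1.1 <= (q (n + k)%N).1.1, (q (n + k)%N).1.2 <= (q n).1.2,
    (q n).2.1 <= (q (n + k)%N).2.1 & (q (n + k)%N).2.2 <= (q n).2.2].
  elim: k => [|k [J1 J2 J3 J4]]; first by rewrite addn0.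
  have [N1 N2 N3 N4] := nest (n + k)%N; rewrite addnS; split.
  - exact: le_trans N1.
  - exact: le_trans J2.
  - exact: le_trans N3.
  - exact: le_trans J4.
have cross n m : (q n).1.1 <= (q m).1.2 /\ (q n).2.1 <= (q m).2.2.
  have [A1 _ A3 _] := mono n m; have [_ B2 _ B4] := mono m n.
  rewrite addnC in B2 B4.
  by have := lt1 (n + m)%N; have := lt2 (n + m)%N; split; lra.
pose X := [set (q n).1.1 | n in setT]; pose Y := [set (q n).2.1 | n in setT].
have sX : has_sup X by split; [exists (q 0%N).1.1, 0%N|exists (q 0%N).1.2 => _ [n _ <-]; exact: (cross n 0%N).1].
have sY : has_sup Y by split; [exists (q 0%N).2.1, 0%N|exists (q 0%N).2.2 => _ [n _ <-]; exact: (cross n 0%N).2].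
set x := sup X; set y := sup Y.
have xin n : (q n).1.1 <= x <= (q n).1.2.
  apply/andP; split; first by apply: ub_le_sup; [exact: sX.2|exists n].
  by apply: ge_sup; [exact: sX.1|move=> _ [m _ <-]; exact: (cross m n).1].
have yin n : (q n).2.1 <= y <= (q n).2.2.
  apply/andP; split; first by apply: ub_le_sup; [exact: sY.2|exists n].
  by apply: ge_sup; [exact: sY.1|move=> _ [m _ <-]; exact: (cross m n).2].
have [r r0 Hr] := Ploc x y (xin 0%N) (yin 0%N).
have sm (L : R) : 0 < L -> exists n0, forall n, (n0 <= n)%N -> L / 2 ^+ n < r.
  move=> L0; pose n0 := Num.Def.archi_bound (L / r).
  have Hn0 : L / r < n0%:R by apply: archi_boundP; rewrite divr_ge0 // ltW.
  exists n0 => n n0n; rewrite ltr_pdivrMr ?exprn_gt0 // mulrC -ltr_pdivrMr //.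
  apply: lt_le_trans Hn0 _; rewrite (le_trans (_ : _ <= n%:R)) ?ler_nat //.
  by rewrite -natrX ler_nat ltnW // ltn_expl.
have [n1 H1] := sm _ (ltac:(by rewrite subr_gt0) : 0 < b - a).
have [n2 H2] := sm _ (ltac:(by rewrite subr_gt0) : 0 < d - c).
pose n := maxn n1 n2.
have [I1 I2] := qP n; apply.
have [/= M1 M2 M3 M4] := mono 0%N n; rewrite add0n in M1 M2 M3 M4.
apply: (Hr n) => //.
- by rewrite I1 H1 // leq_maxl.
- by rewrite I2 H2 // leq_maxr.
Qed.

End real_tools.

Section mean_value.
Context {R : realType}.
Local Notation C := R[i].
Local Open Scope complex_scope.

Lemma rderP (g : R -> C) (t : R) (d : C) : rder g t d <->
  is_derive t 1 (fun s => complex.Re (g s)) (complex.Re d) /\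
  is_derive t 1 (fun s => complex.Im (g s)) (complex.Im d).
Proof.
split=> [H|[/is_deriveP H1 /is_deriveP H2] e e0].
  split; apply/is_deriveP => e /H[r r0 Hr]; exists r => // h hr.
    have := Hr h; rewrite nm_real => /(_ hr); apply: le_trans.
    by apply: le_trans (nm_Re _); rewrite !ReImE /= mulr0 subr0.
  have := Hr h; rewrite nm_real => /(_ hr); apply: le_trans.
  by apply: le_trans (nm_Im _); rewrite !ReImE /= mulr0 add0r.
have e2 : 0 < e / 2 by lra.
have [r r0 Hr] := H1 _ e2; have [s s0 Hs] := H2 _ e2.
exists (Num.min r s); first by rewrite lt_min r0.
move=> h; rewrite nm_real lt_min => /andP[/Hr {}Hr /Hs {}Hs].
apply: le_trans (nm_le_ReIm _) _; rewrite !ReImE /= !mulr0 subr0 add0r.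
by rewrite [e]splitr mulrDl lerD.
Qed.

(** The real mean value theorem is applied to the projection of the curve on its own increment [v],
    that is to [Re (conj v * g)], whose increment is [|v| ^ 2]. *)
Lemma mean_value_le (g d : R -> C) (a b M : R) : a <= b ->
  (forall s, a <= s <= b -> rder g s (d s)) ->
  (forall s, a <= s <= b -> normc (d s) <= M) ->
  normc (g b - g a) <= M * (b - a).
Proof.
rewrite le_eqVlt => /orP[/eqP<-|ab] Hd HM; first by rewrite !subrr mulr0 nm00.
set v := g b - g a.
pose w := conjc v.
have Hw s : a <= s <= b -> is_derive s 1 (fun s => complex.Re (w * g s)) (complex.Re (w * d s)).
  by move=> /Hd/(gderZ w)/rderP[].
have [c cab E] := MVT_le ab Hw.
have Nw : normc w = normc v by rewrite /w; case: (v) => x y /=; rewrite sqrrN.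
have Ew : complex.Re (w * g b) - complex.Re (w * g a) = normc v ^+ 2.
  by rewrite nm_sqr -ReN -ReD -mulrN -mulrDr -/v /w; case: (v) => x y /=; ring.
have L : complex.Re (w * d c) <= normc v * M.
  apply: le_trans (ler_norm _) _; apply: le_trans (nm_Re _) _; rewrite normcM Nw.
  by rewrite ler_wpM2l ?nm_ge0 ?HM.
have ba : 0 < b - a by rewrite subr_gt0.
have [v0|v0] := eqVneq (normc v) 0.
  by rewrite v0 mulr_ge0 ?(ltW ba) // (le_trans (nm_ge0 (d c))) ?HM.
have vp : 0 < normc v by rewrite lt_neqAle eq_sym v0 nm_ge0.
rewrite -(ler_pM2l vp) -expr2 -Ew E mulrA.
by rewrite ler_wpM2r // ltW.
Qed.

Lemma rder0_cst (g : R -> C) (a b : R) : a <= b ->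
  (forall s, a <= s <= b -> rder g s 0) -> g b = g a.
Proof.
move=> ab H; apply/eqP; rewrite -subr_eq0 -nm_eq0 eq_le nm_ge0 andbT.
have := @mean_value_le g (fun=> 0) a b 0 ab H _; rewrite mul0r; apply.
by move=> s _; rewrite nm00.
Qed.

Definition ccont (f : C -> C) z := forall e : R, 0 < e -> exists2 r : R, 0 < r &
    forall h, normc h < r -> normc (f (z + h) - f z) < e.

Lemma cder_ccont f z d : cder f z d -> ccont f z.
Proof. by move=> H e e0; exact: (gder_cont H e0). Qed.

Lemma rder_antiderivative (g : R -> C) (a b : R) : a < b ->
  (forall x, forall e : R, 0 < e -> exists2 r : R, 0 < r &
    forall h, `|h| < r -> normc (g (x + h) - g x) < e) ->
  exists G : R -> C, forall x, a < x < b -> rder G x (g x).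
Proof.
move=> ab cg.
have [|G1 H1] := @antiderivative R (fun x => complex.Re (g x)) a b ab.
  move=> x e /(cg x)[r r0 Hr]; exists r => // h /Hr; apply: le_lt_trans.
  by apply: le_trans (nm_Re _); rewrite !ReImE.
have [|G2 H2] := @antiderivative R (fun x => complex.Im (g x)) a b ab.
  move=> x e /(cg x)[r r0 Hr]; exists r => // h /Hr; apply: le_lt_trans.
  by apply: le_trans (nm_Im _); rewrite !ReImE.
exists (fun x => G1 x +i* G2 x) => x xab.
by apply/rderP; split; [exact: H1|exact: H2].
Qed.

End mean_value.

(** * Goursat's theorem and isolated zeros *)

Section goursat.
Context {R : realType}.
Local Notation C := R[i].
Local Open Scope complex_scope.

Lemma rder_compare (G Q g q : R -> C) (a b M : R) :
  (forall s, Num.min a b <= s <= Num.max a b ->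
     [/\ rder G s (g s), rder Q s (q s) & normc (g s - q s) <= M]) ->
  normc ((G b - G a) - (Q b - Q a)) <= M * `|b - a|.
Proof.
have key x y : x <= y -> (forall s, x <= s <= y ->
     [/\ rder G s (g s), rder Q s (q s) & normc (g s - q s) <= M]) ->
    normc ((G y - G x) - (Q y - Q x)) <= M * (y - x).
  move=> xy H; rewrite (_ : _ - _ = (G y - Q y) - (G x - Q x)); last by ring.
  apply: (mean_value_le (g := fun s => G s - Q s) (d := fun s => g s - q s) xy).
    by move=> s /H[H1 H2 _]; exact: gderB.
  by move=> s /H[].
have [ab|ba] := leP a b => H; first by rewrite ger0_norm ?subr_ge0 //; exact: key.
rewrite ltr0_norm ?subr_lt0 // (_ : - (b - a) = a - b) ?opprB // -nmN.
rewrite (_ : - _ = (G a - G b) - (Q a - Q b)); last by ring.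
by apply: key => //; exact: ltW.
Qed.

Lemma horizontal_rder (f : C -> C) (x y : R) d : cder f (x +i* y) d ->
  rder (fun s => f (s +i* y)) x d.
Proof.
move=> H e /H[r r0 Hr]; exists r => // h hr.
by have := Hr h%:C hr; rewrite (_ : x +i* y + h%:C = (x + h) +i* y)//; apply: complex_eqP => /=; ring.
Qed.

Lemma vertical_rder (f : C -> C) (x y : R) d : cder f (x +i* y) d ->
  rder (fun s => f (x +i* s)) y (d * 'i).
Proof.
move=> H e /H[r r0 Hr]; exists r => // h hr.
have E : normc ('i * h%:C) = normc h%:C.
  by rewrite normcM [normc 'i]/normc expr0n expr1n add0r sqrtr1 mul1r.
have := Hr ('i * h%:C); rewrite E => /(_ hr).
rewrite (_ : x +i* y + 'i * h%:C = x +i* (y + h)) ?mulrA //.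
by apply: complex_eqP => /=; ring.
Qed.

Variables (f : C -> C) (a0 b0 c0 d0 : R) (E : seq C).
Hypothesis f_cont : forall z, ccont f z.
Hypothesis f_cder : forall x y, a0 < x < b0 -> c0 < y < d0 -> x +i* y \notin E ->
  exists d, cder f (x +i* y) d.

Variables A B : R -> R -> C.
Hypothesis A_rder : forall y x, a0 < x < b0 -> rder (A y) x (f (x +i* y)).
Hypothesis B_rder : forall x y, c0 < y < d0 -> rder (B x) y (f (x +i* y)).

(** The integral of [f] counterclockwise around the rectangle, expressed by increments of
    antiderivatives along horizontal and vertical lines; additivity under quartering thereby becomes
    a ring identity. *)
Let I a b c d := (A c b - A c a) + 'i * (B b d - B b c) - (A d b - A d a) - 'i * (B a d - B a c).

(* An additive set function giving mass at least 1 to every rectangle that meets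
   [e]; it absorbs the exceptional points in the Goursat argument. *)
Let nu (e : C) a b c d := (Num.sg (b - complex.Re e) - Num.sg (a - complex.Re e)) *
  (Num.sg (d - complex.Im e) - Num.sg (c - complex.Im e)).

(** The weight against which [I] is measured: additive like [I], at least the area, and at least 1
    on rectangles containing an exceptional point. *)
Let W a b c d := (b - a) * (d - c) + \sum_(e <- E) nu e a b c d.

Let sg_mono (x a b : R) : a <= b -> Num.sg (a - x) <= Num.sg (b - x).
Proof. by move=> ab; case: sgrP => ?; case: sgrP => ?; lra. Qed.

Let sg_jump (x a b : R) : a <= x <= b -> a < b -> 1 <= Num.sg (b - x) - Num.sg (a - x).
Proof. by move=> /andP[ax xb] ab; case: sgrP => ?; case: sgrP => ?; lra. Qed.

Let nu_ge0 e a b c d : a <= b -> c <= d -> 0 <= nu e a b c d.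
Proof. by move=> ab cd; rewrite mulr_ge0 ?subr_ge0 ?sg_mono. Qed.

Let W_ge1 e a b c d : e \in E -> a < b -> c < d -> a <= complex.Re e <= b ->
  c <= complex.Im e <= d -> 1 <= W a b c d.
Proof.
move=> eE ab cd h1 h2; rewrite /W.
have p : 0 < (b - a) * (d - c) by rewrite mulr_gt0 // subr_gt0.
rewrite (big_rem e) //=.
have n1 : 1 <= nu e a b c d by rewrite -[1]mulr1 ler_pM // sg_jump.
have n2 : 0 <= \sum_(y <- rem e E) nu y a b c d.
  by apply: sumr_ge0 => ? _; apply: nu_ge0; exact: ltW.
lra.
Qed.

Let nm_i (z : C) : normc ('i * z) = normc z.
Proof. by rewrite normcM [normc 'i]/normc expr0n expr1n add0r sqrtr1 mul1r. Qed.

(* The four edges of the boundary, compared with the antiderivative [Q] of the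
   affine approximation [q] of [f]; the contribution of [Q] telescopes. *)
Let edges (Q q : C -> C) (M a b c d : R) : a0 < a -> b < b0 -> c0 < c -> d < d0 ->
  a < b -> c < d -> (forall z, cder Q z (q z)) ->
  (forall x y, a <= x <= b -> c <= y <= d -> normc (f (x +i* y) - q (x +i* y)) <= M) ->
  normc (I a b c d) <= 2 * M * ((b - a) + (d - c)).
Proof.
move=> a0a bb0 c0c dd0 ab cd HQ HM.
have ha y : c <= y <= d -> normc (A y b - A y a - (Q (b +i* y) - Q (a +i* y))) <= M * (b - a).
  move=> ycd; rewrite -[X in _ * X]ger0_norm; last by rewrite subr_ge0 ltW.
  apply: (@rder_compare (A y) (fun s => Q (s +i* y)) (fun s => f (s +i* y)) (fun s => q (s +i* y))) => s.
  rewrite (min_idPl (ltW ab)) (max_idPr (ltW ab)) => /andP[as_ sb]; split.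
  - by apply: A_rder; apply/andP; split; lra.
  - exact: horizontal_rder.
  - by apply: HM => //; rewrite as_.
have hb x : a <= x <= b -> normc ('i * (B x d - B x c) - (Q (x +i* d) - Q (x +i* c))) <= M * (d - c).
  move=> xab; rewrite -[X in _ <= _ * X]ger0_norm; last by rewrite subr_ge0 ltW.
  rewrite mulrBr.
  apply: (@rder_compare (fun s => 'i * B x s) (fun s => Q (x +i* s))
    (fun s => 'i * f (x +i* s)) (fun s => q (x +i* s) * 'i)) => s.
  rewrite (min_idPl (ltW cd)) (max_idPr (ltW cd)) => /andP[cs sd]; split.
  - by apply: gderZ; apply: B_rder; apply/andP; split; lra.
  - exact: vertical_rder.
  - by rewrite [q _ * _]mulrC -mulrBr nm_i; apply: HM => //; rewrite cs.
have -> : I a b c d =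
  (A c b - A c a - (Q (b +i* c) - Q (a +i* c))) +
  ('i * (B b d - B b c) - (Q (b +i* d) - Q (b +i* c))) +
  (- (A d b - A d a - (Q (b +i* d) - Q (a +i* d))) +
  - ('i * (B a d - B a c) - (Q (a +i* d) - Q (a +i* c)))).
  by rewrite /I; ring.
apply: le_trans (nmD _ _) _.
have n1 := nmD (A c b - A c a - (Q (b +i* c) - Q (a +i* c)))
  ('i * (B b d - B b c) - (Q (b +i* d) - Q (b +i* c))).
have n2 := nmD (- (A d b - A d a - (Q (b +i* d) - Q (a +i* d))))
  (- ('i * (B a d - B a c) - (Q (a +i* d) - Q (a +i* c)))).
rewrite 2!(nmN (_ - _)) in n2.
have la : a <= a <= b by rewrite lexx ltW.
have lb : a <= b <= b by rewrite lexx ltW.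
have lc : c <= c <= d by rewrite lexx ltW.
have ld : c <= d <= d by rewrite lexx ltW.
have := ha c lc; have := ha d ld; have := hb a la; have := hb b lb.
lra.
Qed.

(** The bound [|I| <= e W] passes from the quarters to the whole, so only small rectangles around a
    point matter. At an exceptional point boundedness of [f] suffices, because [W >= 1] there while
    the perimeter is small; elsewhere the affine approximation is used. *)
Let goursat_lt a b c d : a0 < a -> b < b0 -> c0 < c -> d < d0 -> a < b -> c < d ->
  I a b c d = 0.
Proof.
move=> a0a bb0 c0c dd0 ab cd.
have W0 : 0 < W a b c d.
  rewrite /W ltr_pwDl ?mulr_gt0 ?subr_gt0 //.
  by apply: sumr_ge0 => ? _; apply: nu_ge0; exact: ltW.
suff H (e : R) : 0 < e -> normc (I a b c d) <= e * W a b c d.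
  apply/eqP; rewrite -nm_eq0 eq_le nm_ge0 andbT leNgt; apply/negP => n0.
  have := H (normc (I a b c d) / W a b c d / 2) ltac:(by rewrite !divr_gt0).
  set n := normc _ in n0 *; set w := W a b c d in W0 *.
  rewrite (_ : n / w / 2 * w = n / 2); [lra|by field; rewrite gt_eqF].
move=> e0.
pose P a b c d := normc (I a b c d) <= e * W a b c d.
apply: (@rect_ind R a b c d P ab cd).
  move=> a' b' m c' d' n _ _ H1 H2 H3 H4; rewrite /P.
  have -> : I a' b' c' d' = (I a' m c' n + I m b' c' n) + (I a' m n d' + I m b' n d').
    by rewrite /I; ring.
  have -> : W a' b' c' d' = (W a' m c' n + W m b' c' n) + (W a' m n d' + W m b' n d').
    have S : \sum_(e <- E) nu e a' b' c' d' =
        (\sum_(e <- E) nu e a' m c' n + \sum_(e <- E) nu e m b' c' n) +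
        (\sum_(e <- E) nu e a' m n d' + \sum_(e <- E) nu e m b' n d').
      by rewrite -!big_split /=; apply: eq_bigr => u _; rewrite /nu; ring.
    by rewrite /W S; ring.
  apply: le_trans (nmD _ _) _; rewrite mulrDr; apply: lerD.
    by apply: le_trans (nmD _ _) _; rewrite mulrDr; exact: lerD.
  by apply: le_trans (nmD _ _) _; rewrite mulrDr; exact: lerD.
move=> x y xab ycd; rewrite /P; set z := x +i* y.
have sub (a' b' c' d' u v : R) : a' <= x <= b' -> c' <= y <= d' ->
    a' <= u <= b' -> c' <= v <= d' -> normc (u +i* v - z) <= (b' - a') + (d' - c').
  move=> h1 h2 h3 h4; apply: le_trans (nm_le_ReIm _) _ => /=.
  by apply: lerD; rewrite ler_norml; apply/andP; split; lra.
have [zE|zE] := boolP (z \in E).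
  have [r r0 Hr] := f_cont z ltr01.
  set M := normc (f z) + 1.
  have M0 : 0 < M by rewrite /M; have := nm_ge0 (f z); lra.
  exists (Num.min (r / 2) (e / (4 * M))); first by rewrite lt_min !divr_gt0 // mulr_gt0.
  move=> k a' b' c' d' aa bb cc dd xa yc ab' cd' _ _.
  rewrite !lt_min => /andP[s1 s2] /andP[s3 s4].
  have Hw : 1 <= W a' b' c' d' by exact: (@W_ge1 z).
  apply: le_trans (_ : e <= _); last by rewrite ler_peMr // ltW.
  have := @edges (fun=> 0) (fun=> 0) M a' b' c' d'.
  have -> : a0 < a' by lra. have -> : b' < b0 by lra.
  have -> : c0 < c' by lra. have -> : d' < d0 by lra.
  move=> /(_ isT isT isT isT ab' cd' (fun z => gder_cst _ _ _)) H.
  apply: le_trans (H _) _.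
    move=> u v hu hv; rewrite subr0.
    have := Hr (u +i* v - z) (le_lt_trans (sub _ _ _ _ _ _ xa yc hu hv) _).
    rewrite (_ : z + _ = u +i* v); last by ring.
    move=> HH; have {}HH := HH ltac:(lra).
    apply: le_trans (nm_le_add (f z) (f (u +i* v))) _.
    by rewrite /M addrC lerD2l ltW.
  rewrite ltr_pdivlMr ?mulr_gt0 // in s2; rewrite ltr_pdivlMr ?mulr_gt0 // in s4; lra.
have [d1 Hd] : exists d, cder f z d by apply: f_cder => //; apply/andP; split; lra.
pose u := b - a; pose v := d - c.
have u0 : 0 < u by rewrite subr_gt0.
have v0 : 0 < v by rewrite subr_gt0.
have uv0 : 0 < (u + v) ^+ 2 by rewrite exprn_gt0 // addr_gt0.
(* [(u + v) ^ 2 / (u v)] compares the square of half the perimeter with the area; quartering does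
   not change it, and this [e'] turns the bound [2 e' L ^ 2] of the boundary integral into exactly
   [e] times the area. *)
pose e' := e * (u * v) / (2 * (u + v) ^+ 2).
have e'0 : 0 < e' by apply: divr_gt0; [rewrite mulr_gt0 // mulr_gt0|rewrite mulr_gt0].
have [r r0 Hr] := Hd e' e'0.
exists (r / 2); first by rewrite divr_gt0.
move=> k a' b' c' d' aa bb cc dd xa yc ab' cd' E1 E2 s1 s2.
pose q w := f z + d1 * (w - z).
pose Q w := f z * w + d1 * (2^-1 * ((w - z) * (w - z))).
have HQ w : cder Q w (q w).
  rewrite /Q /q; apply: gderD; first exact: cder_scale.
  apply: gderZ; rewrite (_ : w - z = 2^-1 * (2 * (w - z))); last by field.
  apply: gderZ; apply: (@cder_shift _ (fun x => x * x) (- z)); exact: cder_sqr.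
set L := (b' - a') + (d' - c').
apply: le_trans (edges (lt_le_trans a0a aa) (le_lt_trans bb bb0) (lt_le_trans c0c cc)
  (le_lt_trans dd dd0) ab' cd' HQ (M := e' * L) _) _.
  move=> s t hs ht; have hst := sub _ _ _ _ _ _ xa yc hs ht.
  have := Hr (s +i* t - z) ltac:(by apply: le_lt_trans hst _; lra).
  rewrite (_ : z + _ = s +i* t); last by ring.
  rewrite /q opprD addrA => H; apply: le_trans H _.
  by rewrite ler_pM2l.
have Wl : (b' - a') * (d' - c') <= W a' b' c' d'.
  by rewrite /W lerDl; apply: sumr_ge0 => ? _; apply: nu_ge0; exact: ltW.
apply: le_trans (_ : _ <= e * ((b' - a') * (d' - c'))) _; last by rewrite ler_pM2l.
rewrite -/L (_ : 2 * (e' * L) * L = e' * 2 * L ^+ 2); last by ring.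
have p2 : (2 : R) ^+ k != 0 by rewrite gt_eqF // exprn_gt0.
have LE : L = (u + v) / 2 ^+ k by rewrite /L E1 E2 -/u -/v; field.
rewrite LE E1 E2 -/u -/v /e' le_eqVlt; apply/orP; left; apply/eqP.
by field; rewrite p2 gt_eqF // addr_gt0.
Qed.

Let goursat a b c d : a0 < a < b0 -> a0 < b < b0 -> c0 < c < d0 -> c0 < d < d0 ->
  I a b c d = 0.
Proof.
wlog: a b / a <= b => [H|].
  have [ab|ba] := leP a b; first exact: H.
  move=> ha hb hc hd; have := H b a (ltW ba) hb ha hc hd => /eqP.
  by rewrite -oppr_eq0 => /eqP <-; rewrite /I; ring.
wlog: c d / c <= d => [H|].
  have [cd|dc] := leP c d; first exact: H.
  move=> ab ha hb hc hd; have := H d c (ltW dc) ab ha hb hd hc => /eqP.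
  by rewrite -oppr_eq0 => /eqP <-; rewrite /I; ring.
rewrite le_eqVlt => /orP[/eqP<- *|cd]; first by rewrite /I; ring.
rewrite le_eqVlt => /orP[/eqP<- *|ab]; first by rewrite /I; ring.
by move=> /andP[h1 h2] /andP[h3 h4] /andP[h5 h6] /andP[h7 h8]; exact: goursat_lt.
Qed.

(** As [I] vanishes, the way along the height [y0] may be replaced by the way along the height [y].
    The increment from [x + i y] then consists of one horizontal and one vertical piece close to
    that point, where [f] is nearly constant. *)
Lemma primitive_rect x0 y0 : a0 < x0 < b0 -> c0 < y0 < d0 ->
  forall x y, a0 < x < b0 -> c0 < y < d0 ->
  cder (fun z => A y0 (complex.Re z) - A y0 x0 +
    'i * (B (complex.Re z) (complex.Im z) - B (complex.Re z) y0)) (x +i* y) (f (x +i* y)).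
Proof.
move=> hx0 hy0 x y hx hy e e0.
have [r r0 Hr] := f_cont (x +i* y) (ltac:(lra) : 0 < e / 2).
pose m := Num.min (Num.min (x - a0) (b0 - x)) (Num.min (y - c0) (d0 - y)).
have m0 : 0 < m by rewrite /m !lt_min; apply/andP; split; apply/andP; split; lra.
exists (Num.min (r / 2) m); first by rewrite lt_min m0 divr_gt0.
move=> h; rewrite /m !lt_min => /and3P[hr /andP[h1 h2] /andP[h3 h4]].
case: h hr h1 h2 h3 h4 => p q hr h1 h2 h3 h4.
have Np := nm_Re (p +i* q); have Nq := nm_Im (p +i* q); rewrite /= in Np Nq.
set n := Num.sqrt _ in Np Nq.
have En : normc (p +i* q) = n by [].
rewrite En in hr h1 h2 h3 h4.
have [Np1 Np2] : - n <= p /\ p <= n by move: Np; rewrite ler_norml => /andP[].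
have [Nq1 Nq2] : - n <= q /\ q <= n by move: Nq; rewrite ler_norml => /andP[].
have hxp : a0 < x + p < b0 by apply/andP; split; lra.
have hyq : c0 < y + q < d0 by apply/andP; split; lra.
have G := goursat hx hxp hy0 hy.
rewrite [normc (p +i* q)]/normc -/n /=.
rewrite (_ : _ - _ - _ = (A y (x + p) - A y x - (f (x +i* y) * (x + p)%:C - f (x +i* y) * x%:C))
  + 'i * (B (x + p) (y + q) - B (x + p) y - (f (x +i* y) * (y + q)%:C - f (x +i* y) * y%:C))); last first.
  have -> : A y (x + p) = A y x + ((A y0 (x + p) - A y0 x) + 'i * (B (x + p) y - B (x + p) y0) - 'i * (B x y - B x y0)).
    by apply/eqP; rewrite -subr_eq0 -[_ - _]opprK oppr_eq0 -G /I; apply/eqP; ring.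
  have -> : p +i* q = p%:C + 'i * q%:C by apply: complex_eqP => /=; ring.
  by rewrite !rmorphD /=; ring.
apply: le_trans (nmD _ _) _; rewrite nm_i.
have near s t : `|s - x| <= `|p| -> `|t - y| <= `|q| -> normc (f (s +i* t) - f (x +i* y)) <= e / 2.
  move=> hs ht; have := Hr ((s - x) +i* (t - y)).
  rewrite (_ : x +i* y + _ = s +i* t); last by apply: complex_eqP => /=; ring.
  move=> H; apply/ltW/H; apply: le_lt_trans (nm_le_ReIm _) _ => /=; lra.
have -> : e * n = e / 2 * n + e / 2 * n by lra.
have e2 : 0 < e / 2 by lra.
apply: lerD.
  apply: le_trans (_ : _ <= e / 2 * `|x + p - x|) _; last by rewrite addrAC subrr add0r ler_pM2l.
  apply: (@rder_compare (A y) (fun s => f (x +i* y) * s%:C) (fun s => f (s +i* y)) (fun=> f (x +i* y))) => s hs.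
  have hs' : `|s - x| <= `|p|.
    move: hs; case: (leP x (x + p)) => h /andP[s1 s2].
      have p0 : 0 <= p by lra.
      by rewrite ger0_norm ?(ger0_norm p0); lra.
    have p0 : p <= 0 by lra.
    by rewrite ler0_norm ?(ler0_norm p0); lra.
  split.
  - by apply: A_rder; move: hs'; rewrite ler_norml => /andP[]; lra.
  - by have := gderZ (f (x +i* y)) (rder_id s); rewrite mulr1.
  - by apply: near; rewrite // subrr normr0.
apply: le_trans (_ : _ <= e / 2 * `|y + q - y|) _; last by rewrite addrAC subrr add0r ler_pM2l.
apply: (@rder_compare (B (x + p)) (fun s => f (x +i* y) * s%:C) (fun s => f ((x + p) +i* s)) (fun=> f (x +i* y))) => s hs.
have hs' : `|s - y| <= `|q|.
  move: hs; case: (leP y (y + q)) => h /andP[s1 s2].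
    have p0 : 0 <= q by lra.
    by rewrite ger0_norm ?(ger0_norm p0); lra.
  have p0 : q <= 0 by lra.
  by rewrite ler0_norm ?(ler0_norm p0); lra.
split.
- by apply: B_rder; move: hs'; rewrite ler_norml => /andP[]; lra.
- by have := gderZ (f (x +i* y)) (rder_id s); rewrite mulr1.
- by apply: near; rewrite // addrAC subrr add0r.
Qed.

End goursat.

Section primitive.
Context {R : realType}.
Local Notation C := R[i].
Local Open Scope complex_scope.

(** The exceptional points serve quotients such as [(f z - f w) / (z - w)], known to be continuous,
    but not known to be differentiable, at [w]. *)
Lemma primitive (f : C -> C) (z0 : C) (r : R) (E : seq C) : 0 < r ->
  (forall z, ccont f z) ->
  (forall z, `|complex.Re (z - z0)| < r -> `|complex.Im (z - z0)| < r -> z \notin E ->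
     exists d, cder f z d) ->
  exists G, forall z, normc (z - z0) < r -> cder G z (f z).
Proof.
move=> r0 fc fd; case: z0 fd => x0 y0 fd.
have xr : x0 - r < x0 + r by lra.
have yr : y0 - r < y0 + r by lra.
have [|A HA] := @boolp.choice _ _ (fun y G => forall x, x0 - r < x < x0 + r -> rder G x (f (x +i* y))).
  move=> y.
  apply: (rder_antiderivative (g := fun x => f (x +i* y))) => // x e /(fc (x +i* y))[s s0 Hs].
  exists s => // h hs; have := Hs h%:C; rewrite nm_real => /(_ hs).
  by rewrite (_ : x +i* y + h%:C = (x + h) +i* y) //; apply: complex_eqP => /=; ring.
have [|B HB] := @boolp.choice _ _ (fun x G => forall y, y0 - r < y < y0 + r -> rder G y (f (x +i* y))).
  move=> x.
  apply: (rder_antiderivative (g := fun y => f (x +i* y))) => // y e /(fc (x +i* y))[s s0 Hs].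
  exists s => // h hs; have := Hs (0 +i* h).
  rewrite (_ : x +i* y + 0 +i* h = x +i* (y + h)); last by apply: complex_eqP => /=; ring.
  by apply; rewrite /= expr0n add0r sqrtr_sqr.
have fd' x y : x0 - r < x < x0 + r -> y0 - r < y < y0 + r -> x +i* y \notin E ->
    exists d, cder f (x +i* y) d.
  move=> /andP[h1 h2] /andP[h3 h4]; apply: fd => /=; rewrite ltr_norml; apply/andP; split; lra.
have hx0 : x0 - r < x0 < x0 + r by apply/andP; split; lra.
have hy0 : y0 - r < y0 < y0 + r by apply/andP; split; lra.
eexists => -[x y] hz; apply: (primitive_rect fc fd' HA HB hx0 hy0).
  have := le_lt_trans (nm_Re _) hz; rewrite /= ltr_norml => /andP[]; lra.
have := le_lt_trans (nm_Im _) hz; rewrite /= ltr_norml => /andP[]; lra.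
Qed.

End primitive.

Section isolated_zeros.
Context {R : realType}.
Local Notation C := R[i].
Local Open Scope complex_scope.

(** Compactness of a closed disc in the form of an induction on sets, obtained by quartering a
    square around the disc. Bounds, positive minima and cluster points are all extracted through a
    suitable [P]. *)
Lemma bounded_ind (a : C) (r : R) (P : set C -> Prop) :
  (forall A B, A `<=` B -> P B -> P A) ->
  (forall A B, P A -> P B -> P (A `|` B)) ->
  (forall z, exists2 e : R, 0 < e & P [set w | normc (w - z) < e]) ->
  P [set w | normc (w - a) <= r].
Proof.
move=> Psub PU Ploc.
pose Q (x1 x2 y1 y2 : R) := P [set w : C | x1 <= complex.Re w <= x2 /\ y1 <= complex.Im w <= y2].
(* [r] may be negative or zero, whereas the square needs sides of positive length. *)
pose s := `|r| + 1.
have s0 : 0 < s by rewrite /s; have := normr_ge0 r; lra.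
suff H : Q (complex.Re a - s) (complex.Re a + s) (complex.Im a - s) (complex.Im a + s).
  apply: Psub H => w /= wr.
  have := le_trans (nm_Re (w - a)) wr; have := le_trans (nm_Im (w - a)) wr.
  rewrite !ReImE !ler_norml /s; have := ler_norm r => h1 /andP[h2 h3] /andP[h4 h5].
  by split; apply/andP; split; lra.
apply: rect_ind; [lra|lra| |].
  move=> x1 x2 m y1 y2 n _ _ H1 H2 H3 H4.
  apply: Psub (PU _ _ (PU _ _ H1 H2) (PU _ _ H3 H4)) => w [/andP[h1 h2] /andP[h3 h4]].
  have [xm|xm] := leP (complex.Re w) m; have [yn|yn] := leP (complex.Im w) n.
  - by left; left; rewrite /= h1 h3 xm yn.
  - by right; left; rewrite /= h1 h4 xm ltW.
  - by left; right; rewrite /= h2 h3 yn ltW.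
  - by right; right; rewrite /= h2 h4 !ltW.
move=> x y _ _; have [e e0 He] := Ploc (x +i* y).
exists (e / 2); first by rewrite divr_gt0.
move=> k a' b' c' d' _ _ _ _ /andP[h1 h2] /andP[h3 h4] _ _ _ _ h5 h6.
apply: Psub He => w [/andP[h7 h8] /andP[h9 h10]] /=.
apply: le_lt_trans (nm_le_ReIm _) _; rewrite !ReImE /= [e]splitr.
by apply: ltrD; rewrite ltr_norml; apply/andP; split; lra.
Qed.

Lemma ccont_bounded (f : C -> C) a r : (forall z, ccont f z) ->
  exists M, forall z, normc (z - a) <= r -> normc (f z) <= M.
Proof.
move=> fc.
apply: (@bounded_ind a r (fun A => exists M, forall z, A z -> normc (f z) <= M)).
- by move=> A B AB [M HM]; exists M => z /AB/HM.
- move=> A B [M HM] [N HN]; exists (Num.max M N) => z; rewrite le_max.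
  by case=> [/HM ->|/HN ->]; rewrite ?orbT.
- move=> z; have [e e0 He] := fc z _ ltr01; exists e => //; exists (normc (f z) + 1).
  move=> w /= /He; rewrite (addrC z) subrK => h.
  by apply: le_trans (nm_le_add (f z) _) _; rewrite addrC lerD2l ltW.
Qed.

Lemma ccont_near (f g : C -> C) z (r : R) : 0 < r ->
  (forall h, normc h < r -> f (z + h) = g (z + h)) -> ccont f z -> ccont g z.
Proof.
move=> r0 fg fc e /fc[s s0 Hs]; exists (Num.min r s); first by rewrite lt_min r0.
have gz : f z = g z by have := fg 0; rewrite addr0 nm00; apply.
by move=> h; rewrite lt_min => /andP[/fg <- /Hs]; rewrite gz.
Qed.

Lemma ccontM (f g : C -> C) z : ccont f z -> ccont g z -> ccont (fun x => f x * g x) z.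
Proof.
move=> fc gc e e0.
have [r r0 Hr] := fc 1 ltr01.
set M := normc (f z) + 1; have M0 : 0 < M by rewrite /M; have := nm_ge0 (f z); lra.
set N := normc (g z) + 1; have N0 : 0 < N by rewrite /N; have := nm_ge0 (g z); lra.
have [s s0 Hs] := fc (e / 2 / N) ltac:(by rewrite !divr_gt0).
have [t t0 Ht] := gc (e / 2 / M) ltac:(by rewrite !divr_gt0).
exists (Num.min r (Num.min s t)); first by rewrite !lt_min r0 s0.
move=> h; rewrite !lt_min => /and3P[/Hr h1 /Hs h2 /Ht h3].
rewrite (_ : _ - _ = f (z + h) * (g (z + h) - g z) + (f (z + h) - f z) * g z); last by ring.
apply: le_lt_trans (nmD _ _) _; rewrite !normcM [e]splitr; apply: ltr_leD.
  apply: le_lt_trans (_ : _ <= M * normc (g (z + h) - g z)) _.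
    apply: ler_wpM2r; first exact: nm_ge0.
    by apply: le_trans (nm_le_add (f z) _) _; rewrite addrC lerD2l ltW.
  by rewrite mulrC -ltr_pdivlMr.
apply: le_trans (_ : _ <= normc (f (z + h) - f z) * N) _.
  by apply: ler_wpM2l; [exact: nm_ge0|rewrite /N lerDl].
by rewrite -ler_pdivlMr // ltW.
Qed.

Lemma ccontB_cst (f : C -> C) c z : ccont f z -> ccont (fun x => f x - c) z.
Proof.
move=> fc e /fc[r r0 Hr]; exists r => // h /Hr.
by rewrite (_ : _ - _ - _ = f (z + h) - f z) //; ring.
Qed.

Lemma cder_div (f : C -> C) c z d : z != c -> cder f z d ->
  exists d', cder (fun x => f x / (x - c)) z d'.
Proof.
move=> zc fd; eexists; apply: gder_mul fd _.
by apply: (@cder_shift _ GRing.inv (- c)); apply: cder_inv; rewrite subr_eq0.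
Qed.

(** The quotient takes the value of the derivative at [c], which makes it continuous there; instead
    of being proved a point of differentiability, [c] joins the exceptional points. *)
Lemma divide_zero (f : C -> C) (E : seq C) c : (forall z, ccont f z) ->
  (forall z, z \notin E -> exists d, cder f z d) -> c \notin E -> f c = 0 ->
  exists g, [/\ forall z, ccont g z,
    forall z, z \notin c :: E -> exists d, cder g z d &
    forall z, f z = (z - c) * g z].
Proof.
move=> fc fd cE fc0; have [d0 Hd0] := fd c cE.
pose g z := if z == c then d0 else f z / (z - c).
have gE z : z != c -> g z = f z / (z - c) by rewrite /g => /negbTE ->.
have far z h : z != c -> normc h < normc (z - c) -> z + h != c.
  move=> zc; apply: contraTneq => E1.
  by rewrite -leNgt (_ : h = - (z - c)) ?nmN // -E1; ring.
have far0 z : z != c -> 0 < normc (z - c) by move=> zc; rewrite nm_gt0 subr_eq0.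
exists g; split.
- move=> z; have [->|zc] := eqVneq z c.
    move=> e e0; have [r r0 Hr] := Hd0 (e / 2) ltac:(by rewrite divr_gt0).
    exists r => // h hr; rewrite /g eqxx.
    case: ifP => [_|/negbT hc]; first by rewrite subrr nm00.
    have h0 : h != 0 by apply: contra hc => /eqP ->; rewrite addr0.
    have := Hr h hr; rewrite fc0 subr0.
    rewrite (_ : c + h - c = h); last by ring.
    rewrite (_ : f (c + h) / h - d0 = (f (c + h) - d0 * h) / h); last by field.
    rewrite normcM normcV => H.
    apply: le_lt_trans (_ : _ <= e / 2) _; last by lra.
    by rewrite ler_pdivrMr // nm_gt0.
  apply: (@ccont_near (fun x => f x * (x - c)^-1) g z (normc (z - c))); first exact: far0.
    by move=> h hr; rewrite gE //; exact: far.
  apply: ccontM; first exact: fc.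
  apply: (@cder_ccont _ _ _ (- (z - c)^-2)).
  by apply: (@cder_shift _ GRing.inv (- c)); apply: cder_inv; rewrite subr_eq0.
- move=> z; rewrite in_cons negb_or => /andP[zc zE].
  have [d Hd] := fd z zE; have [d' Hd'] := cder_div zc Hd.
  exists d'; apply: gder_ext (far0 _ zc) _ _ Hd'; last by rewrite gE.
  by move=> h hr; rewrite gE //; exact: far.
- move=> z; have [->|zc] := eqVneq z c; first by rewrite subrr mul0r.
  by rewrite gE // mulrC divfK // subr_eq0.
Qed.

Lemma expi_rder (t : R) : rder (fun s => cos s +i* sin s) t ('i * (cos t +i* sin t)).
Proof.
apply/rderP; split => /=.
  by rewrite mul0r mul1r sub0r; exact: is_derive_cos.
by rewrite mul0r mul1r add0r; exact: is_derive_sin.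
Qed.

Lemma nm_expi (t : R) : normc (cos t +i* sin t) = 1.
Proof. by rewrite /= cos2Dsin2 sqrtr1. Qed.

(* With [P' = (f - f w) / (z - w)], the curve
   [P (w + r e^{i t}) + i t f w] has derivative [i f (w + r e^{i t})]. *)
Lemma mean_value_circle (f : C -> C) (E : seq C) w r M : 0 < r -> (forall z, ccont f z) ->
  (forall z, z \notin E -> exists d, cder f z d) -> w \notin E ->
  (forall z, normc (z - w) = r -> normc (f z) <= M) -> normc (f w) <= M.
Proof.
move=> r0 fc fd wE HM.
have [||||g [gc gd gE]] := @divide_zero (fun z => f z - f w) E w.
- by move=> z; exact: ccontB_cst.
- by move=> z /fd[d Hd]; exists d; rewrite -[d]subr0; apply: gderB Hd (gder_cst _ _ _).
- by [].
- by rewrite subrr.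
have [||G HG] := @primitive R g w (2 * r) (w :: E) _ gc; first by lra.
  by move=> z _ _; exact: gd.
pose e (t : R) := cos t +i* sin t.
pose psi (t : R) := G (w + r%:C * e t) + ('i * f w) * t%:C.
have Hpsi t : rder psi t ('i * f (w + r%:C * e t)).
  have n1 : normc (w + r%:C * e t - w) = r.
    by rewrite addrAC subrr add0r normcM nm_expi mulr1 nm_real gtr0_norm.
  have HG' := HG (w + r%:C * e t) ltac:(by rewrite n1; lra).
  have := gderZ r%:C (expi_rder t) => /(gderD_cst w).
  rewrite (_ : (fun s => _ + w) = (fun s => w + r%:C * e s)); last first.
    by apply/funext => s; rewrite addrC.
  move=> /(cder_curve (g := fun s => w + r%:C * e s) HG').
  have := gderZ ('i * f w) (rder_id t) => h1 h2.
  have := gderD h2 h1; rewrite mulr1.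
  rewrite (_ : _ + 'i * f w = 'i * f (w + r%:C * e t)) //.
  have -> : f (w + r%:C * e t) = f w + r%:C * e t * g (w + r%:C * e t).
    by rewrite -[LHS](subrK (f w)) gE addrC; congr (_ + _ * _); ring.
  by rewrite -/(e t); ring.
have := @mean_value_le R psi _ 0 (2 * pi) M _ (fun t _ => Hpsi t) _.
have pi0 := pi_gt0 R.
(* After a full turn [G] returns to its value, so the increment of [psi] is [2 pi i f w]. *)
rewrite {1 2}/psi /e cos0 sin0 mulr_natl cos2pi sin2pi rmorph0 !mulr0 addr0 subr0.
rewrite addrAC subrr add0r normcM nm_real.
rewrite normcM [normc 'i]/normc expr0n expr1n add0r sqrtr1 mul1r.
have pi2 : 0 < (pi : R) *+ 2 by rewrite mulrn_wgt0.
rewrite (gtr0_norm pi2) => H; rewrite -(ler_pM2r pi2); apply: H.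
  by rewrite mulrn_wge0 // ltW.
move=> s _; rewrite normcM [normc 'i]/normc expr0n expr1n add0r sqrtr1 mul1r.
by apply: HM; rewrite addrAC subrr add0r normcM nm_expi mulr1 nm_real gtr0_norm.
Qed.

Lemma factor_zeros (F : C -> C) (s : seq C) : (forall z, exists d, cder F z d) ->
  uniq s -> (forall z, z \in s -> F z = 0) ->
  exists g, [/\ forall z, ccont g z,
    forall z, z \notin s -> exists d, cder g z d &
    forall z, F z = \prod_(x <- s) (z - x) * g z].
Proof.
move=> Fd; elim: s => [|x s IH] /=.
  move=> _ _; exists F; split => //; last by move=> z; rewrite big_nil mul1r.
  by move=> z; have [d Hd] := Fd z; exact: cder_ccont Hd.
move=> /andP[xs us] Hz.
have [|g [gc gd gE]] := IH us; first by move=> z zs; apply: Hz; rewrite in_cons zs orbT.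
have gx : g x = 0.
  have := Hz x (mem_head _ _); rewrite gE => /eqP; rewrite mulf_eq0 => /orP[|/eqP//].
  rewrite prodf_seq_eq0 => /hasP[y ys /=]; rewrite subr_eq0 => /eqP xy.
  by rewrite xy ys in xs.
have [k [kc kd kE]] := divide_zero gc gd xs gx.
exists k; split => // z; rewrite big_cons gE kE; ring.
Qed.

(** Dividing [n] accumulating zeros out of [F] leaves a factor [g]. With the zeros and [w] within
    [1/6] of [a], the product of the [|w - x|] is at most [3 ^ - n], whereas on the unit circle
    around [w] each [|z - x|] is at least [2/3], so that [|g w| <= M (3/2) ^ n]. Hence
    [|F w| <= M / 2 ^ n] for every [n]. *)
Lemma isolated_zeros (F : C -> C) a : (forall z, exists d, cder F z d) ->
  (forall e : R, 0 < e -> exists w, normc (w - a) < e /\ F w != 0) ->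
  exists2 r : R, 0 < r & forall z, 0 < normc (z - a) < r -> F z != 0.
Proof.
move=> Fd Fnz; apply: contrapT => nH.
have zeros (r : R) : 0 < r -> exists z, [/\ 0 < normc (z - a), normc (z - a) < r & F z = 0].
  move=> r0; apply: contrapT => nz; apply: nH; exists r => // z /andP[h1 h2].
  by apply/eqP => Fz; apply: nz; exists z.
have many n : exists s : seq C, [/\ size s = n, uniq s,
    forall z, z \in s -> F z = 0 /\ normc (z - a) < 6^-1 &
    exists2 r : R, 0 < r & forall z, z \in s -> r <= normc (z - a)].
  elim: n => [|n [s [s1 s2 s3 [r r0 s4]]]]; first by exists [::]; split => //; exists 1.
  have [|z [z1 z2 z3]] := zeros (Num.min r 6^-1); first by rewrite lt_min r0 invr_gt0 ltr0n.
  rewrite lt_min in z2; case/andP: z2 => z2 z4.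
  exists (z :: s); split => /=; first by rewrite s1.
  - rewrite s2 andbT; apply/negP => /s4; by rewrite leNgt z2.
  - by move=> y; rewrite in_cons => /orP[/eqP->//|/s3].
  - exists (normc (z - a)) => // y; rewrite in_cons => /orP[/eqP->//|/s4].
    exact/le_trans/ltW.
have [w [wa Fw]] := Fnz 6^-1 ltac:(by rewrite invr_gt0).
have [|M HM] := @ccont_bounded F a 2; first by move=> z; have [d /cder_ccont] := Fd z.
have bound n : normc (F w) <= M / 2 ^+ n.
  have [s [s1 s2 s3 _]] := many n.
  have [|g [gc gd gE]] := factor_zeros Fd s2; first by move=> z /s3[].
  have ws : w \notin s by apply/negP => /s3[Fw0 _]; rewrite Fw0 eqxx in Fw.
  have prodn z : normc (\prod_(x <- s) (z - x)) = \prod_(x <- s) normc (z - x).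
    elim: (s) => [|x t IH]; first by rewrite !big_nil; exact: (@normc1 R).
    by rewrite !big_cons normcM IH.
  have up : \prod_(x <- s) normc (w - x) <= (3^-1) ^+ n.
    rewrite -s1; elim: (s) s3 => [|x t IH] s3; first by rewrite big_nil expr0.
    rewrite big_cons /= exprS; apply: ler_pM; first exact: nm_ge0.
    - by apply: prodr_ge0 => ? _; exact: nm_ge0.
    - have [_ xa] := s3 x (mem_head _ _).
      have := nm_tri a w x; rewrite (nmBC a x); lra.
    - by apply: IH => z zt; apply: s3; rewrite in_cons zt orbT.
  have gw : normc (g w) <= M * (3 / 2) ^+ n.
    apply: (mean_value_circle ltr01 gc gd ws) => z zw.
    have Hl : (2 / 3) ^+ n <= \prod_(x <- s) normc (z - x).
      rewrite -s1; elim: (s) s3 => [|x t IH] s3; first by rewrite big_nil expr0.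
      rewrite big_cons /= exprS; apply: ler_pM.
      - by rewrite divr_ge0.
      - by rewrite exprn_ge0 // divr_ge0.
      - have [_ xa] := s3 x (mem_head _ _).
        have := nm_tri x z w; have := nm_tri a x w; rewrite zw (nmBC a w); lra.
      - by apply: IH => y yt; apply: s3; rewrite in_cons yt orbT.
    have Fz : normc (F z) <= M.
      by apply: HM; have := nm_tri w z a; rewrite zw; lra.
    have p0 : 0 < (2 / 3 : R) ^+ n by rewrite exprn_gt0 // divr_gt0.
    rewrite -(ler_pM2l p0) mulrCA -exprMn.
    rewrite (_ : 2 / 3 * (3 / 2) = 1 :> R); last by field.
    rewrite expr1n mulr1; apply: le_trans Fz; rewrite gE normcM prodn.
    by apply: ler_wpM2r; [exact: nm_ge0|].
  rewrite gE normcM prodn.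
  apply: le_trans (ler_pM _ _ up gw) _.
  - by apply: prodr_ge0 => ? _; exact: nm_ge0.
  - exact: nm_ge0.
  - rewrite mulrCA -exprMn (_ : 3^-1 * (3 / 2) = 2^-1 :> R); last by field.
    by rewrite exprVn.
have Fw0 : 0 < normc (F w) by rewrite nm_gt0.
pose n := Num.Def.archi_bound (M / normc (F w)).
have M0 : 0 < M by have := bound 0%N; rewrite expr0 divr1; lra.
have : M / normc (F w) < n%:R by apply: archi_boundP; rewrite divr_ge0 // ltW.
have := bound n; rewrite ler_pdivlMr ?exprn_gt0 // mulrC -ler_pdivlMr // => h1 h2.
have := le_lt_trans h1 h2; apply/negP; rewrite -leNgt.
by rewrite -natrX ler_nat ltnW // ltn_expl.
Qed.

End isolated_zeros.

(** * Local complex-time solutions *)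

Section local_flow.
Context {R : realType}.
Local Notation C := R[i].
Local Open Scope complex_scope.

Lemma le_geom (x y r : R) : (forall n, x <= y + r / 2 ^+ n) -> x <= y.
Proof.
move=> H; rewrite leNgt; apply/negP => yx.
have xy : 0 < x - y by lra.
have r0 : 0 <= r by have := H 0%N; rewrite expr0 divr1; lra.
pose n := Num.Def.archi_bound (r / (x - y)).
have : r / (x - y) < n%:R by apply: archi_boundP; rewrite divr_ge0 // ltW.
have p2 : 0 < (2 : R) ^+ n by rewrite exprn_gt0.
rewrite ltr_pdivrMr // => h1.
have : n%:R <= (2 : R) ^+ n by rewrite -natrX ler_nat ltnW // ltn_expl.
have := H n; rewrite -lerBlDl ler_pdivlMr // => h2 h3; nra.
Qed.

Lemma nm_conj (z : C) : normc (conjc z) = normc z.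
Proof. by case: z => x y /=; rewrite sqrrN. Qed.

Lemma ball_convex (q a b : C) (r s : R) : normc (a - q) < r -> normc (b - q) < r ->
  0 <= s <= 1 -> normc (a + s%:C * (b - a) - q) < r.
Proof.
move=> ar br /andP[s0 s1].
rewrite (_ : _ - q = (1 - s)%:C * (a - q) + s%:C * (b - q)); last by rewrite rmorphB; ring.
apply: le_lt_trans (nmD _ _) _; rewrite !normcM !nm_real.
rewrite (ger0_norm s0) ger0_norm; last by lra.
have [s01|s01] := eqVneq s 0; first by rewrite s01 subr0 mul0r mul1r addr0.
have sp : 0 < s by rewrite lt_neqAle eq_sym s01.
have := nm_ge0 (a - q); nra.
Qed.

Lemma ccont_glue2 (f g k : C -> C) z : ccont f z -> ccont g z -> f z = g z ->
  (forall w, k w = f w \/ k w = g w) -> ccont k z.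
Proof.
move=> fc gc fg H e e0; have [r r0 Hr] := fc e e0; have [s s0 Hs] := gc e e0.
have kz : k z = f z by case: (H z) => // ->.
exists (Num.min r s); first by rewrite lt_min r0.
move=> h; rewrite lt_min kz => /andP[/Hr h1 /Hs h2].
by case: (H (z + h)) => ->; rewrite // fg.
Qed.

(* A continuous substitute for the inverse, whose junk value at 0 is not a limit. *)
Definition tame_inv (m : R) (v : C) : C :=
  if m <= normc v then v^-1 else conjc v / (m ^+ 2)%:C.

Lemma ccont_tame_inv m v : 0 < m -> ccont (tame_inv m) v.
Proof.
move=> m0.
have cc (w : C) : ccont (fun v => conjc v / (m ^+ 2)%:C) w.
  move=> e e0; exists (e * m ^+ 2); first by rewrite mulr_gt0 // exprn_gt0.
  move=> h hr; rewrite -mulrBl -rmorphB normcM normcV nm_conj nm_real.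
  rewrite (addrC w) addrK ger0_norm ?sqr_ge0 // ltr_pdivrMr ?exprn_gt0 //.
have [vm|mv] := ltP (normc v) m.
  apply: (@ccont_near _ (fun v => conjc v / (m ^+ 2)%:C) _ _ (m - normc v)); [lra| |exact: cc].
  move=> h hr; rewrite /tame_inv leNgt.
  by rewrite (le_lt_trans (nmD _ _)) //; lra.
have v0 : v != 0 by rewrite -nm_gt0; lra.
move: (mv); rewrite le_eqVlt => /orP[/eqP mE|mv'].
  apply: (ccont_glue2 (cder_ccont (cder_inv v0)) (cc v)).
    rewrite mE; have := nm_sqr v => ->; case: v v0 {mv mE} => x y v0.
    have d0 : x ^+ 2 + y ^+ 2 != 0.
      by move: v0; rewrite -nm_eq0 /= sqrtr_eq0 -ltNge => /gt_eqF ->.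
    by apply: complex_eqP => /=; field; rewrite ?expr0n ?addr0 ?mulf_neq0.
  by move=> w; rewrite /tame_inv; case: ifP => _; [left|right].
apply: (@ccont_near _ GRing.inv _ _ (normc v - m)); [lra| |exact: (cder_ccont (cder_inv v0))].
move=> h hr; rewrite /tame_inv; case: ifP => // /negbT; rewrite -ltNge => h1.
exfalso; have := nm_le_add (v + h) v; rewrite (_ : v - (v + h) = - h) ?nmN; [lra|ring].
Qed.

Lemma ccont_comp (f g : C -> C) z : ccont f (g z) -> ccont g z -> ccont (fun x => f (g x)) z.
Proof.
move=> fc gc e /fc[r r0 Hr]; have [s s0 Hs] := gc r r0; exists s => // h /Hs /Hr.
by rewrite (addrC (g z)) subrK.
Qed.

Variable F : C -> C.
Hypothesis F_cder : forall z, exists d, cder F z d.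

Let F_ccont z : ccont F z.
Proof. by have [d /cder_ccont] := F_cder z. Qed.

(* Solutions in complex time. *)
Definition hsol (U : set C) (S : C -> C) := forall u, U u -> cder S u (F (S u)).

(** A lower bound [k] for the complex lifetime of [q]; all prolongations below rest on keeping such
    a [k] uniform. *)
Definition boxed (k : R) (q : C) := exists S : C -> C, S 0 = q /\ hsol [set u | normc u < k] S.

(** A primitive [T] of [1 / F] measures complex time, since along a solution its derivative is 1.
    Near [q0] it differs little from multiplication by [tau = 1 / F q0], which makes it injective
    with explicit bounds. *)
Lemma transit_time q0 : F q0 != 0 -> exists r tau T, [/\ 0 < r, tau != 0,
  forall z, normc (z - q0) < r -> F z != 0,
  forall z, normc (z - q0) < r -> cder T z (F z)^-1 &
  forall z w, normc (z - q0) < r -> normc (w - q0) < r ->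
    normc (T z - T w - tau * (z - w)) <= normc tau / 2 * normc (z - w)].
Proof.
move=> F0; pose m := normc (F q0) / 2.
have nF0 : 0 < normc (F q0) by rewrite nm_gt0.
have m0 : 0 < m by rewrite divr_gt0.
(* [primitive] asks for continuity on the whole plane, so [1 / F] is altered where [|F|] is below
   half of [|F q0|]. *)
pose f z := tame_inv m (F z).
have fc z : ccont f z by apply: ccont_comp; [exact: ccont_tame_inv|exact: F_ccont].
have [r1 r10 H1] := @F_ccont q0 m m0.
have big z : normc (z - q0) < r1 -> m <= normc (F z).
  move=> /H1; rewrite (addrC q0) subrK => h.
  by have := nm_le_add (F z) (F q0); rewrite nmBC; rewrite /m in h *; lra.
have Fnz z : normc (z - q0) < r1 -> F z != 0 by move=> /big h; rewrite -nm_gt0; lra.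
have fE z : normc (z - q0) < r1 -> f z = (F z)^-1 by move=> /big h; rewrite /f /tame_inv h.
have fd z : normc (z - q0) < r1 -> exists d, cder f z d.
  move=> zr; have [d Hd] := F_cder z.
  have Hi := gder_comp (cder_inv (Fnz _ zr)) Hd; eexists.
  have rz : 0 < r1 - normc (z - q0) by lra.
  apply: (gder_ext rz _ _ Hi); last by rewrite fE.
  move=> h hr; rewrite fE //; apply: le_lt_trans (_ : normc (z - q0) + normc h < _); last by lra.
  by rewrite (_ : z + h - q0 = (z - q0) + h) ?nmD //; ring.
have tau0 : (F q0)^-1 != 0 by rewrite invr_eq0.
set tau := (F q0)^-1 in tau0.
have nt : 0 < normc tau by rewrite nm_gt0.
have [r2 r20 H2] := fc q0 (normc tau / 2) ltac:(by rewrite divr_gt0).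
have [|T HT] := @primitive R f q0 (r1 / 2) [::] (ltac:(by rewrite divr_gt0)) fc.
  move=> z h1 h2 _; apply: fd; apply: le_lt_trans (nm_le_ReIm _) _; lra.
pose r := Num.min (r1 / 2) r2.
have r0 : 0 < r by rewrite lt_min divr_gt0.
have rr1 z : normc (z - q0) < r -> normc (z - q0) < r1.
  by rewrite lt_min => /andP[h _]; lra.
have HT' z : normc (z - q0) < r -> cder T z (F z)^-1.
  by move=> zr; rewrite -fE ?rr1 //; apply: HT; move: zr; rewrite lt_min => /andP[].
exists r, tau, T; split => //; first by move=> z /rr1/Fnz.
move=> z w zr wr.
have := @mean_value_le R (fun s => T (w + s%:C * (z - w)) - tau * (0 + s%:C * (z - w)))
  (fun s => (F (w + s%:C * (z - w)))^-1 * (z - w) - tau * (z - w)) 0 1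
  (normc tau / 2 * normc (z - w)) ler01.
rewrite !rmorph1 !rmorph0 !mul1r !mul0r !addr0 !add0r subr0 mulr1 mulr0 subr0.
rewrite (addrC w) subrK (_ : T z - _ - T w = T z - T w - tau * (z - w)); last by ring.
have inb s : 0 <= s <= 1 -> normc (w + s%:C * (z - w) - q0) < r by exact: ball_convex.
apply=> s hs.
  apply: gderB; last by apply: gderZ; exact: rder_affine.
  apply: (cder_curve (g := fun s => w + s%:C * (z - w))); first exact: HT' (inb _ hs).
  exact: rder_affine.
rewrite -mulrBl normcM; apply: ler_wpM2r; first exact: nm_ge0.
have := inb s hs => h.
have := H2 (w + s%:C * (z - w) - q0); rewrite (addrC q0) subrK !fE ?subrr ?nm00 // ?rr1 //.
by move=> /(_ _)/ltW; apply; move: h; rewrite lt_min => /andP[].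
Qed.

(** The solution through [q] sends [u] to the point where [T] equals [T q + u]. The last clause,
    joining close points by a complex time proportional to their distance, later yields openness of
    the image of solutions and a continuous inverse. *)
Lemma flow_box q0 : F q0 != 0 -> exists delta rho K, [/\ 0 < delta, 0 < rho, 0 < K &
  forall q, normc (q - q0) < delta -> exists S, [/\ S 0 = q,
    hsol [set u | normc u < rho] S &
    forall q', normc (q' - q0) < delta ->
      exists w, [/\ normc w < rho, normc w <= K * normc (q - q') & S w = q']]].
Proof.
move=> F0; have [r [tau [T [r0 tau0 Fnz HT Hlin]]]] := transit_time F0.
have nt : 0 < normc tau by rewrite nm_gt0.
have lower z w : normc (z - q0) < r -> normc (w - q0) < r ->
    normc tau / 2 * normc (z - w) <= normc (T z - T w).
  move=> zr wr; have := Hlin z w zr wr.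
  have := nm_le_add (T z - T w) (tau * (z - w)).
  rewrite nmBC normcM; lra.
have upper z w : normc (z - q0) < r -> normc (w - q0) < r ->
    normc (T z - T w) <= 2 * normc tau * normc (z - w).
  move=> zr wr; have := Hlin z w zr wr.
  have := nm_le_add (tau * (z - w)) (T z - T w).
  rewrite normcM; have := nm_ge0 (z - w); nra.
have Tinj z w : normc (z - q0) < r -> normc (w - q0) < r -> T z = T w -> z = w.
  move=> zr wr E; have := lower z w zr wr; rewrite E subrr nm00 => h.
  apply/eqP; rewrite -subr_eq0 -nm_eq0 eq_le nm_ge0 andbT.
  by have := nm_ge0 (z - w); nra.
pose rho := normc tau * r / 4.
have rho0 : 0 < rho by rewrite divr_gt0 // mulr_gt0.
have onto q u : normc (q - q0) < r / 4 -> normc u < rho ->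
    exists z, normc (z - q0) < r /\ T z = T q + u.
  move=> qr ur; apply: contrapT => nz.
  (* Newton's iteration with the fixed slope [tau] halves the residual at each step, and the steps
     add up to at most [2 |u| / |tau| < r / 2]. *)
  have appr n : exists z, normc (z - q) <= (1 - 2^-1 ^+ n) * (2 * normc u / normc tau) /\
      normc (T z - (T q + u)) <= normc u / 2 ^+ n.
    elim: n => [|n [z [z1 z2]]].
      by exists q; rewrite !expr0 !subrr mul0r nm00 opprD addrA subrr add0r nmN divr1.
    have p1 : 0 < (2^-1 : R) ^+ n by rewrite exprn_gt0.
    have p2 : 0 < (2 : R) ^+ n by rewrite exprn_gt0.
    have u2 : 2 * normc u / normc tau < r / 2.
      by rewrite ltr_pdivrMr //; rewrite /rho in ur; lra.
    have u20 : 0 <= 2 * normc u / normc tau.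
      by rewrite divr_ge0 ?mulr_ge0 ?nm_ge0 // ltW.
    set d := T z - (T q + u) in z2.
    pose z' := z - tau^-1 * d.
    have dn : normc (z' - z) = normc d / normc tau.
      by rewrite /z' addrAC subrr add0r nmN normcM normcV mulrC.
    have z'q : normc (z' - q) <= (1 - 2^-1 ^+ n.+1) * (2 * normc u / normc tau).
      apply: le_trans (nm_tri z _ _) _; rewrite dn.
      have : normc d / normc tau <= 2^-1 ^+ n.+1 * (2 * normc u / normc tau).
        rewrite exprS exprVn ler_pdivrMr //.
        rewrite (_ : 2^-1 * (2 ^+ n)^-1 * (2 * normc u / normc tau) * normc tau = normc u / 2 ^+ n) //.
        by field; rewrite !gt_eqF.
      rewrite exprS; lra.
    have le1 k : 1 - (2^-1 : R) ^+ k <= 1 by rewrite lerBlDr lerDl exprn_ge0.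
    have zr : normc (z - q0) < r.
      have := nm_tri q z q0; have := le1 n; nra.
    have z'r : normc (z' - q0) < r.
      have := nm_tri q z' q0; have := le1 n.+1; nra.
    exists z'; split => //.
    have -> : T z' - (T q + u) = T z' - T z - tau * (z' - z).
      rewrite (_ : tau * (z' - z) = - d); last by rewrite /z'; field.
      by rewrite /d; ring.
    apply: le_trans (Hlin _ _ z'r zr) _; rewrite dn.
    rewrite exprS invfM.
    rewrite (_ : normc tau / 2 * (normc d / normc tau) = normc d / 2); last first.
      by field; rewrite gt_eqF.
    by rewrite mulrCA mulrC ler_pM2l // invr_gt0.
  (* Without an exact solution the residual would have a positive lower bound on the closed disc of
     radius [r / 2]. *)
  have [|||c c0 Hc] := @bounded_ind R q (r / 2) (fun A => exists2 c : R, 0 < c &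
      forall z, A z -> normc (z - q) <= r / 2 -> c <= normc (T z - (T q + u))).
  - by move=> A B AB [c c0 H]; exists c => // z /AB/H.
  - move=> A B [c c0 H] [d d0 K]; exists (Num.min c d); first by rewrite lt_min c0.
    by move=> z [/H h /h|/K h /h]; rewrite ge_min => ->; rewrite ?orbT.
  - move=> z; have [zr|zr] := ltP (r / 2) (normc (z - q)).
      exists (normc (z - q) - r / 2); first by lra.
      exists 1 => // w /= wz wr; exfalso.
      by have := nm_tri w z q; rewrite (nmBC z w); lra.
    have zr0 : normc (z - q0) < r by have := nm_tri q z q0; lra.
    have Tz : 0 < normc (T z - (T q + u)).
      by rewrite nm_gt0 subr_eq0; apply/eqP => E; apply: nz; exists z.
    have [e e0 He] := gder_cont (HT z zr0) (ltac:(by rewrite divr_gt0) : 0 < normc (T z - (T q + u)) / 2).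
    exists e => //; exists (normc (T z - (T q + u)) / 2); first by rewrite divr_gt0.
    move=> w /= /He; rewrite (addrC z) subrK => h _.
    have := nm_tri (T w) (T z) (T q + u); rewrite (nmBC (T z) (T w)); lra.
  have : c <= 0.
    apply: (@le_geom _ _ (normc u)) => n; rewrite add0r.
    have [z [z1 z2]] := appr n; apply: le_trans z2; apply: Hc => /=.
      apply: le_trans z1 _.
      have u2 : 2 * normc u / normc tau < r / 2.
        by rewrite ltr_pdivrMr //; rewrite /rho in ur; lra.
      have u20 : 0 <= 2 * normc u / normc tau.
        by rewrite divr_ge0 ?mulr_ge0 ?nm_ge0 // ltW.
      have : 0 <= (2^-1 : R) ^+ n by rewrite exprn_ge0.
      nra.
    apply: le_trans z1 _.
    have u2 : 2 * normc u / normc tau < r / 2.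
      by rewrite ltr_pdivrMr //; rewrite /rho in ur; lra.
    have u20 : 0 <= 2 * normc u / normc tau.
      by rewrite divr_ge0 ?mulr_ge0 ?nm_ge0 // ltW.
    have : 0 <= (2^-1 : R) ^+ n by rewrite exprn_ge0.
    nra.
  lra.
(* Points of the disc of radius [r / 16] are less than [r / 8] apart, so [T] differs on them by at
   most [3/2 |tau| r / 8], which is below [rho = |tau| r / 4]. *)
exists (r / 16), rho, (2 * normc tau); split => //; first by rewrite divr_gt0.
  by rewrite mulr_gt0.
move=> q qr.
have qr4 : normc (q - q0) < r / 4 by lra.
have [S HS] := @boolp.choice _ _ (fun u z => normc u < rho -> normc (z - q0) < r /\ T z = T q + u)
  (fun u => match pselect (normc u < rho) with
    | left h => let: ex_intro z hz := onto q u qr4 h in ex_intro _ z (fun=> hz)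
    | right h => ex_intro _ 0 (fun h' => False_ind _ (h h')) end).
have S0 : S 0 = q.
  have [|h1 h2] := HS 0; first by rewrite nm00.
  by apply: Tinj => //; [lra|rewrite h2 addr0].
exists S; split => //.
  move=> u ur; have [z1 z2] := HS u ur.
  have Fz := Fnz _ z1; have nFz : 0 < normc (F (S u)) by rewrite nm_gt0.
  move=> e e0.
  (* [S] is differentiated as an inverse function: its increment [k] changes [T] by exactly [h], and
     [|k| <= 2 |h| / |tau|] turns an error relative to [k] into one relative to [h]. *)
  have [s s0 Hs] := HT _ z1 (e * normc tau / (2 * normc (F (S u))))
    ltac:(by rewrite divr_gt0 // mulr_gt0).
  exists (Num.min (rho - normc u) (s * normc tau / 2)).
    by rewrite lt_min subr_gt0 ur divr_gt0 // mulr_gt0.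
  move=> h; rewrite lt_min => /andP[h1 h2].
  have uhr : normc (u + h) < rho by apply: le_lt_trans (nmD _ _) _; lra.
  have [w1 w2] := HS _ uhr.
  set k := S (u + h) - S u.
  have Tk : T (S (u + h)) - T (S u) = h by rewrite w2 z2; ring.
  have kh : normc k <= 2 / normc tau * normc h.
    rewrite mulrAC ler_pdivlMr //.
    by have := lower _ _ w1 z1; rewrite Tk -/k; lra.
  have ks : normc k < s.
    apply: le_lt_trans kh _.
    rewrite (_ : s = 2 / normc tau * (s * normc tau / 2)); last by field; rewrite gt_eqF.
    by rewrite ltr_pM2l // divr_gt0.
  have := Hs k ks; rewrite {1}/k (addrC (S u)) subrK Tk => hk.
  rewrite -/k (_ : k - F (S u) * h = - (F (S u) * (h - (F (S u))^-1 * k))); last by field.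
  rewrite nmN normcM.
  apply: le_trans (ler_wpM2l (nm_ge0 _) hk) _.
  rewrite (_ : normc (F (S u)) * (e * normc tau / (2 * normc (F (S u))) * normc k) = e * (normc tau / 2 * normc k)).
    rewrite ler_pM2l //.
    rewrite (_ : normc h = normc tau / 2 * (2 / normc tau * normc h)); last by field; rewrite gt_eqF.
    by rewrite ler_pM2l // divr_gt0.
  by field; rewrite gt_eqF.
move=> q' q'r; exists (T q' - T q).
have up : normc (T q' - T q) <= 2 * normc tau * normc (q - q').
  by rewrite (nmBC q); apply: upper; lra.
have ws : normc (T q' - T q) < rho.
  have := nm_tri q0 q' q; rewrite (nmBC q0) => h.
  have h2 : normc (T q' - T q) <= 3 / 2 * normc tau * normc (q' - q).
    have := Hlin q' q ltac:(lra) ltac:(lra).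
    have := nm_le_add (tau * (q' - q)) (T q' - T q); rewrite normcM; lra.
  have : normc (q' - q) < r / 8 by lra.
  rewrite /rho; have := nm_ge0 (q' - q); nra.
split => //.
have [z1 z2] := HS _ ws; apply: Tinj => //; first by lra.
by rewrite z2; ring.
Qed.

End local_flow.

(** * Prolongation along segments *)

Section segments.
Context {R : realType}.
Local Notation C := R[i].
Local Open Scope complex_scope.
Variable F : C -> C.
Hypothesis F_cder : forall z, exists d, cder F z d.
Local Notation hsol := (hsol F).
Local Notation boxed := (boxed F).

Definition lip_zero (a : C) (L r : R) :=
  forall w, normc (w - a) < r -> normc (F w) <= L * normc (w - a).

Lemma lip_zeroP a : F a = 0 -> exists L r, [/\ 0 < L, 0 < r & lip_zero a L r].
Proof.
move=> Fa; have [d /gder_bound[r r0 Hr]] := F_cder a.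
exists (normc d + 1), r; split => //; first by have := nm_ge0 d; lra.
by move=> w wr; have := Hr (w - a) wr; rewrite (addrC a) subrK Fa subr0.
Qed.

(** Complex time is travelled along segments parametrised by [[0, 1]]; [c] is the total complex time
    elapsed. *)
Definition curve (z : R -> C) (c : C) :=
  forall s, 0 <= s <= 1 -> rder z s (c * F (z s)).

Lemma rder_cont (z : R -> C) s d : rder z s d -> forall e : R, 0 < e ->
  exists2 r : R, 0 < r & forall u, `|u - s| < r -> normc (z u - z s) < e.
Proof.
move=> H e /(gder_cont H)[r r0 Hr]; exists r => // u us.
by have := Hr (u - s); rewrite nm_real (addrC s) subrK; apply.
Qed.

(* As long as the curve stays in the Lipschitz disc its distance to the zero at
   most doubles, so it never leaves that disc. *)
Lemma short_time a L r z c : 0 < L -> lip_zero a L r -> curve z c ->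
  L * normc c <= 2^-1 -> 2 * normc (z 0 - a) < r ->
  forall s, 0 <= s <= 1 -> normc (z s - a) <= 2 * normc (z 0 - a).
Proof.
move=> L0 HL Hz Lc zr; set D := normc (z 0 - a) in zr *.
have D0 : 0 <= D by exact: nm_ge0.
apply: real_ind.
- by rewrite -/D; lra.
- move=> s /andP[s0 s1] Hs.
  have s01 : 0 <= s <= 1 by rewrite s0 ltW.
  have [e e0 He] := rder_cont (Hz s s01) (ltac:(lra) : 0 < r - 2 * D).
  exists e => // s' /andP[ss' s'e] s'1.
  have inr u : 0 <= u <= s' -> normc (z u - a) < r.
    move=> /andP[u0 us']; have [us|su] := leP u s.
      by apply: le_lt_trans zr; apply: Hs; rewrite u0.
    have Hss : normc (z s - a) <= 2 * D by apply: Hs; rewrite s0 lexx.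
    have := He u; rewrite ger0_norm; last by lra.
    move=> /(_ ltac:(lra)); have := nm_tri (z s) (z u) a; lra.
  (* A bound [2 D + r / 2 ^ n] on the distance makes the displacement at most half of it, and so
     improves itself to [2 D + r / 2 ^ n.+1]. *)
  have step n : forall u, 0 <= u <= s' -> normc (z u - a) <= 2 * D + r / 2 ^+ n.
    elim: n => [|n IH] u hu.
      by rewrite expr0 divr1; have := inr u hu; lra.
    have /andP[u0 us'] := hu.
    have := @mean_value_le R z (fun s => c * F (z s)) 0 u (2^-1 * (2 * D + r / 2 ^+ n)) u0.
    have Hd x : 0 <= x <= u -> rder z x (c * F (z x)).
      by move=> /andP[x0 xu]; apply: Hz; apply/andP; split; lra.
    have HM x : 0 <= x <= u -> normc (c * F (z x)) <= 2^-1 * (2 * D + r / 2 ^+ n).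
      move=> /andP[x0 xu]; have hx : 0 <= x <= s' by apply/andP; split; lra.
      rewrite normcM.
      have h1 := HL _ (inr x hx); have h2 := IH x hx.
      apply: le_trans (ler_wpM2l (nm_ge0 _) h1) _.
      rewrite mulrA (mulrC (normc c)); apply: ler_pM => //; last exact: nm_ge0.
      by rewrite mulr_ge0 ?nm_ge0 // ltW.
    move=> /(_ Hd HM); rewrite subr0 => h.
    have p2 : 0 < (2 : R) ^+ n by rewrite exprn_gt0.
    have r0 : 0 <= r by lra.
    have M0 : 0 <= 2 * D + r / 2 ^+ n.
      by apply: addr_ge0; [rewrite mulr_ge0|rewrite divr_ge0 // ltW].
    have := nm_tri (z 0) (z u) a; rewrite -/D exprS invfM.
    rewrite mulrCA; nra.
  by apply: (@le_geom _ _ _ r) => n; apply: step; apply/andP; split; lra.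
- move=> s /andP[s0 s1] Hs; rewrite leNgt; apply/negP => h.
  have s01 : 0 <= s <= 1 by rewrite s1 ltW.
  have [e e0 He] := rder_cont (Hz s s01) (ltac:(by rewrite subr_gt0) : 0 < normc (z s - a) - 2 * D).
  pose u := Num.max 0 (s - e / 2).
  have us : u < s by rewrite /u gt_max s0 /=; lra.
  have u0 : 0 <= u by rewrite /u le_max lexx.
  have ue : s - e / 2 <= u by rewrite /u le_max lexx orbT.
  have := He u; rewrite ltr0_norm; last by lra.
  move=> /(_ ltac:(lra)); have := Hs u ltac:(by rewrite u0).
  have := nm_tri (z u) (z s) a; rewrite (nmBC (z s) (z u)); lra.
Qed.

Lemma curve_sub z c (a b : R) : curve z c -> 0 <= a <= 1 -> 0 <= b <= 1 ->
  curve (fun s => z (a + s * (b - a))) ((b - a)%:C * c).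
Proof.
move=> Hz /andP[a0 a1] /andP[b0 b1] s /andP[s0 s1].
rewrite -mulrA; apply: rder_reparam; apply: Hz; apply/andP; split; nra.
Qed.

(** At a zero of [F] the short-time bound with initial distance 0 keeps both curves there. Elsewhere
    [T (z1 u) - T (z2 u)] has derivative [c - c = 0], and [T] is injective. *)
Lemma ode_unique z1 z2 c : curve z1 c -> curve z2 c -> z1 0 = z2 0 ->
  forall s, 0 <= s <= 1 -> z1 s = z2 s.
Proof.
move=> H1 H2 E0; apply: real_ind => //.
- move=> s /andP[s0 s1] Hs; have s01 : 0 <= s <= 1 by rewrite s0 ltW.
  have Es : z1 s = z2 s by apply: Hs; rewrite s0 lexx.
  have [Fq|Fq] := eqVneq (F (z1 s)) 0.
    have [L [r [L0 r0 HL]]] := lip_zeroP Fq.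
    have c1 : 0 < normc c + 1 by have := nm_ge0 c; lra.
    exists (2^-1 / (L * (normc c + 1))); first by rewrite divr_gt0 ?invr_gt0 // mulr_gt0.
    move=> s' /andP[ss' s's] s'1.
    have stay z : curve z c -> z s = z1 s -> z s' = z1 s.
      move=> Hz Ez.
      have hs' : 0 <= s' <= 1 by apply/andP; split; lra.
      have := short_time L0 HL (curve_sub Hz s01 hs').
      rewrite mul0r addr0 Ez subrr nm00 mulr0 normcM nm_real.
      have ds : s' - s < 2^-1 / (L * (normc c + 1)) by lra.
      have Lc : 0 < L * (normc c + 1) by rewrite mulr_gt0.
      rewrite ltr_pdivlMr // in ds.
      rewrite ger0_norm; last by lra.
      have nc := nm_ge0 c.
      move=> /(_ _ r0 1 _); rewrite mul1r (addrC s) subrK => h.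
      apply/eqP; rewrite -subr_eq0 -nm_eq0 eq_le nm_ge0 andbT; apply: h.
        apply: ltW; apply: le_lt_trans ds.
        rewrite [X in _ <= X](_ : _ = L * ((s' - s) * (normc c + 1))); last by ring.
        by apply: ler_wpM2l; [exact: ltW|apply: ler_wpM2l; lra].
      by rewrite ler01 lexx.
    by rewrite (stay z1) // (stay z2).
  have [r [tau [T [r0 tau0 Fnz HT Hlin]]]] := transit_time F_cder Fq.
  have nt : 0 < normc tau by rewrite nm_gt0.
  have [e1 e10 He1] := rder_cont (H1 s s01) r0.
  have [e2 e20 He2] := rder_cont (H2 s s01) r0.
  exists (Num.min e1 e2); first by rewrite lt_min e10.
  move=> s' /andP[ss']; rewrite -ltrBlDl lt_min => /andP[h1 h2] s'1.
  have in1 u : s <= u <= s' -> normc (z1 u - z1 s) < r.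
    by move=> /andP[su us']; apply: He1; rewrite ger0_norm; lra.
  have in2 u : s <= u <= s' -> normc (z2 u - z1 s) < r.
    by rewrite Es; move=> /andP[su us']; apply: He2; rewrite ger0_norm; lra.
  have := @rder0_cst R (fun u => T (z1 u) - T (z2 u)) s s' (ltW ss').
  rewrite Es subrr => TE.
  have {}TE : T (z1 s') = T (z2 s').
    apply/eqP; rewrite -subr_eq0; apply/eqP/TE => u hu.
    have hu1 : 0 <= u <= 1 by move: hu => /andP[]; lra.
    rewrite (_ : 0 = (F (z1 u))^-1 * (c * F (z1 u)) - (F (z2 u))^-1 * (c * F (z2 u))).
      apply: gderB.
        by apply: (cder_curve (g := z1)); [exact: HT (in1 _ hu)|exact: H1].
      by apply: (cder_curve (g := z2)); [exact: HT (in2 _ hu)|exact: H2].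
    by field; rewrite (Fnz _ (in1 _ hu)) (Fnz _ (in2 _ hu)).
  have hs' : s <= s' <= s' by rewrite lexx ltW.
  have := Hlin _ _ (in1 _ hs') (in2 _ hs'); rewrite TE subrr sub0r nmN normcM => h.
  apply/eqP; rewrite -subr_eq0 -nm_eq0 eq_le nm_ge0 andbT.
  by have := nm_ge0 (z1 s' - z2 s'); nra.
- move=> s /andP[s0 s1] Hs; have s01 : 0 <= s <= 1 by rewrite s1 ltW.
  apply/eqP; apply: contrapT => /negP ne.
  have n0 : 0 < normc (z1 s - z2 s) / 2 by rewrite divr_gt0 // nm_gt0 subr_eq0.
  have [e1 e10 He1] := rder_cont (H1 s s01) n0.
  have [e2 e20 He2] := rder_cont (H2 s s01) n0.
  pose u := Num.max 0 (s - Num.min e1 e2 / 2).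
  have e0 : 0 < Num.min e1 e2 by rewrite lt_min e10.
  have us : u < s by rewrite /u gt_max s0 /=; lra.
  have u0 : 0 <= u by rewrite /u le_max lexx.
  have ue : s - Num.min e1 e2 / 2 <= u by rewrite /u le_max lexx orbT.
  have l1 : Num.min e1 e2 <= e1 by rewrite ge_min lexx.
  have l2 : Num.min e1 e2 <= e2 by rewrite ge_min lexx orbT.
  have := He1 u; have := He2 u; rewrite ltr0_norm; last by lra.
  move=> /(_ ltac:(lra)) k2 /(_ ltac:(lra)) k1.
  have := nm_tri (z1 u) (z1 s) (z2 s); rewrite (nmBC (z1 s) (z1 u)).
  by rewrite {2}(Hs u) ?u0 //; lra.
Qed.

(** The equation is asked for along one segment only, so [S] need not be holomorphic: a real orbit,
    made constant in the imaginary direction, qualifies on horizontal segments. *)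
Definition seg (S : C -> C) (u v : C) := curve (fun s => S (u + s%:C * (v - u))) (v - u).

Lemma seg_sub S u v (x y : R) : seg S u v -> 0 <= x <= 1 -> 0 <= y <= 1 ->
  seg S (u + x%:C * (v - u)) (u + y%:C * (v - u)).
Proof.
move=> H hx hy; have := curve_sub H hx hy; rewrite /seg /curve.
have E : u + y%:C * (v - u) - (u + x%:C * (v - u)) = (y - x)%:C * (v - u).
  by rewrite rmorphB; ring.
move=> K s hs; have := K s hs; rewrite E.
rewrite (_ : (fun s => _) = (fun s => S (u + x%:C * (v - u) + s%:C * ((y - x)%:C * (v - u))))).
  by rewrite (_ : u + (x + s * (y - x))%:C * _ = u + x%:C * (v - u) + s%:C * ((y - x)%:C * (v - u))) // rmorphD rmorphM; ring.
by apply/funext => t; congr S; rewrite rmorphD rmorphM; ring.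
Qed.

Lemma seg_rev S u v : seg S u v -> seg S v u.
Proof.
move=> /seg_sub H; have := H 1 0; rewrite rmorph1 rmorph0 mul1r mul0r addr0 (addrC u) subrK.
by apply; rewrite lexx ler01.
Qed.

Lemma seg_unique S1 S2 u v u' v' : seg S1 u v -> seg S2 u' v' -> v - u = v' - u' ->
  S1 u = S2 u' -> S1 v = S2 v'.
Proof.
move=> H1 H2 E Eu; rewrite /seg -E in H2.
have := ode_unique H1 H2; rewrite rmorph0 !mul0r !addr0 => /(_ Eu 1).
by rewrite rmorph1 !mul1r {2}E !(addrC u) !(addrC u') !subrK; apply; rewrite lexx ler01.
Qed.

Lemma hsol_seg U S u v : hsol U S ->
  (forall s, 0 <= s <= 1 -> U (u + s%:C * (v - u))) -> seg S u v.
Proof.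
move=> HS HU s hs; rewrite [X in rder _ _ X]mulrC.
by apply: (cder_curve (g := fun s => u + s%:C * (v - u))); [exact: HS (HU _ hs)|exact: rder_affine].
Qed.

(** The segment is cut into [n] pieces short enough for [short_time], each of which at most doubles
    the distance. *)
Lemma seg_long a L r n : 0 < L -> lip_zero a L r -> forall S u v, seg S u v ->
  L * normc (v - u) <= n%:R / 2 -> 2 ^+ n * normc (S u - a) < r ->
  normc (S v - a) <= 2 ^+ n * normc (S u - a).
Proof.
move=> L0 HL; elim: n => [|n IH] S u v Huv Lc ur.
  have : v - u = 0.
    apply/eqP; rewrite -nm_eq0 eq_le nm_ge0 andbT.
    by rewrite mul0r in Lc; rewrite -(pmulr_rle0 _ L0).
  by move/eqP; rewrite subr_eq0 => /eqP ->; rewrite expr0 mul1r.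
have n10 : 0 < n.+1%:R :> R by rewrite ltr0n.
have n0 : 0 <= n%:R :> R by rewrite ler0n.
have n1E : n.+1%:R = n%:R + 1 :> R by rewrite -addn1 natrD.
pose x : R := n%:R / n.+1%:R.
have x01 : 0 <= x <= 1.
  by rewrite /x divr_ge0 ?ler0n //= ler_pdivrMr // mul1r ler_nat.
pose w := u + x%:C * (v - u).
have Hx : 1 - x = n.+1%:R^-1 by rewrite /x n1E; field; lra.
have h01 : 0 <= (0 : R) <= 1 by rewrite lexx ler01.
have h11 : 0 <= (1 : R) <= 1 by rewrite lexx ler01.
have s1 : seg S u w by have := seg_sub Huv h01 x01; rewrite rmorph0 mul0r addr0.
have s2 : seg S w v by have := seg_sub Huv x01 h11; rewrite rmorph1 mul1r (addrC u (v - u)) subrK.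
have p2 : 1 <= (2 : R) ^+ n by rewrite exprn_ege1 // ler1n.
have nu := nm_ge0 (S u - a).
have nv := nm_ge0 (v - u).
rewrite exprS in ur *.
have b1 : normc (S w - a) <= 2 ^+ n * normc (S u - a).
  apply: IH s1 _ _; last by nra.
  rewrite /w addrAC subrr add0r normcM nm_real ger0_norm; last by case/andP: x01.
  rewrite mulrCA /x mulrAC ler_pdivrMr //.
  by rewrite [leRHS]mulrAC -mulrA ler_wpM2l.
have := short_time L0 HL s2; rewrite rmorph0 mul0r addr0 => /(_ _ _ 1 h11).
rewrite rmorph1 mul1r (addrC w) subrK => h.
apply: le_trans (h _ _) _; last by lra.
  rewrite /w (_ : v - _ = (1 - x)%:C * (v - u)); last by rewrite rmorphB rmorph1; ring.
  rewrite normcM nm_real Hx ger0_norm ?invr_ge0 ?ler0n //.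
  rewrite mulrCA mulrC ler_pdivrMr //; lra.
by apply: le_lt_trans ur; rewrite -mulrA ler_pM2l.
Qed.

Definition cvx (U : set C) := forall u v, U u -> U v ->
  forall s : R, 0 <= s <= 1 -> U (u + s%:C * (v - u)).

Lemma cvx_ball0 (r : R) : cvx [set u | normc u < r].
Proof.
move=> u v /= ur vr s hs; have := @ball_convex R 0 u v r s.
by rewrite !subr0; apply.
Qed.

Lemma hsol_shift (f : C -> C) c k : hsol [set u | normc u < k] f ->
  hsol [set u | normc (u - c) < k] (fun u => f (u - c)).
Proof. by move=> H u /= /H; exact: cder_shift. Qed.

(** Two local solutions around [u] and [v] agree at a common point [z]: the midpoint of [u] and [v]
    lies in [U] and in both discs, both have the value of [S] there, and uniqueness carries this
    along the segment to [z]. *)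
Lemma thicken U S k : 0 < k -> cvx U -> (forall u v, U u -> U v -> seg S u v) ->
  (forall u, U u -> boxed k (S u)) ->
  exists S', (forall u, U u -> S' u = S u) /\
    hsol [set z | exists2 u, U u & normc (z - u) < k] S'.
Proof.
move=> k0 Ucvx HS HB.
have [b Hb] := @boolp.choice _ _ (fun u f => U u -> f 0 = S u /\ hsol [set z | normc z < k] f)
  (fun u => match pselect (U u) with
    | left h => let: ex_intro f hf := HB u h in ex_intro _ f (fun=> hf)
    | right h => ex_intro _ S (fun h' => False_ind _ (h h')) end).
have [c Hc] := @boolp.choice _ _ (fun z u => (exists2 u, U u & normc (z - u) < k) ->
    U u /\ normc (z - u) < k)
  (fun z => match pselect (exists2 u, U u & normc (z - u) < k) with
    | left h => let: ex_intro2 u h1 h2 := h in ex_intro _ u (fun=> conj h1 h2)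
    | right h => ex_intro _ 0 (fun h' => False_ind _ (h h')) end).
have key z u v : U u -> U v -> normc (z - u) < k -> normc (z - v) < k ->
    b u (z - u) = b v (z - v).
  move=> Uu Uv zu zv.
  pose m := u + (2^-1)%:C * (v - u).
  have h2 : 0 <= (2^-1 : R) <= 1 by rewrite invr_ge0 ler0n invf_le1 ?ler1n ?ltr0n.
  have Um : U m by exact: Ucvx.
  have uv : normc (v - u) < 2 * k.
    by have := nm_tri z v u; rewrite (nmBC v z); lra.
  have mu : normc (m - u) < k.
    rewrite /m addrAC subrr add0r normcM nm_real ger0_norm; last by case/andP: h2.
    lra.
  have mv : normc (m - v) < k.
    rewrite (_ : m - v = - ((2^-1)%:C * (v - u))).
      by rewrite nmN normcM nm_real ger0_norm; [lra|case/andP: h2].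
    by rewrite /m rmorphV ?unitfE //= rmorphMn rmorph1; field.
  have fromm x : U x -> normc (m - x) < k -> b x (m - x) = S m.
    move=> Ux mx; have [b0 bs] := Hb x Ux.
    apply: (seg_unique (u := 0) (u' := x) _ (HS x m Ux Um)); last by [].
      apply: (hsol_seg bs); move=> s hs.
      by apply: cvx_ball0; rewrite /mkset ?nm00.
    by rewrite subr0.
  apply: (@seg_unique _ _ (m - u) (z - u) (m - v) (z - v)).
  - have [_ bs] := Hb u Uu; apply: (hsol_seg bs) => s hs; exact: cvx_ball0.
  - have [_ bs] := Hb v Uv; apply: (hsol_seg bs) => s hs; exact: cvx_ball0.
  - by ring.
  - by rewrite !fromm.
exists (fun z => b (c z) (z - c z)); split.
  move=> u Uu; have [|U1 U2] := Hc u; first by exists u; rewrite // subrr nm00.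
  by rewrite (key u (c u) u) ?subrr ?nm00 //; exact: (Hb u Uu).1.
move=> z Hz; have [U1 U2] := Hc z Hz.
have [_ bs] := Hb _ U1.
have kz : 0 < k - normc (z - c z) by lra.
apply: (gder_ext kz _ _ (hsol_shift bs U2)) => // h hr.
have zh : normc (z + h - c z) < k.
  apply: le_lt_trans (_ : normc (z - c z) + normc h < _); last by lra.
  by rewrite (_ : z + h - c z = (z - c z) + h) ?nmD //; ring.
have [|V1 V2] := Hc (z + h); first by exists (c z).
exact: key.
Qed.

Lemma boxed_le k k' q : k' <= k -> boxed k q -> boxed k' q.
Proof. by move=> kk [S [S0 HS]]; exists S; split => // u /= uk; apply: HS => /=; lra. Qed.

Lemma boxed_near q : F q != 0 -> exists e k, [/\ 0 < e, 0 < k &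
  forall w, normc (w - q) < e -> boxed k w].
Proof.
move=> /(flow_box F_cder)[e [k [K [e0 k0 _ H]]]]; exists e, k; split => // w /H[S [S0 HS _]].
by exists S.
Qed.

(** For complex times below [(2 * L)^-1] the solution stays between the distances [D / 2] and [2 D]
    from [a], where compactness gives a uniform but unknown lifetime [k]; prolonging by [k] finitely
    often reaches [(2 * L)^-1], a lifetime that does not depend on [D]. *)
Lemma boxed_near_zero a L r z : 0 < L -> lip_zero a L r ->
  (forall w, 0 < normc (w - a) < r -> F w != 0) ->
  0 < normc (z - a) -> 4 * normc (z - a) < r -> boxed (2 * L)^-1 z.
Proof.
move=> L0 HL Fnz; set D := normc (z - a) => D0 Dr.
have [k k0 Hk] : exists2 k : R, 0 < k & forall w, D / 2 <= normc (w - a) <= 2 * D -> boxed k w.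
  have [|||k k0 Hk] := @bounded_ind R a (2 * D) (fun A => exists2 k : R, 0 < k &
      forall w, A w -> D / 2 <= normc (w - a) <= 2 * D -> boxed k w).
  - by move=> A B AB [k k0 H]; exists k => // w /AB; exact: H.
  - move=> A B [k k0 H] [l l0 G]; exists (Num.min k l); first by rewrite lt_min k0.
    move=> w [/H|/G] h /h; apply: boxed_le; first by rewrite ge_min lexx.
    by rewrite ge_min lexx orbT.
  - move=> w; have [h1|h1] := ltP (normc (w - a)) (D / 2).
      exists (D / 2 - normc (w - a)); first by lra.
      exists 1 => // x /= xw /andP[h2 _]; exfalso; have := nm_tri w x a; lra.
    have [h2|h2] := ltP (2 * D) (normc (w - a)).
      exists (normc (w - a) - 2 * D); first by lra.
      exists 1 => // x /= xw /andP[_ h3]; exfalso; have := nm_tri x w a; rewrite (nmBC w x); lra.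
    have Fw : F w != 0 by apply: Fnz; apply/andP; split; lra.
    have [e [k [e0 k0 H]]] := boxed_near Fw.
    by exists e => //; exists k => // x /= /H.
  - by exists k => // w h; apply: Hk => //=; case/andP: h.
have mid S u : S 0 = z -> seg S 0 u -> normc u < (2 * L)^-1 ->
    D / 2 <= normc (S u - a) <= 2 * D.
  move=> S0 Hs ul.
  have Lu : L * normc u <= 2^-1.
    by rewrite invfM in ul; rewrite mulrC -ler_pdivlMr // ltW.
  have up : normc (S u - a) <= 2 * D.
    have := @seg_long a L r 1 L0 HL _ _ _ Hs; rewrite subr0 S0 -/D expr1 mul1r.
    by apply; lra.
  have dn : D <= 2 * normc (S u - a).
    have := @seg_long a L r 1 L0 HL _ _ _ (seg_rev Hs); rewrite sub0r nmN S0 -/D expr1 mul1r.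
    by apply; lra.
  by apply/andP; split; lra.
pose U n := [set u : C | normc u < n.+1%:R * k /\ normc u < (2 * L)^-1].
have Ucvx n : cvx (U n).
  by move=> u v [u1 u2] [v1 v2] s hs; split; exact: cvx_ball0.
have L20 : 0 < (2 * L)^-1 by rewrite invr_gt0 mulr_gt0.
have U0 n : U n 0 by split; rewrite nm00 // mulr_gt0 // ltr0n.
have all n : exists S, S 0 = z /\ hsol (U n) S.
  elim: n => [|n [S [S0 HS]]].
    have [|S [S0 HS]] := Hk z; first by rewrite -/D; apply/andP; split; lra.
    by exists S; split => // u [u1 _]; apply: HS => /=; rewrite mul1r in u1.
  have sg u v : U n u -> U n v -> seg S u v.
    by move=> Uu Uv; apply: (hsol_seg HS) => s hs; exact: Ucvx.
  have [|S' [S'E HS']] := thicken k0 (@Ucvx n) sg.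
    move=> u Uu; apply: Hk; apply: mid => //; [exact: sg|by case: Uu].
  exists S'; split; first by rewrite S'E.
  move=> u [u1 u2]; apply: HS'.
  have n2 : 0 < n.+2%:R :> R by rewrite ltr0n.
  have n21 : n.+2%:R = n.+1%:R + 1 :> R by rewrite -(addn1 n.+1) natrD.
  have n11 : 0 < n.+1%:R :> R by rewrite ltr0n.
  (* A point of modulus below [(n + 2) k] is within [k] of its multiple by [(n + 1) / (n + 2)],
     whose modulus is below [(n + 1) k]. *)
  exists ((n.+1%:R / n.+2%:R)%:C * u).
    rewrite /U /= normcM nm_real ger0_norm ?divr_ge0 ?ler0n //; split.
      by rewrite mulrAC ltr_pdivrMr // -mulrA ltr_pM2l // mulrC.
    apply: le_lt_trans u2; rewrite ler_piMl ?nm_ge0 //.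
    by rewrite ler_pdivrMr // mul1r; lra.
  rewrite (_ : u - _ = (n.+2%:R^-1)%:C * u).
    by rewrite normcM nm_real ger0_norm ?invr_ge0 ?ler0n // mulrC ltr_pdivrMr // mulrC.
  rewrite -{1}[u]mul1r -mulrBl -[1]/(1%:C) -rmorphB; congr (_%:C * _).
  by rewrite n21; field; lra.
pose n := Num.Def.archi_bound ((2 * L)^-1 / k).
have Hn : (2 * L)^-1 / k < n%:R by apply: archi_boundP; rewrite divr_ge0 // ltW.
have [S [S0 HS]] := all n; exists S; split => // u /= ul; apply: HS; split => //.
apply: lt_trans ul _; rewrite -ltr_pdivrMr //; apply: lt_trans Hn _.
by rewrite ltr_nat.
Qed.

End segments.

(** * Heteroclinic orbits and strips of solutions *)

Section compactness.
Context {R : realType}.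
Local Notation C := R[i].
Local Open Scope complex_scope.

Definition rect (a b c d : R) := [set w : C | a <= complex.Re w <= b /\ c <= complex.Im w <= d].

(** Unlike in [bounded_ind], the local hypothesis concerns only points and parts of the rectangle,
    so that functions continuous merely on a strip can be treated. *)
Lemma rect_cover (a b c d : R) (P : set C -> Prop) : a < b -> c < d ->
  (forall A B, A `<=` B -> P B -> P A) ->
  (forall A B, P A -> P B -> P (A `|` B)) ->
  (forall z, rect a b c d z -> exists2 e : R, 0 < e &
    P [set w | rect a b c d w /\ normc (w - z) < e]) ->
  P (rect a b c d).
Proof.
move=> ab cd Psub PU Ploc.
apply: (@rect_ind R a b c d (fun a b c d => P (rect a b c d)) ab cd).
  move=> x1 x2 m y1 y2 n _ _ H1 H2 H3 H4.
  apply: Psub (PU _ _ (PU _ _ H1 H2) (PU _ _ H3 H4)) => w [/andP[h1 h2] /andP[h3 h4]].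
  have [xm|xm] := leP (complex.Re w) m; have [yn|yn] := leP (complex.Im w) n.
  - by left; left; rewrite /rect /= h1 h3 xm yn.
  - by right; left; rewrite /rect /= h1 h4 xm ltW.
  - by left; right; rewrite /rect /= h2 h3 yn ltW.
  - by right; right; rewrite /rect /= h2 h4 !ltW.
move=> x y hx hy; have [//|e e0 He] := Ploc (x +i* y).
exists (e / 2); first by rewrite divr_gt0.
move=> k a' b' c' d' aa bb cc dd /andP[h1 h2] /andP[h3 h4] _ _ _ _ h5 h6.
apply: Psub He => w [/andP[h7 h8] /andP[h9 h10]] /=; split.
  by split; apply/andP; split; lra.
apply: le_lt_trans (nm_le_ReIm _) _; rewrite !ReImE /= [e]splitr.
by apply: ltrD; rewrite ltr_norml; apply/andP; split; lra.
Qed.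

Definition rcont (f : C -> R) (z : C) := forall e : R, 0 < e ->
  exists2 r : R, 0 < r & forall w, normc (w - z) < r -> `|f w - f z| < e.

Lemma rect_max (f : C -> R) (a b c d : R) : a < b -> c < d ->
  (forall z, rect a b c d z -> rcont f z) ->
  exists2 z, rect a b c d z & forall w, rect a b c d w -> f w <= f z.
Proof.
move=> ab cd fc.
have [|||M HM] := @rect_cover a b c d
  (fun A => exists M, forall w, rect a b c d w -> A w -> f w <= M) ab cd.
- by move=> A B AB [M HM]; exists M => w hw /AB; exact: HM.
- move=> A B [M HM] [N HN]; exists (Num.max M N) => w hw; rewrite le_max.
  by case=> [/(HM _ hw) ->|/(HN _ hw) ->]; rewrite ?orbT.
- move=> z hz; have [e e0 He] := fc z hz 1 ltr01; exists e => //.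
  exists (f z + 1) => w _ [_ /He]; rewrite ltr_norml => /andP[]; lra.
have ne : rect a b c d (a +i* c) by split; rewrite /= lexx ltW.
pose A := f @` rect a b c d.
have hA : has_sup A.
  split; first by exists (f (a +i* c)); exists (a +i* c).
  by exists M => _ [w hw <-]; exact: HM.
have ub w : rect a b c d w -> f w <= sup A by move=> hw; apply: ub_le_sup; [exact: hA.2|exists w].
apply: contrapT => nz.
have lt w : rect a b c d w -> f w < sup A.
  move=> hw; rewrite ltNge; apply/negP => h; apply: nz; exists w => // v /ub; lra.
have [|||N Ns HN] := @rect_cover a b c d
  (fun B => exists2 N, N < sup A & forall w, rect a b c d w -> B w -> f w <= N) ab cd.
- by move=> B B' BB [N Ns HN]; exists N => // w hw /BB; exact: HN.
- move=> B B' [N Ns HN] [N' Ns' HN']; exists (Num.max N N'); first by rewrite gt_max Ns.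
  by move=> w hw; rewrite le_max; case=> [/(HN _ hw) ->|/(HN' _ hw) ->]; rewrite ?orbT.
- move=> z hz; have zs := lt z hz.
  have [e e0 He] := fc z hz ((sup A - f z) / 2) ltac:(lra); exists e => //.
  exists ((sup A + f z) / 2); first by lra.
  by move=> w _ [_ /He]; rewrite ltr_norml => /andP[]; lra.
have : sup A <= N by apply: ge_sup; [exact: hA.1|move=> _ [w hw <-]; exact: HN].
lra.
Qed.

(** In the direction [h] of the conjugate of [lam * d] the linear term raises [Re (lam * S)] by
    [|lam * d| |h|], and the remainder takes back at most half of this. *)
Lemma no_local_max (S : C -> C) (z d lam : C) (r : R) : cder S z d -> d != 0 -> lam != 0 -> 0 < r ->
  ~ (forall h, normc h < r -> complex.Re (lam * S (z + h)) <= complex.Re (lam * S z)).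
Proof.
move=> Sd d0 lam0 r0 H.
have nd : 0 < normc d by rewrite nm_gt0.
have nl : 0 < normc lam by rewrite nm_gt0.
have [s s0 Hs] := Sd (normc d / 2) ltac:(by rewrite divr_gt0).
pose m := Num.min r s / 2.
have m0 : 0 < m by rewrite divr_gt0 // lt_min r0.
have mr : m < r /\ m < s.
  have : Num.min r s <= r by rewrite ge_min lexx.
  have : Num.min r s <= s by rewrite ge_min lexx orbT.
  by rewrite /m; rewrite /m in m0; lra.
pose u := lam * d.
have nu : normc u = normc lam * normc d by rewrite normcM.
have nu0 : 0 < normc u by rewrite nu mulr_gt0.
pose h := (m / normc u)%:C * conjc u.
have nh : normc h = m.
  by rewrite normcM nm_real nm_conj ger0_norm ?divfK ?gt_eqF // divr_ge0 // ltW.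
have := H h; rewrite nh => /(_ mr.1).
have := Hs h; rewrite nh => /(_ mr.2) hs.
have E : complex.Re (lam * (d * h)) = m * normc u.
  rewrite mulrA -/u /h mulrCA.
  have -> : u * conjc u = (normc u ^+ 2)%:C.
    by rewrite nm_sqr; case: (u) => x y; apply: complex_eqP => /=; ring.
  by rewrite -rmorphM /=; field; rewrite gt_eqF.
have A : `|complex.Re (lam * (S (z + h) - S z - d * h))| <= normc lam * (normc d / 2 * m).
  by apply: le_trans (nm_Re _) _; rewrite normcM ler_wpM2l ?nm_ge0.
have -> : lam * S (z + h) = lam * S z + lam * (S (z + h) - S z - d * h) + lam * (d * h) by ring.
rewrite 2!ReD E; move: A; rewrite ler_norml => /andP[A _].
rewrite nu in nu0 *.
by have := mulr_gt0 m0 nu0; nra.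
Qed.

Lemma ivt (f : R -> R) (a b v : R) : a <= b -> (forall x, econt f x) ->
  (f a <= v <= f b) || (f b <= v <= f a) -> exists2 c, a <= c <= b & f c = v.
Proof.
move=> ab fc hv.
have [||c] := @IVT R f a b v ab.
- by apply: continuous_subspaceT => x; apply/econtP.
- case/orP: hv => /andP[h1 h2]; first by rewrite ge_min le_max h1 h2 orbT.
  by rewrite ge_min le_max h1 h2 orbT.
- by rewrite in_itv /=; exists c.
Qed.

End compactness.

(** * Extension of a heteroclinic orbit to a strip, and injectivity there *)

Section strips.
Context {R : realType}.
Local Notation C := R[i].
Local Open Scope complex_scope.

Lemma line_seg (F : C -> C) (z : R -> C) u v : (forall t, rder z t (F (z t))) ->
  complex.Im u = complex.Im v -> seg F (fun w => z (complex.Re w)) u v.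
Proof.
move=> Hz; case: u v => x y [x' y'] /= <- s hs.
rewrite (_ : (fun s => _) = (fun s => z (x + s * (x' - x)))); last first.
  by apply/funext => t /=; congr z; ring.
rewrite (_ : complex.Re _ = x + s * (x' - x)); last by rewrite /=; ring.
rewrite (_ : x' +i* y - _ = (x' - x)%:C); last by apply: complex_eqP => /=; ring.
exact: rder_reparam.
Qed.

Definition limp (z : R -> C) (a : C) := forall e : R, 0 < e ->
  exists N : R, forall t, N <= t -> normc (z t - a) < e.

Definition limm (z : R -> C) (a : C) := forall e : R, 0 < e ->
  exists N : R, forall t, t <= - N -> normc (z t - a) < e.

(** Stated by limits of a solution defined for all times; the passage from limit sets to this form
    is [limit_set_het]. *)
Definition heteroclinic (F : C -> C) (ap am p : C) := exists z : R -> C,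
  [/\ z 0 = p, forall t, rder z t (F (z t)), limp z ap & limm z am].

Lemma nm_small_eq (u v : C) : (forall e : R, 0 < e -> normc (u - v) < e) -> u = v.
Proof.
move=> H; apply/eqP; rewrite -subr_eq0 -nm_eq0 eq_le nm_ge0 andbT leNgt.
by apply/negP => h; have := H _ h; rewrite ltxx.
Qed.

Lemma flow_unique (F : C -> C) (z1 z2 : R -> C) (t0 : R) : (forall z, exists d, cder F z d) ->
  (forall t, rder z1 t (F (z1 t))) -> (forall t, rder z2 t (F (z2 t))) ->
  z1 t0 = z2 t0 -> forall t, z1 t = z2 t.
Proof.
move=> Fd H1 H2 E t.
have := @seg_unique R F Fd _ _ t0%:C t%:C t0%:C t%:C (line_seg H1 (erefl : complex.Im t0%:C = complex.Im t%:C))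
   (line_seg H2 (erefl : complex.Im t0%:C = complex.Im t%:C)) erefl.
exact.
Qed.

Definition strip (D : set R) := [set w : C | D (complex.Im w)].

Definition ivl (D : set R) := forall x y w, D x -> D w -> x <= y <= w -> D y.

Lemma cvx_strip D : ivl D -> cvx (strip D).
Proof.
move=> HD [x1 y1] [x2 y2]; rewrite /strip /= => h1 h2 s /andP[s0 s1].
rewrite (_ : _ + _ = y1 + s * (y2 - y1)); last by ring.
have [y12|y21] := leP y1 y2.
  by apply: (HD y1 _ y2) => //; apply/andP; split; nra.
by apply: (HD y2 _ y1) => //; apply/andP; split; nra.
Qed.

Section fixed_equilibria.
Variables (F : C -> C) (ap am : C).
Hypothesis F_cder : forall z, exists d, cder F z d.
Hypothesis apm : ap <> am.
Hypothesis Fap : F ap = 0.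
Hypothesis Fam : F am = 0.
Local Notation het := (heteroclinic F ap am).
Local Notation hsol := (hsol F).
Local Notation boxed := (boxed F).
Local Notation seg := (seg F).

Lemma het_nz z : (forall t, rder z t (F (z t))) -> limp z ap -> limm z am ->
  forall t, F (z t) != 0.
Proof.
move=> Hz Lp Lm t; apply/eqP => Ft.
have cst s : z s = z t.
  apply: (flow_unique (z2 := fun=> z t) (t0 := t) F_cder Hz) => // u.
  by rewrite Ft; exact: gder_cst.
apply: apm; transitivity (z t).
  apply/esym/nm_small_eq => e /Lp[N HN]; rewrite -(cst N); exact: HN.
apply: nm_small_eq => e /Lm[N HN]; rewrite -(cst (- N)); exact: HN.
Qed.

(** The orbit itself supplies, arbitrarily close to [ap] and [am], the points with [F <> 0] that
    isolation of zeros requires. *)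
Lemma het_isolated p : het p -> exists L r, [/\ 0 < L, 0 < r,
  forall a, a = ap \/ a = am -> lip_zero F a L r &
  forall a, a = ap \/ a = am -> forall w, 0 < normc (w - a) < r -> F w != 0].
Proof.
case=> z [z0 Hz Lp Lm]; have nz := het_nz Hz Lp Lm.
have [L1 [r1 [L10 r10 H1]]] := lip_zeroP F_cder Fap.
have [L2 [r2 [L20 r20 H2]]] := lip_zeroP F_cder Fam.
have [|r3 r30 H3] := isolated_zeros (a := ap) F_cder.
  by move=> e /Lp[N HN]; exists (z N); split; [exact: HN|exact: nz].
have [|r4 r40 H4] := isolated_zeros (a := am) F_cder.
  by move=> e /Lm[N HN]; exists (z (- N)); split; [exact: HN|exact: nz].
exists (Num.max L1 L2), (Num.min (Num.min r1 r2) (Num.min r3 r4)); split.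
- by rewrite lt_max L10.
- by rewrite !lt_min r10 r20 r30 r40.
- move=> a ha w; rewrite !lt_min => /andP[/andP[h1 h2] _].
  case: ha => E; subst a.
    by apply: le_trans (H1 _ h1) _; rewrite ler_wpM2r ?nm_ge0 // le_max lexx.
  by apply: le_trans (H2 _ h2) _; rewrite ler_wpM2r ?nm_ge0 // le_max lexx orbT.
- move=> a ha w; rewrite !lt_min => /andP[h0 /andP[_ /andP[h3 h4]]].
  by case: ha => E; subst a; [apply: H3|apply: H4]; rewrite h0.
Qed.

(** All points of the orbit have a common lifetime [k]: towards both ends by the estimate near an
    equilibrium, in between by induction along a compact interval of times. Thickening the real line
    then gives the band. *)
Lemma het_tube p : het p -> exists k S, [/\ 0 < k, S 0 = p &
  hsol (strip [set y | - k < y < k]) S].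
Proof.
move=> hp; have [L [r [L0 r0 HL Hnz]]] := het_isolated hp.
case: hp => z [z0 Hz Lp Lm]; have nz := het_nz Hz Lp Lm.
have near_end a t : a = ap \/ a = am -> normc (z t - a) < r / 4 -> boxed (2 * L)^-1 (z t).
  move=> ha h; apply: (boxed_near_zero F_cder L0 (HL a ha) (Hnz a ha)); last by lra.
  by rewrite nm_gt0 subr_eq0; apply: contraNneq (nz t) => ->; case: ha => ->; rewrite ?Fap ?Fam.
have [N1 HN1] := Lp (r / 4) ltac:(by rewrite divr_gt0).
have [N2 HN2] := Lm (r / 4) ltac:(by rewrite divr_gt0).
have L20 : 0 < (2 * L)^-1 by rewrite invr_gt0 mulr_gt0.
have [k k0 Hk] : exists2 k : R, 0 < k & forall t, boxed k (z t).
  have mid b : exists2 k : R, 0 < k & forall t, - N2 <= t <= b -> boxed k (z t).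
    have [b1|b1] := leP (- N2) b; last first.
      by exists 1 => // t /andP[h1 h2]; lra.
    apply: (@real_ind R (- N2) b (fun b => exists2 k : R, 0 < k & forall t, - N2 <= t <= b -> boxed k (z t))); last by rewrite b1 lexx.
    - have [e [k [e0 k0 H]]] := boxed_near F_cder (nz (- N2)).
      exists k => // t /andP[h1 h2]; have -> : t = - N2 by lra.
      by apply: H; rewrite subrr nm00.
    - move=> s /andP[s0 s1] /(_ s)[|k k0 Hk]; first by rewrite s0 lexx.
      have [e [l [e0 l0 H]]] := boxed_near F_cder (nz s).
      have [d d0 Hd] := rder_cont (Hz s) e0.
      exists d => // s' /andP[ss' s'd] _; exists (Num.min k l); first by rewrite lt_min k0.
      move=> t /andP[t1 t2]; have [ts|st] := leP t s.
        by apply: (boxed_le _ (Hk t _)); rewrite ?ge_min ?lexx // t1.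
      apply: (boxed_le _ (H (z t) _)); first by rewrite ge_min lexx orbT.
      by apply: Hd; rewrite ger0_norm; lra.
    - move=> s /andP[s0 s1] Hs.
      have [e [l [e0 l0 H]]] := boxed_near F_cder (nz s).
      have [d d0 Hd] := rder_cont (Hz s) e0.
      pose u := Num.max (- N2) (s - d / 2).
      have us : u < s by rewrite /u gt_max s0 /=; lra.
      have u1 : - N2 <= u by rewrite /u le_max lexx.
      have ud : s - d / 2 <= u by rewrite /u le_max lexx orbT.
      have [|k k0 Hk] := Hs u; first by rewrite u1.
      exists (Num.min k l); first by rewrite lt_min k0.
      move=> t /andP[t1 t2]; have [ts|st] := leP t u.
        by apply: (boxed_le _ (Hk t _)); rewrite ?ge_min ?lexx // t1.
      apply: (boxed_le _ (H (z t) _)); first by rewrite ge_min lexx orbT.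
      by apply: Hd; rewrite ler0_norm; lra.
  have [k k0 Hk] := mid N1.
  exists (Num.min k (2 * L)^-1); first by rewrite lt_min k0.
  move=> t; have [t1|t1] := leP t (- N2).
    apply: (boxed_le _ (near_end am t _ _)); [by rewrite ge_min lexx orbT|by right|exact: HN2].
  have [t2|t2] := leP N1 t.
    apply: (boxed_le _ (near_end ap t _ _)); [by rewrite ge_min lexx orbT|by left|exact: HN1].
  by apply: (boxed_le _ (Hk t _)); rewrite ?ge_min ?lexx //; apply/andP; split; lra.
have [|||S [SE HS]] := @thicken R F F_cder (strip [set 0]) (fun w => z (complex.Re w)) k k0.
- by apply: cvx_strip => x y w /= -> -> h; lra.
- by move=> u v; rewrite /strip /= => Eu Ev; apply: line_seg => //; rewrite Eu Ev.
- by move=> u _; exact: Hk.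
exists k, S; split => //; first by rewrite SE.
move=> w /andP[h1 h2]; apply: HS; exists (complex.Re w)%:C => //.
apply: le_lt_trans (nm_le_ReIm _) _; rewrite !ReImE /= subrr normr0 add0r oppr0 addr0.
by rewrite ltr_norml h1.
Qed.

Section on_strip.
Variables (D : set R) (S : C -> C).
Hypothesis D_ivl : ivl D.
Hypothesis D_open : forall y, D y -> exists2 e : R, 0 < e & forall y', `|y' - y| < e -> D y'.
Hypothesis D0 : D 0.
Hypothesis S_hsol : hsol (strip D) S.
Hypothesis S0_het : het (S 0).

Lemma strip_seg u v : strip D u -> strip D v -> seg S u v.
Proof. by move=> Du Dv; apply: (hsol_seg S_hsol) => s; exact: cvx_strip. Qed.

Lemma strip_line u t : strip D u -> rder (fun s => S (u + s%:C)) t (F (S (u + t%:C))).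
Proof.
move=> Du; rewrite -[X in rder _ _ X]mulr1.
rewrite (_ : (fun s => _) = (fun s => S (u + s%:C * 1))); last by apply/funext => s; rewrite mulr1.
rewrite (_ : u + t%:C = u + t%:C * 1); last by rewrite mulr1.
apply: (cder_curve (g := fun s => u + s%:C * 1)); last exact: rder_affine.
by apply: S_hsol; rewrite /strip /= !ReImE /= mulr0 mul0r addr0 addr0.
Qed.

(** The vertical segment from [t] to [t + i y] is a complex time of length at most [B], along which
    the distance to an equilibrium grows at most by [2 ^ n], with [n] depending only on [B] and [L].
    Convergence on the real line thus becomes uniform in [y]. *)
Lemma strip_ends B : forall e : R, 0 < e -> exists N : R, forall t y, D y -> `|y| <= B ->
  (N <= t -> normc (S (t +i* y) - ap) < e) /\ (t <= - N -> normc (S (t +i* y) - am) < e).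
Proof.
move=> e e0; have [L [r [L0 r0 HL _]]] := het_isolated S0_het.
have [z [z0 Hz Lp Lm]] := S0_het.
have SE t : S t%:C = z t.
  have Dt : strip D 0 by [].
  have H := fun t => strip_line t Dt.
  by have := flow_unique (t0 := 0) F_cder H Hz; rewrite addr0 z0 => /(_ erefl t); rewrite add0r.
pose n := Num.Def.archi_bound (2 * L * `|B|).
have Hn : 2 * L * `|B| < n%:R by apply: archi_boundP; rewrite !mulr_ge0 // ltW.
have p2 : 0 < (2 : R) ^+ n by rewrite exprn_gt0.
have m0 : 0 < Num.min r e / 2 ^+ n by rewrite divr_gt0 // lt_min r0.
have key a t y : a = ap \/ a = am -> D y -> `|y| <= B ->
    normc (z t - a) < Num.min r e / 2 ^+ n -> normc (S (t +i* y) - a) < e.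
  move=> ha Dy yB; rewrite ltr_pdivlMr // mulrC lt_min => /andP[h1 h2].
  apply: le_lt_trans h2; rewrite -SE in h1 *.
  apply: (seg_long (n := n) L0 (HL a ha)) => //; first exact: strip_seg.
  rewrite (_ : t +i* y - t%:C = 0 +i* y); last by apply: complex_eqP => /=; ring.
  have -> : normc (0 +i* y) = `|y| by rewrite /= expr0n add0r sqrtr_sqr.
  have := ler_norm B; nra.
have [N1 HN1] := Lp _ m0; have [N2 HN2] := Lm _ m0.
exists (Num.max N1 N2) => t y Dy yB; split.
  by rewrite ge_max => /andP[h _]; apply: key => //; [left|exact: HN1].
move=> h; apply: key => //; [by right|apply: HN2].
by apply: le_trans h _; rewrite lerN2 le_max lexx orbT.
Qed.

Lemma strip_het u : strip D u -> het (S u).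
Proof.
move=> Du; exists (fun t => S (u + t%:C)); split; first by rewrite addr0.
- by move=> t; exact: strip_line.
- move=> e /(strip_ends `|complex.Im u|)[N HN]; exists (N - complex.Re u) => t ht.
  have [H _] := HN (complex.Re u + t) (complex.Im u) Du (lexx _).
  rewrite (_ : u + t%:C = (complex.Re u + t) +i* complex.Im u).
    by apply: H; lra.
  by apply: complex_eqP; rewrite !ReImE //= addr0.
- move=> e /(strip_ends `|complex.Im u|)[N HN]; exists (N + complex.Re u) => t ht.
  have [_ H] := HN (complex.Re u + t) (complex.Im u) Du (lexx _).
  rewrite (_ : u + t%:C = (complex.Re u + t) +i* complex.Im u).
    by apply: H; lra.
  by apply: complex_eqP; rewrite !ReImE //= addr0.
Qed.

Lemma het_Fnz p : het p -> F p != 0.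
Proof. by move=> [z [<- Hz Lp Lm]]; exact: (het_nz Hz Lp Lm). Qed.

Lemma strip_nz u : strip D u -> F (S u) != 0.
Proof. by move=> /strip_het/het_Fnz. Qed.

Lemma strip_inj u v : strip D u -> strip D v -> S u = S v -> u = v.
Proof.
move=> Du Dv E; apply: contrapT => uv.
wlog : u v Du Dv E uv / complex.Im u <= complex.Im v.
  move=> H; have [h|h] := leP (complex.Im u) (complex.Im v); first exact: (H u v).
  by apply: (H v u) => //; [move=> vu; apply: uv|exact: ltW].
rewrite le_eqVlt => /orP[/eqP Im_eq|sp].
  pose tau := complex.Re v - complex.Re u.
  have tau0 : tau != 0.
    by rewrite subr_eq0; apply/eqP => h; apply: uv; apply: complex_eqP.
  have per t : S (u + (t + tau)%:C) = S (u + t%:C).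
    have Hv := fun t => strip_line t Dv; have Hu := fun t => strip_line t Du.
    have := flow_unique (t0 := 0) F_cder Hv Hu; rewrite !addr0 => /(_ (esym E) t) <-.
    congr S; apply: complex_eqP; rewrite !ReImE /= /tau; [by ring|by rewrite !addr0].
  have pern n t : S (u + (t + tau *+ n)%:C) = S (u + t%:C).
    by elim: n t => [|n IH] t; rewrite ?addr0 // mulrSr addrA per IH.
  have [z [z0 Hz Lp Lm]] := strip_het Du.
  have zE t : z t = S (u + t%:C).
    have Hu := fun t => strip_line t Du.
    by apply: (flow_unique (t0 := 0) F_cder Hz Hu); rewrite addr0.
  have far (N : R) : exists n : nat, N <= `|tau| *+ n.
    pose n := Num.Def.archi_bound (`|N| / `|tau|).
    have Hn : `|N| / `|tau| < n%:R by apply: archi_boundP; rewrite divr_ge0.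
    exists n; rewrite ltr_pdivrMr ?normr_gt0 // mulr_natl in Hn.
    by apply: le_trans (ler_norm N) (ltW Hn).
  have peraux n t : S (u + (t + `|tau| *+ n)%:C) = S (u + t%:C).
    have [h|h] := leP 0 tau; first by rewrite (ger0_norm h); exact: pern.
    by rewrite (ltr0_norm h) -(pern n) -addrA -mulrnDl addNr mul0rn addr0.
  apply: apm; transitivity (S u).
    apply/esym/nm_small_eq => e /Lp[N HN]; have [n hn] := far N.
    by have := HN _ hn; rewrite zE -(add0r (_ *+ n)) peraux addr0.
  apply: nm_small_eq => e /Lm[N HN]; have [n hn] := far N.
  have := HN (- (`|tau| *+ n)); rewrite zE -(peraux n) addNr addr0 lerN2.
  exact.
set s1 := complex.Im u in sp; set s2 := complex.Im v in sp.
pose w := v - u.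
have Imw : complex.Im w = s2 - s1 by rewrite ImD ImN.
(* The solutions through [u] and [v] coincide up to the shift [w], so [w] is a period as long as
   both points lie in the strip. *)
have per x : strip D x -> strip D (x + w) -> S (x + w) = S x.
  move=> Dx Dxw; apply: (seg_unique F_cder (strip_seg Dv Dxw) (strip_seg Du Dx)) => //.
  by rewrite /w; ring.
clearbody w.
have Dmid y : s1 <= y <= s2 -> D y by exact: D_ivl.
have [e1 e10 He1] := D_open Du; have [e2 e20 He2] := D_open Dv.
(* The functional takes equal values at [ap] and [am], so on the slab between [s1] and [s2] it tends
   to 0 at both ends, and a positive value forces a maximum. Points slightly outside the slab are
   brought back by the period, so the maximum is local in the plane. *)
have nonpos lam : lam != 0 -> complex.Re (lam * (am - ap)) = 0 ->
    forall x, s1 <= complex.Im x <= s2 -> complex.Re (lam * (S x - ap)) <= 0.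
  move=> lam0 lamE x hx; rewrite leNgt; apply/negP => vpos.
  set val := complex.Re _ in vpos.
  have nl : 0 < normc lam by rewrite nm_gt0.
  pose B := Num.max `|s1| `|s2|.
  have yB y : s1 <= y <= s2 -> `|y| <= B.
    move=> /andP[h1 h2]; rewrite /B le_max; have [y0|y0] := leP 0 y.
      by apply/orP; right; rewrite (ger0_norm y0) (le_trans h2) // ler_norm.
    by apply/orP; left; rewrite (ltr0_norm y0) lerNl (le_trans _ h1) // lerNl -normrN ler_norm.
  have [N HN] := strip_ends B (ltac:(by rewrite divr_gt0) : 0 < val / normc lam).
  have small t y : s1 <= y <= s2 -> N <= t \/ t <= - N -> complex.Re (lam * (S (t +i* y) - ap)) < val.
    move=> hy ht; have [H1 H2] := HN t y (Dmid _ hy) (yB _ hy).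
    apply: le_lt_trans (ler_norm _) _; case: ht => ht.
      apply: le_lt_trans (nm_Re _) _; rewrite normcM mulrC -ltr_pdivlMr //; exact: H1.
    rewrite (_ : lam * (S (t +i* y) - ap) = lam * (S (t +i* y) - am) + lam * (am - ap)); last by ring.
    rewrite ReD lamE addr0.
    apply: le_lt_trans (nm_Re _) _; rewrite normcM mulrC -ltr_pdivlMr //; exact: H2.
  have xE : x = complex.Re x +i* complex.Im x by case: (x).
  have [hx1 hx2] : complex.Re x < N /\ - N < complex.Re x.
    by split; rewrite ltNge; apply/negP => h; have := small (complex.Re x) (complex.Im x) hx;
      rewrite -xE -/val ltxx; [move=> /(_ (or_introl h))|move=> /(_ (or_intror h))].
  have N0 : - N < N by lra.
  pose f y := complex.Re (lam * (S y - ap)).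
  have [|m [m1 m2] Hm] := @rect_max R f (- N) N s1 s2 N0 sp.
    move=> y [_ hy]; have Dy : strip D y by exact: Dmid.
    move=> e e0; have [r r0 Hr] := gder_cont (S_hsol Dy) (ltac:(by rewrite divr_gt0) : 0 < e / normc lam).
    exists r => // y' yr; rewrite /f -ReN -ReD.
    apply: le_lt_trans (nm_Re _) _.
    rewrite (_ : _ - _ = lam * (S y' - S y)); last by ring.
    rewrite normcM mulrC -ltr_pdivlMr //.
    by have := Hr (y' - y) yr; rewrite (addrC y) subrK.
  have valm : val <= f m.
    by apply: Hm; split => //; apply/andP; split; apply: ltW.
  have glob y : s1 <= complex.Im y <= s2 -> f y <= f m.
    move=> hy; have yE : y = complex.Re y +i* complex.Im y by case: (y).
    have [h1|h1] := leP N (complex.Re y).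
      by apply: ltW; apply: lt_le_trans valm; rewrite /f yE; apply: small => //; left.
    have [h2|h2] := leP (complex.Re y) (- N).
      by apply: ltW; apply: lt_le_trans valm; rewrite /f yE; apply: small => //; right.
    by apply: Hm; split => //; apply/andP; split; apply: ltW.
  have Dm : strip D m by exact: Dmid.
  have del0 : 0 < Num.min (Num.min e1 e2) (s2 - s1) by rewrite !lt_min e10 e20 subr_gt0.
  apply: (no_local_max (S_hsol Dm) (strip_nz Dm) lam0 del0) => h.
  rewrite !lt_min => /andP[/andP[h1 h2] h3].
  have := nm_Im h => hi; have /andP[m3 m4] := m2.
  have hin : - normc h <= complex.Im h <= normc h by rewrite -ler_norml.
  case/andP: hin => i1 i2.
  suff : f (m + h) <= f m.
    by rewrite /f !mulrBr !ReD !ReN; lra.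
  have [l1|l1] := ltP (complex.Im (m + h)) s1.
    rewrite ImD in l1.
    have E1 : S (m + h + w) = S (m + h).
      apply: per; rewrite /strip /= !ImD ?Imw.
        apply: He1; rewrite ltr0_norm; [|rewrite -/s1]; lra.
      by apply: Dmid; apply/andP; split; lra.
    rewrite /f -E1; apply: glob; rewrite !ImD Imw; apply/andP; split; lra.
  have [l2|l2] := ltP s2 (complex.Im (m + h)).
    rewrite ImD in l2.
    have E1 : S (m + h - w + w) = S (m + h - w).
      apply: per; rewrite /strip /= ?subrK !ImD ?ImN ?Imw.
        by apply: Dmid; apply/andP; split; lra.
      apply: He2; rewrite gtr0_norm; rewrite -/s2; lra.
    rewrite subrK in E1.
    rewrite /f E1; apply: glob; rewrite !ImD ImN Imw; apply/andP; split; lra.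
  by apply: glob; rewrite l1 l2.
(* Orthogonal to [ap - am], so that [nonpos] applies to [lam] and to [- lam]: the functional is
   constant on the slab, again against [no_local_max]. *)
pose lam := 'i * conjc (ap - am).
have lam0 : lam != 0.
  rewrite -nm_gt0 normcM nm_conj.
  have -> : normc 'i = 1 :> R by rewrite /normc expr0n expr1n add0r sqrtr1.
  by rewrite mul1r nm_gt0 subr_eq0; apply/eqP.
have lamE : complex.Re (lam * (am - ap)) = 0.
  by rewrite /lam; case: (ap) (am) => x y [x' y'] /=; ring.
have Nlam0 : - lam != 0 by rewrite oppr_eq0.
have NlamE : complex.Re (- lam * (am - ap)) = 0 by rewrite mulNr ReN lamE oppr0.
pose m := 0 +i* ((s1 + s2) / 2).
have Dm : strip D m by apply: Dmid; rewrite /=; apply/andP; split; lra.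
have hsp : 0 < (s2 - s1) / 2 by lra.
apply: (no_local_max (S_hsol Dm) (strip_nz Dm) lam0 hsp) => h hr.
have := nm_Im h => hi.
have hin : - normc h <= complex.Im h <= normc h by rewrite -ler_norml.
case/andP: hin => i1 i2.
have A := nonpos lam lam0 lamE (m + h) ltac:(rewrite ImD /=; apply/andP; split; lra).
have A' := nonpos (- lam) Nlam0 NlamE m ltac:(rewrite /=; apply/andP; split; lra).
move: A A'; rewrite mulNr !mulrBr !opprB !ReD !ReN; lra.
Qed.

End on_strip.
End fixed_equilibria.
End strips.

(** * The maximal strip *)

Section upper_end.
Context {R : realType}.
Local Notation C := R[i].
Local Open Scope complex_scope.
Variables (F : C -> C) (ap am : C).
Hypothesis F_cder : forall z, exists d, cder F z d.
Hypothesis apm : ap <> am.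
Hypothesis Fap : F ap = 0.
Hypothesis Fam : F am = 0.
Local Notation het := (heteroclinic F ap am).
Local Notation hsol := (hsol F).
Local Notation boxed := (boxed F).
Local Notation seg := (seg F).

Definition band (a b : R) : set C := strip [set y | a < y < b].

Lemma ivl_oo (a b : R) : ivl [set y | a < y < b].
Proof.
by move=> x y w /= /andP[h1 h2] /andP[h3 h4] /andP[h5 h6]; apply/andP; split; lra.
Qed.

Lemma open_oo (a b y : R) : a < y < b ->
  exists2 e : R, 0 < e & forall y', `|y' - y| < e -> a < y' < b.
Proof.
move=> /andP[h1 h2]; exists (Num.min (y - a) (b - y)); first by rewrite lt_min !subr_gt0 h1.
move=> y'; rewrite lt_min ltr_norml ltr_norml => /andP[/andP[h3 h4] /andP[h5 h6]].
by apply/andP; split; lra.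
Qed.

(* Every line [Im = n] crosses a small circle around [ap] on which [F] does not
   vanish; a cluster point of the crossings would violate injectivity. *)
Lemma no_half_plane a S : a < 0 -> hsol (strip [set y | a < y]) S -> het (S 0) -> False.
Proof.
move=> a0 HS S0.
have Di : ivl [set y : R | a < y].
  by move=> x y w /= h1 h2 /andP[h3 h4]; exact: lt_le_trans h3.
have Do (y : R) : a < y -> exists2 e : R, 0 < e & forall y', `|y' - y| < e -> a < y'.
  move=> ay; exists (y - a); first by rewrite subr_gt0.
  by move=> y'; rewrite ltr_norml => /andP[]; lra.
have inj := strip_inj F_cder apm Fap Fam Di Do a0 HS S0.
have ends := strip_ends F_cder apm Fap Fam Di a0 HS S0.
have [L [r [L0 r0 HL Hnz]]] := het_isolated F_cder apm Fap Fam S0.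
have d0 : 0 < normc (am - ap) by rewrite nm_gt0 subr_eq0; apply/eqP => E; exact: apm.
pose r1 := Num.min r (normc (am - ap)) / 2.
have r10 : 0 < r1 by rewrite divr_gt0 // lt_min r0.
have [r1r r1d] : r1 < r /\ r1 < normc (am - ap).
  have : Num.min r (normc (am - ap)) <= r by rewrite ge_min lexx.
  have : Num.min r (normc (am - ap)) <= normc (am - ap) by rewrite ge_min lexx orbT.
  by rewrite /r1; rewrite /r1 in r10; split; lra.
have Dn (n : nat) : a < n%:R by apply: lt_le_trans a0 _; rewrite ler0n.
have cross (n : nat) : exists t, normc (S (t +i* n%:R) - ap) = r1.
  have e0 : 0 < Num.min r1 (normc (am - ap) - r1) by rewrite lt_min r10 subr_gt0.
  have [N HN] := ends n%:R _ e0.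
  have nb : `|n%:R| <= n%:R :> R by rewrite ger0_norm ?ler0n.
  have [H1 _] := HN (Num.max N (- N)) n%:R (Dn n) nb.
  have [_ H2] := HN (- Num.max N (- N)) n%:R (Dn n) nb.
  have {}H1 := H1 ltac:(by rewrite le_max lexx).
  have {}H2 := H2 ltac:(by rewrite lerN2 le_max lexx).
  rewrite !lt_min in H1 H2; case/andP: H1 => h1 _; case/andP: H2 => _ h2.
  have [|||t _ Et] := @ivt R (fun t => normc (S (t +i* n%:R) - ap)) (- Num.max N (- N)) (Num.max N (- N)) r1.
  - have : 0 <= Num.max N (- N) by rewrite le_max; case: (leP 0 N) => //= h; rewrite oppr_ge0 ltW.
    lra.
  - move=> t e e'0; have Dt : strip [set y | a < y] (t +i* n%:R) by exact: Dn.
    have [d d'0 Hd] := gder_cont (HS _ Dt) e'0.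
    exists d => // h hd; have := Hd h%:C; rewrite nm_real => /(_ hd).
    rewrite (_ : t +i* n%:R + h%:C = (t + h) +i* n%:R); last by apply: complex_eqP => /=; ring.
    apply: le_lt_trans; rewrite ler_norml.
    have := nm_tri (S (t +i* n%:R)) (S ((t + h) +i* n%:R)) ap.
    have := nm_tri (S ((t + h) +i* n%:R)) (S (t +i* n%:R)) ap.
    rewrite (nmBC (S (t +i* n%:R)) (S ((t + h) +i* n%:R))).
    by move=> h3 h4; apply/andP; split; lra.
  - apply/orP; right; rewrite (ltW h1) /=.
    have := nm_tri (S (- Num.max N (- N) +i* n%:R)) am ap.
    rewrite (nmBC am (S _)); lra.
  - by exists t.
have [t Ht] := boolp.choice cross.
pose x n := t n +i* n%:R.
have Dx n : strip [set y | a < y] (x n) by exact: Dn.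
have [|||N HN] := @bounded_ind R ap r1 (fun A => exists N, forall n, (N < n)%N -> ~ A (S (x n))).
- by move=> A B AB [N HN]; exists N => n /HN nB /AB.
- move=> A B [N HN] [N' HN']; exists (maxn N N') => n.
  by rewrite gtn_max => /andP[/HN nA /HN' nB] [].
- move=> w; have [h1|h1] := ltP (normc (w - ap)) r1.
    exists (r1 - normc (w - ap)); first by lra.
    exists 0%N => n _ /=; have := nm_tri w (S (x n)) ap; rewrite /x Ht; lra.
  have [h2|h2] := ltP r1 (normc (w - ap)).
    exists (normc (w - ap) - r1); first by lra.
    exists 0%N => n _ /=; have := nm_tri (S (x n)) w ap; rewrite (nmBC w (S (x n))) /x Ht; lra.
  have Fw : F w != 0.
    by apply: (Hnz ap) => //; [left|apply/andP; split; lra].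
  have [e [k [K [e0 k0 _ H]]]] := flow_box F_cder Fw.
  exists e => //.
  pose m := Num.Def.archi_bound k.
  have Hm : k < m%:R by apply: archi_boundP; exact: ltW.
  (* Let two crossings fall into one flow box, at heights [n0 >= m] and [n > n0 + m]. They are
     joined by a complex time of modulus below [k < m]; [n0 >= m] keeps the way inside the half
     plane, and injectivity forces [n - n0 < k]. *)
  have [[n0 [n0m hn0]]|none] := pselect (exists n, (m <= n)%N /\ normc (S (x n) - w) < e).
    exists (n0 + m)%N => n nn /= hn.
    have [f [f0 fs fE]] := H _ hn0.
    have [u [u1 _ u3]] := fE _ hn.
    have := nm_Im u; rewrite ler_norml => /andP[i1 i2].
    have Hin (s : R) : 0 <= s <= 1 -> strip [set y | a < y] (x n0 + s%:C * u).
      move=> /andP[s0 s1]; rewrite /strip /= !ReImE /= mul0r addr0.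
      have : m%:R <= n0%:R :> R by rewrite ler_nat.
      nra.
    have Dxu : strip [set y | a < y] (x n0 + u).
      by have := Hin 1; rewrite rmorph1 mul1r; apply; rewrite ler01 lexx.
    have E : S (x n0 + u) = S (x n).
      rewrite -u3.
      apply: (@seg_unique R F F_cder S f (x n0) (x n0 + u) 0 u).
      - by apply: (hsol_seg HS) => s hs; rewrite addrAC subrr add0r; exact: Hin.
      - apply: (hsol_seg fs) => s hs; apply: cvx_ball0 => //.
        by rewrite /mkset nm00.
      - by ring.
      - by rewrite f0.
    have := inj _ _ Dxu (Dx n) E => /(congr1 (@complex.Im R)).
    rewrite ImD /= => E2.
    have : n0%:R + m%:R < n%:R :> R by rewrite -natrD ltr_nat.
    lra.
  exists m => n mn /= hn; apply: none; exists n; split => //; exact: ltnW.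
- by apply: (HN N.+1) => //=; rewrite /x Ht.
Qed.

Section escape.
Variables (a b : R) (S : C -> C).
Hypothesis a0 : a < 0.
Hypothesis b0 : 0 < b.
Hypothesis S_hsol : hsol (band a b) S.
Hypothesis S0 : het (S 0).
Hypothesis S_max : forall b' S', b < b' -> S' 0 = S 0 -> hsol (band a b') S' -> False.

Let D0 : [set y | a < y < b] 0.
Proof. by rewrite /= a0 b0. Qed.

Let S_seg u v : band a b u -> band a b v -> seg S u v.
Proof. exact: (strip_seg (@ivl_oo a b) S_hsol). Qed.

Let S_nz u : band a b u -> F (S u) != 0.
Proof. exact: (strip_nz F_cder apm Fap Fam (@ivl_oo a b) D0 S_hsol S0). Qed.

(** Bounded values near the boundary point have a cluster value [w]. It is no zero of [F]: from
    arbitrarily close to [w] the solution could not reach a fixed [S v <> w] within a complex time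
    below [(2 * L)^-1]. A box around [w] therefore serves one point of the strip and, by uniqueness,
    the points around it. *)
Let boxed_top t M : (forall d : R, 0 < d -> exists u, [/\ band a b u,
    normc (u - (t +i* b)) < d & normc (S u) <= M]) ->
  exists2 k : R, 0 < k & forall u, band a b u -> normc (u - (t +i* b)) < k -> boxed k (S u).
Proof.
move=> HM; set q := t +i* b in HM *.
have [w Hw] : exists w, forall e d : R, 0 < e -> 0 < d -> exists u,
    [/\ band a b u, normc (u - q) < d & normc (S u - w) < e].
  apply: contrapT => nw.
  have [|||d d0 Hd] := @bounded_ind R 0 M (fun A => exists2 d : R, 0 < d &
      forall u, band a b u -> normc (u - q) < d -> ~ A (S u)).
  - by move=> A B AB [d d0 H]; exists d => // u hu hq /AB; exact: H.
  - move=> A B [d d0 H] [d' d'0 H']; exists (Num.min d d'); first by rewrite lt_min d0.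
    by move=> u hu; rewrite lt_min => /andP[/(H _ hu) nA /(H' _ hu) nB] [].
  - move=> w; apply: contrapT => nl; apply: nw; exists w => e d e0 d0.
    apply: contrapT => nu; apply: nl; exists e => //; exists d => // u hu hq /= hS.
    by apply: nu; exists u.
  - have [u [u1 u2 u3]] := HM d d0; apply: (Hd u u1 u2).
    by rewrite /mkset subr0.
have [Fw|Fw] := eqVneq (F w) 0.
  exfalso; have [L [r [L0 r0 HL]]] := lip_zeroP F_cder Fw.
  have q0 : 0 < (4 * L)^-1 by rewrite invr_gt0 mulr_gt0.
  have [v [v1 v2 _]] := Hw 1 _ ltr01 q0.
  set X := normc (S v - w).
  have X0 : 0 < X.
    by rewrite nm_gt0 subr_eq0; apply: contraNneq (S_nz v1) => ->; rewrite Fw.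
  pose e := Num.min r X / 4.
  have e0 : 0 < e by rewrite divr_gt0 // lt_min r0.
  have [er eX] : 4 * e <= r /\ 4 * e <= X.
    have h : 4 * e = Num.min r X by rewrite /e; field.
    by rewrite h !ge_min !lexx orbT.
  have [u [u1 u2 u3]] := Hw e _ e0 q0.
  have := @seg_long R F w L r 1 L0 HL S u v (S_seg u1 v1).
  rewrite expr1 mul1r -/X => H.
  have : X <= 2 * normc (S u - w).
    apply: H; last by lra.
    have h : normc (v - u) < (2 * L)^-1.
      have := nm_tri q v u; rewrite (nmBC q).
      have -> : (2 * L)^-1 = 2 * (4 * L)^-1 by field; rewrite gt_eqF.
      lra.
    have -> : 2^-1 = L * (2 * L)^-1 by field; rewrite gt_eqF.
    by rewrite ler_pM2l // ltW.
  lra.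
have [e [k [e0 k0 Hk]]] := boxed_near F_cder Fw.
have k4 : 0 < k / 4 by rewrite divr_gt0.
have [u [u1 u2 u3]] := Hw e _ e0 k4.
have [f [f0 fs]] := Hk _ u3.
exists (k / 4) => // v v1 v2.
have uv : normc (v - u) < k / 2.
  by have := nm_tri q v u; rewrite (nmBC q); lra.
have Sv : S v = f (v - u).
  apply: (@seg_unique R F F_cder S f u v 0 (v - u)).
  - exact: S_seg.
  - apply: (hsol_seg fs) => s hs; apply: cvx_ball0 => //; rewrite /mkset ?nm00 //; lra.
  - by rewrite subr0.
  - by rewrite f0.
exists (fun x => f (v - u + x)); split; first by rewrite addr0.
move=> x /= xk; have := fs (v - u + x).
rewrite /= => /(_ ltac:(apply: le_lt_trans (nmD _ _) _; lra)) H e' /H[r r0 Hr].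
by exists r => // h /Hr; rewrite addrA.
Qed.

(** Otherwise each point of the line [Im = b] has a neighbourhood in which the values of [S] share a
    lifetime; compactness in the middle and the equilibria at the ends make it uniform near the
    whole line, and thickening prolongs [S] beyond [b]. *)
Lemma escape_top : exists t, forall M, exists2 d : R, 0 < d &
  forall u, band a b u -> normc (u - (t +i* b)) < d -> M < normc (S u).
Proof.
apply: contrapT => nt.
have loc t : exists2 k : R, 0 < k & forall u, band a b u -> normc (u - (t +i* b)) < k -> boxed k (S u).
  have [M HM] : exists M, forall d : R, 0 < d -> exists u, [/\ band a b u,
      normc (u - (t +i* b)) < d & normc (S u) <= M].
    apply: contrapT => nM; apply: nt; exists t => M; apply: contrapT => nd; apply: nM.
    exists M => d d0; apply: contrapT => nu; apply: nd; exists d => // u hu hd.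
    by rewrite ltNge; apply/negP => h; apply: nu; exists u.
  exact: boxed_top HM.
have [L [r [L0 r0 HL Hnz]]] := het_isolated F_cder apm Fap Fam S0.
have r4 : 0 < r / 4 by rewrite divr_gt0.
have [N HN] := strip_ends F_cder apm Fap Fam (@ivl_oo a b) D0 S_hsol S0 b r4.
have L20 : 0 < (2 * L)^-1 by rewrite invr_gt0 mulr_gt0.
have near_end p u : p = ap \/ p = am -> band a b u -> normc (S u - p) < r / 4 -> boxed (2 * L)^-1 (S u).
  move=> hp hu h; apply: (boxed_near_zero F_cder L0 (HL p hp) (Hnz p hp)); last by lra.
  by rewrite nm_gt0 subr_eq0; apply: contraNneq (S_nz hu) => ->; case: hp => ->; rewrite ?Fap ?Fam.
have mid c : - `|N| <= c -> exists2 k : R, 0 < k & forall u, band a b u -> - `|N| <= complex.Re u <= c ->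
    b - k < complex.Im u -> boxed k (S u).
  have one s : exists2 k : R, 0 < k & forall u, band a b u -> `|complex.Re u - s| < k ->
      b - k < complex.Im u -> boxed k (S u).
    have [k k0 Hk] := loc s; exists (k / 2); first by rewrite divr_gt0.
    move=> u hu h1 h2; apply: (boxed_le _ (Hk u hu _)); first lra.
    apply: le_lt_trans (nm_le_ReIm _) _; rewrite !ReImE /= [k]splitr.
    apply: ltrD => //; case/andP: hu => _ ub.
    by rewrite ltr0_norm ?subr_lt0 // opprB; lra.
  move=> Nc; apply: (@real_ind R (- `|N|) c (fun c => exists2 k : R, 0 < k & forall u, band a b u ->
    - `|N| <= complex.Re u <= c -> b - k < complex.Im u -> boxed k (S u))); last by rewrite Nc lexx.
  - have [k k0 Hk] := one (- `|N|); exists k => // u hu /andP[h1 h2]; apply: Hk => //.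
    by rewrite (_ : complex.Re u - _ = 0) ?normr0 //; lra.
  - move=> s /andP[s0 s1] /(_ s)[|k k0 Hk]; first by rewrite s0 lexx.
    have [l l0 Hl] := one s.
    exists l => // s' /andP[ss' s's] _; exists (Num.min k l); first by rewrite lt_min k0.
    have mk : Num.min k l <= k by rewrite ge_min lexx.
    have ml : Num.min k l <= l by rewrite ge_min lexx orbT.
    move=> u hu /andP[h1 h2] h3; have [us|su] := leP (complex.Re u) s.
      by apply: (boxed_le mk); apply: Hk => //; [rewrite h1|lra].
    by apply: (boxed_le ml); apply: Hl => //; [rewrite ger0_norm; lra|lra].
  - move=> s /andP[s0 s1] Hs; have [l l0 Hl] := one s.
    pose v := Num.max (- `|N|) (s - l / 2).
    have vs : v < s by rewrite /v gt_max s0 /=; lra.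
    have v1 : - `|N| <= v by rewrite /v le_max lexx.
    have vd : s - l / 2 <= v by rewrite /v le_max lexx orbT.
    have [|k k0 Hk] := Hs v; first by rewrite v1.
    exists (Num.min k l); first by rewrite lt_min k0.
    have mk : Num.min k l <= k by rewrite ge_min lexx.
    have ml : Num.min k l <= l by rewrite ge_min lexx orbT.
    move=> u hu /andP[h1 h2] h3; have [us|su] := leP (complex.Re u) v.
      by apply: (boxed_le mk); apply: Hk => //; [rewrite h1|lra].
    by apply: (boxed_le ml); apply: Hl => //; [rewrite ler0_norm; lra|lra].
have nN : - `|N| <= `|N| by have := normr_ge0 N; lra.
have [k1 k10 Hk1] := mid _ nN.
pose k := Num.min (Num.min k1 (2 * L)^-1) b.
have k0 : 0 < k by rewrite !lt_min k10 L20.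
have kk1 : k <= k1 by rewrite /k !ge_min lexx.
have kL : k <= (2 * L)^-1 by rewrite /k !ge_min lexx orbT.
have kb : k <= b by rewrite /k !ge_min lexx orbT.
clearbody k.
(* Thickening the line at this height by [k] overshoots [b] by [k / 2], and [k <= b] keeps the line
   itself inside the band. *)
pose y0 := b - k / 2.
have y0a : a < y0 by rewrite /y0; move: a0 b0 kb; lra.
have y0b : y0 < b by rewrite /y0; move: k0; lra.
have hy0 x : band a b (x +i* y0) by rewrite /band /strip /= y0a y0b.
have By0 : `|y0| <= b by rewrite /y0 ger0_norm; lra.
have [|||S' [SE HS']] := @thicken R F F_cder (strip [set y0]) S k k0.
- by apply: cvx_strip => x y w /= -> -> h; lra.
- move=> [x y] [x' y']; rewrite /strip /= => -> ->; exact: S_seg.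
- move=> [x y]; rewrite /strip /= => ->.
  have [h1|h1] := leP `|N| x.
    apply: (boxed_le kL); apply: (near_end ap) => //; first by left.
    by apply: (HN x y0 (hy0 x) By0).1; apply: le_trans h1; exact: ler_norm.
  have [h2|h2] := leP x (- `|N|).
    apply: (boxed_le kL); apply: (near_end am) => //; first by right.
    by apply: (HN x y0 (hy0 x) By0).2; apply: le_trans h2 _; rewrite lerN2; exact: ler_norm.
  by apply: (boxed_le kk1); apply: Hk1; rewrite //= /y0; [apply/andP; split; lra|lra].
have {}HS' : hsol (band (y0 - k) (y0 + k)) S'.
  move=> u /andP[h1 h2]; apply: HS'; exists (complex.Re u +i* y0) => //.
  apply: le_lt_trans (nm_le_ReIm _) _; rewrite !ReImE /= subrr normr0 add0r.
  by rewrite ltr_norml; apply/andP; split; lra.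
have agree u : band a b u -> band (y0 - k) (y0 + k) u -> S u = S' u.
  move=> h1 h2; have h3 := hy0 (complex.Re u).
  have h4 : band (y0 - k) (y0 + k) (complex.Re u +i* y0).
    by rewrite /band /strip /=; apply/andP; split; lra.
  apply: (seg_unique F_cder (S_seg h3 h1) (strip_seg (@ivl_oo _ _) HS' h4 h2)) => //.
  by rewrite SE.
pose T u := if complex.Im u < b then S u else S' u.
apply: (@S_max (b + k / 2) T); first by lra.
  by rewrite /T /= b0.
move=> u /andP[h1 h2].
have [ub|bu] := ltP (complex.Im u) b.
  have hu : band a b u by rewrite /band /strip /= h1 ub.
  have e0 : 0 < b - complex.Im u by lra.
  have TE : T u = S u by rewrite /T ub.
  rewrite TE; apply: (gder_ext e0 _ _ (S_hsol hu)) => // h hr; rewrite /T ifT // ImD.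
  by have := nm_Im h; rewrite ler_norml => /andP[]; lra.
have hu : band (y0 - k) (y0 + k) u by rewrite /band /strip /y0 /=; apply/andP; split; lra.
have TE : T u = S' u by rewrite /T ltNge bu.
have e0 : 0 < Num.min (k / 2) (Num.min (b + k / 2 - complex.Im u) (b - a)).
  by rewrite !lt_min; apply/and3P; split; lra.
rewrite TE; apply: (gder_ext e0 _ _ (HS' _ hu)) => // h.
rewrite !lt_min => /and3P[r1 r2 r3]; rewrite /T; case: ifP => // hb.
have := nm_Im h; rewrite ler_norml => /andP[i1 i2]; rewrite ImD in hb.
apply/esym/agree; rewrite /band /strip /y0 /= ImD; apply/andP; split; lra.
Qed.

End escape.
End upper_end.

Section maximal_strip.
Context {R : realType}.
Local Notation C := R[i].
Local Open Scope complex_scope.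
Implicit Types (F S : C -> C) (ap am p : C).

(** Reversal of time, [F] to [- F] and [u] to [- u], exchanges [ap] with [am] and the upper with the
    lower edge of a band; what is proved for the upper edge transfers to the lower one. *)
Lemma opp_cder F : (forall z, exists d, cder F z d) ->
  forall z, exists d, cder (fun z => - F z) z d.
Proof. by move=> H z; have [d Hd] := H z; exists (- d); exact: gderN. Qed.

Lemma opp_rder (z : R -> C) t d : rder z (- t) d -> rder (fun s => z (- s)) t (- d).
Proof.
move=> H; have := @rder_reparam R z 0 (-1) t d; rewrite add0r mulrN1 => /(_ H).
rewrite rmorphN rmorph1 mulN1r.
by rewrite (_ : (fun s => _) = (fun s => z (- s))) //; apply/funext => s; rewrite add0r mulrN1.
Qed.

Lemma opp_het F ap am p : heteroclinic F ap am p -> heteroclinic (fun z => - F z) am ap p.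
Proof.
move=> [z [z0 Hz Lp Lm]]; exists (fun t => z (- t)); split.
- by rewrite oppr0.
- by move=> t; exact: opp_rder.
- by move=> e /Lm[N HN]; exists N => t ht; apply: HN; rewrite lerN2.
- by move=> e /Lp[N HN]; exists N => t ht; apply: HN; rewrite lerNr.
Qed.

Lemma opp_band F S (a b : R) : hsol F (band a b) S ->
  hsol (fun z => - F z) (band (- b) (- a)) (fun u => S (- u)).
Proof.
move=> H u /andP[h1 h2].
have : cder S (- u) (F (S (- u))).
  by apply: H; rewrite /band /strip /= ImN; apply/andP; split; lra.
move=> Hd e /Hd[r r0 Hr]; exists r => // h hr.
have := Hr (- h); rewrite nmN => /(_ hr).
by rewrite -opprD mulrN mulNr.
Qed.

Variables (F : C -> C) (ap am : C).
Hypothesis F_cder : forall z, exists d, cder F z d.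
Hypothesis apm : ap <> am.
Hypothesis Fap : F ap = 0.
Hypothesis Fam : F am = 0.
Local Notation het := (heteroclinic F ap am).
Local Notation hsol := (hsol F).

Variable p : C.
Hypothesis p_het : het p.

Let W (S : C -> C) (a b : R) := [/\ a < 0, 0 < b, S 0 = p & hsol (band a b) S].

Let W_unique S S' a b a' b' u : W S a b -> W S' a' b' -> band a b u -> band a' b' u -> S u = S' u.
Proof.
move=> [a0 b0 S0 HS] [a'0 b'0 S'0 HS'] hu hu'.
apply: (seg_unique (u := 0) (u' := 0) F_cder (strip_seg (@ivl_oo _ _ _) HS _ hu)
  (strip_seg (@ivl_oo _ _ _) HS' _ hu')) => //.
- by rewrite /strip /= a0.
- by rewrite /strip /= a'0.
- by rewrite S0.
Qed.

Let Dom : set R := [set y | exists S a b, W S a b /\ a < y < b].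

(** Band solutions through [p] agree wherever two of them are defined, so choosing any one of them
    at each point defines a single solution on the union. *)
Let ex_star : exists S, [/\ S 0 = p, hsol (strip Dom) S, Dom 0,
  ivl Dom & forall y, Dom y -> exists2 e : R, 0 < e & forall y', `|y' - y| < e -> Dom y'].
Proof.
have [k [S1 [k0 S10 HS1]]] := het_tube F_cder apm Fap Fam p_het.
have W1 : W S1 (- k) k by split => //; lra.
have D0 : Dom 0 by exists S1, (- k), k; split => //; apply/andP; split; lra.
have [f Hf] := @boolp.choice _ _ (fun u v => Dom (complex.Im u) ->
    exists S a b, [/\ W S a b, band a b u & v = S u])
  (fun u => match pselect (Dom (complex.Im u)) with
    | left h => let: ex_intro g (ex_intro a (ex_intro b (conj h1 h2))) := h in
        ex_intro _ (g u) (fun=> ex_intro _ g (ex_intro _ a (ex_intro _ b (And3 h1 h2 erefl))))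
    | right h => ex_intro _ 0 (fun h' => False_ind _ (h h')) end).
have fE S a b u : W S a b -> band a b u -> f u = S u.
  move=> HW hu; have [|S' [a' [b' [HW' hu' ->]]]] := Hf u; first by exists S, a, b.
  exact: W_unique HW' HW hu' hu.
exists f; split => //.
- rewrite (fE _ _ _ _ W1) //; apply/andP; rewrite /=; split; lra.
- move=> u [S [a [b [HW hu]]]]; rewrite (fE _ _ _ _ HW hu).
  have [a0 b0 S0 HS] := HW.
  have [e e0 He] := open_oo hu.
  apply: (gder_ext e0 _ _ (HS u hu)); last by rewrite (fE _ _ _ _ HW hu).
  move=> h hr; apply/esym; apply: fE HW _; rewrite /band /strip /=; apply: He.
  by rewrite ImD addrAC subrr add0r; apply: le_lt_trans (nm_Im _) hr.
- move=> x y w [S [a [b [HW /andP[h1 h2]]]]] [S' [a' [b' [HW' /andP[h3 h4]]]]] /andP[h5 h6].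
  have [a0 b0 _ _] := HW; have [a'0 b'0 _ _] := HW'.
  have [y0|y0] := leP 0 y.
    by exists S', a', b'; split => //; apply/andP; split; lra.
  by exists S, a, b; split => //; apply/andP; split; lra.
- move=> y [S [a [b [HW hy]]]]; have [e e0 He] := open_oo hy.
  by exists e => // y' /He h; exists S, a, b.
Qed.

Lemma maximal_strip : exists a b S, [/\ [/\ a < 0, 0 < b & S 0 = p], hsol (band a b) S,
  forall b' S', b < b' -> S' 0 = p -> hsol (band a b') S' -> False &
  forall a' S', a' < a -> S' 0 = p -> hsol (band a' b) S' -> False].
Proof.
have [S [S0 HS D0 Di Do]] := ex_star.
have [e e0 He] := Do 0 D0.
have ubD : has_sup Dom.
  split; first by exists 0.
  apply: contrapT => nub.
  have all y : 0 <= y -> Dom y.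
    move=> y0; apply: contrapT => nD; apply: nub; exists y => x Dx.
    rewrite leNgt; apply/negP => yx; apply: nD; apply: (Di 0 _ x) => //.
    by rewrite y0 ltW.
  apply: (@no_half_plane R F ap am F_cder apm Fap Fam (- (e / 2)) S); last by rewrite S0.
    lra.
  move=> u hu; apply: HS; rewrite /strip /=; rewrite /strip /= in hu.
  have [h|h] := leP 0 (complex.Im u); first exact: all.
  by apply: He; rewrite subr0 ltr0_norm //; lra.
have lbD : has_inf Dom.
  split; first by exists 0.
  apply: contrapT => nlb.
  have all y : y <= 0 -> Dom y.
    move=> y0; apply: contrapT => nD; apply: nlb; exists y => x Dx.
    rewrite leNgt; apply/negP => yx; apply: nD; apply: (Di x _ 0) => //.
    by rewrite y0 ltW.
  have Fd' := opp_cder F_cder.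
  apply: (@no_half_plane R (fun z => - F z) am ap Fd' _ _ _ (- (e / 2)) (fun u => S (- u))).
  - exact/nesym.
  - by rewrite Fam oppr0.
  - by rewrite Fap oppr0.
  - lra.
  - move=> u hu; rewrite /strip /= in hu.
    (* Reversal is available for bands only, so a band just large enough to contain [- u] is cut out
       of the lower half plane. *)
    have : hsol (band (- complex.Im u - 1) (e / 2)) S.
      move=> v /andP[h1 h2]; apply: HS; rewrite /strip /=.
      have [h|h] := leP (complex.Im v) 0; first exact: all.
      by apply: He; rewrite subr0 gtr0_norm //; lra.
    move=> /opp_band; apply; rewrite /band /strip /=; apply/andP; split; lra.
  - by rewrite oppr0 S0; exact: opp_het.
have DE y : inf Dom < y < sup Dom -> Dom y.
  move=> /andP[h1 h2].
  have [x Dx xy] := inf_adherent (ltac:(lra) : 0 < y - inf Dom) lbD.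
  have [x' Dx' yx'] := sup_adherent (ltac:(lra) : 0 < sup Dom - y) ubD.
  by apply: (Di x _ x') => //; apply/andP; split; lra.
have b0 : 0 < sup Dom.
  have : Dom (e / 2) by apply: He; rewrite subr0 gtr0_norm; lra.
  move=> /(ub_le_sup ubD.2); lra.
have a0 : inf Dom < 0.
  have : Dom (- (e / 2)) by apply: He; rewrite subr0 ltr0_norm; lra.
  move=> /(ge_inf lbD.2); lra.
exists (inf Dom), (sup Dom), S; split => //.
- by move=> u hu; apply: HS; exact: DE.
- move=> b' S' bb' S'0 HS'.
  have : Dom ((sup Dom + b') / 2).
    by exists S', (inf Dom), b'; split; [split => //; lra|apply/andP; split; lra].
  move=> /(ub_le_sup ubD.2); lra.
- move=> a' S' aa' S'0 HS'.
  have : Dom ((inf Dom + a') / 2).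
    by exists S', a', (sup Dom); split; [split => //; lra|apply/andP; split; lra].
  move=> /(ge_inf lbD.2); lra.
Qed.

Lemma escape_strip : exists a b S, [/\ [/\ a < 0, 0 < b & S 0 = p], hsol (band a b) S,
  exists t, forall M, exists2 d : R, 0 < d &
    forall u, band a b u -> normc (u - (t +i* b)) < d -> M < normc (S u) &
  exists t, forall M, exists2 d : R, 0 < d &
    forall u, band a b u -> normc (u - (t +i* a)) < d -> M < normc (S u)].
Proof.
have [a [b [S [[a0 b0 S0] HS Hb Ha]]]] := maximal_strip.
exists a, b, S; split => //.
  by apply: (escape_top F_cder apm Fap Fam a0 b0 HS); rewrite S0.
have Fd' := opp_cder F_cder.
have [|||||||t Ht] := @escape_top R (fun z => - F z) am ap Fd' _ _ _ (- b) (- a) (fun u => S (- u)) _ _ (opp_band HS).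
- exact/nesym.
- by rewrite Fam oppr0.
- by rewrite Fap oppr0.
- lra.
- lra.
- by rewrite oppr0 S0; exact: opp_het.
- move=> b' S' bb' S'0 HS'; apply: (Ha (- b') (fun u => S' (- u))); first lra.
    by rewrite oppr0 S'0 oppr0.
  have := opp_band HS'; rewrite opprK.
  by rewrite (_ : (fun z => - - F z) = F) //; apply/funext => z; rewrite opprK.
exists (- t) => M; have [d d0 Hd] := Ht M; exists d => // u hu hd.
have := Hd (- u); rewrite opprK; apply.
  by move: hu; rewrite /band /strip /= ImN => /andP[h1 h2]; apply/andP; split; lra.
rewrite -nmN; rewrite (_ : - _ = u - (- t +i* a)) //.
by apply: complex_eqP; rewrite !ReImE /=; ring.
Qed.

End maximal_strip.

(** * The separating circle-valued function *)

Section lifting.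
Context {R : realType}.
Local Notation C := R[i].
Local Open Scope complex_scope.

Lemma int_valued_cst (g : R -> R) (a b : R) : a <= b ->
  (forall s, a <= s <= b -> exists k : int, g s = k%:~R) ->
  (forall s, a <= s <= b -> exists2 d : R, 0 < d &
     forall s', a <= s' <= b -> `|s' - s| < d -> `|g s' - g s| < 1) ->
  g b = g a.
Proof.
move=> ab gi gc.
have eqi s s' : a <= s <= b -> a <= s' <= b -> `|g s' - g s| < 1 -> g s' = g s.
  move=> /gi[k ->] /gi[l ->]; rewrite -rmorphB /= -intr_norm ltrz1 => h.
  by congr _%:~R; apply/eqP; rewrite -subr_eq0 -normr_eq0 eq_le normr_ge0 andbT -ltzD1.
apply: (@real_ind R a b (fun s => g s = g a)); last by rewrite ab lexx.
- by [].
- move=> s /andP[s0 s1] Hs; have hs : a <= s <= b by rewrite s0 ltW.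
  have [d d0 Hd] := gc s hs; exists d => // s' /andP[ss' s'd] s'b.
  have hs' : a <= s' <= b by apply/andP; split; lra.
  rewrite (eqi s s') //; first by apply: Hs; rewrite s0 lexx.
  by apply: Hd => //; rewrite ger0_norm; lra.
- move=> s /andP[s0 s1] Hs; have hs : a <= s <= b by rewrite s1 ltW.
  have [d d0 Hd] := gc s hs.
  pose u := Num.max a (s - d / 2).
  have us : u < s by rewrite /u gt_max s0 /=; lra.
  have u1 : a <= u by rewrite /u le_max lexx.
  have ud : s - d / 2 <= u by rewrite /u le_max lexx orbT.
  have hu : a <= u <= b by apply/andP; split; lra.
  rewrite -(Hs u) ?u1 //; apply/esym/eqi => //.
  by apply: Hd => //; rewrite ltr0_norm; lra.
Qed.

Variable w : C -> R.

(* A continuous lift over A of the circle-valued map [w mod 1]. *)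
Definition lift (A : set C) := exists v : C -> R,
  (forall z, A z -> exists k : int, v z = w z + k%:~R) /\
  (forall z, A z -> forall e : R, 0 < e -> exists2 d : R, 0 < d &
     forall z', A z' -> normc (z' - z) < d -> `|v z' - v z| < e).

Lemma lift_sub A B : A `<=` B -> lift B -> lift A.
Proof.
move=> AB [v [v1 v2]]; exists v; split; first by move=> z /AB/v1.
move=> z Az e e0; have [d d0 Hd] := v2 z (AB _ Az) e e0.
by exists d => // z' /AB; exact: Hd.
Qed.

(** On the seam [phi = m] the two lifts differ by an integer varying continuously; the seam is
    convex, so this integer is constant and can be added to the second lift. *)
Lemma lift_glue (Q : set C) (phi : C -> R) (m : R) :
  (forall z z', `|phi z - phi z'| <= normc (z - z')) ->
  cvx [set z | Q z /\ phi z = m] ->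
  lift [set z | Q z /\ phi z <= m] -> lift [set z | Q z /\ m <= phi z] -> lift Q.
Proof.
move=> phi1 Ecvx [v1 [i1 c1]] [v2 [i2 c2]].
have [k Hk] : exists k : int, forall z, Q z -> phi z = m -> v1 z = v2 z + k%:~R.
  have [[z0 [Q0 E0]]|none] := pselect (exists z, Q z /\ phi z = m); last first.
    by exists 0 => z Qz zm; exfalso; apply: none; exists z.
  have [k1 H1] := i1 z0 ltac:(by split; rewrite // E0).
  have [k2 H2] := i2 z0 ltac:(by split; rewrite // E0).
  exists (k1 - k2) => z Qz zm.
  have E01 (s : R) : 0 <= s <= 1 -> Q (z0 + s%:C * (z - z0)) /\ phi (z0 + s%:C * (z - z0)) = m.
    by move=> hs; apply: Ecvx.
  pose g (s : R) := v1 (z0 + s%:C * (z - z0)) - v2 (z0 + s%:C * (z - z0)).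
  have g01 : g 1 = g 0.
    apply: int_valued_cst => // s hs; have [Qs Es] := E01 s hs.
      have [l1 L1] := i1 (z0 + s%:C * (z - z0)) ltac:(by split; rewrite // Es).
      have [l2 L2] := i2 (z0 + s%:C * (z - z0)) ltac:(by split; rewrite // Es).
      by exists (l1 - l2); rewrite /g L1 L2 rmorphB /=; ring.
    have h2 : 0 < (2^-1 : R) by rewrite invr_gt0.
    have [d1 d10 D1] := c1 (z0 + s%:C * (z - z0)) ltac:(by split; rewrite // Es) _ h2.
    have [d2 d20 D2] := c2 (z0 + s%:C * (z - z0)) ltac:(by split; rewrite // Es) _ h2.
    have n1 : 0 < normc (z - z0) + 1 by have := nm_ge0 (z - z0); lra.
    exists (Num.min d1 d2 / (normc (z - z0) + 1)); first by rewrite divr_gt0 // lt_min d10.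
    move=> s' hs'; rewrite ltr_pdivlMr // => hd; have [Qs' Es'] := E01 s' hs'.
    have dist : normc (z0 + s'%:C * (z - z0) - (z0 + s%:C * (z - z0))) < Num.min d1 d2.
      rewrite (_ : _ - _ = (s' - s)%:C * (z - z0)); last by rewrite rmorphB; ring.
      rewrite normcM nm_real; have := normr_ge0 (s' - s); nra.
    rewrite lt_min in dist; case/andP: dist => x1 x2.
    have := D1 _ ltac:(by split; [exact: Qs'|rewrite Es']) x1.
    have := D2 _ ltac:(by split; [exact: Qs'|rewrite Es']) x2.
    rewrite /g !ltr_norml => /andP[y1 y2] /andP[y3 y4]; apply/andP; split; lra.
  move: g01; rewrite /g rmorph0 rmorph1 !mul0r !mul1r !addr0 (addrC z0) subrK H1 H2.
  by rewrite rmorphB /=; lra.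
exists (fun z => if phi z <= m then v1 z else v2 z + k%:~R); split.
  move=> z Qz; case: ifP => [h|/negbT]; first exact: i1.
  rewrite -ltNge => h; have [l ->] := i2 z (conj Qz (ltW h)).
  by exists (l + k); rewrite rmorphD /= addrA.
move=> z Qz e e0.
have vl z' : Q z' -> phi z' <= m -> (if phi z' <= m then v1 z' else v2 z' + k%:~R) = v1 z'.
  by move=> _ ->.
have vr z' : Q z' -> m <= phi z' -> (if phi z' <= m then v1 z' else v2 z' + k%:~R) = v2 z' + k%:~R.
  move=> Qz' h; case: ifP => // h'; apply: Hk => //; apply/eqP; by rewrite eq_le h h'.
have [zm|zm|zm] := ltgtP (phi z) m.
- have [d d0 Hd] := c1 z (conj Qz (ltW zm)) e e0.
  exists (Num.min d (m - phi z)); first by rewrite lt_min d0 subr_gt0.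
  move=> z' Qz'; rewrite lt_min => /andP[h1 h2].
  have h3 : phi z' <= m.
    by have := le_lt_trans (phi1 z' z) h2; rewrite ltr_norml => /andP[]; lra.
  by rewrite !vl // ?ltW //; apply: Hd.
- have [d d0 Hd] := c2 z (conj Qz (ltW zm)) e e0.
  exists (Num.min d (phi z - m)); first by rewrite lt_min d0 subr_gt0.
  move=> z' Qz'; rewrite lt_min => /andP[h1 h2].
  have h3 : m <= phi z'.
    by have := le_lt_trans (phi1 z' z) h2; rewrite ltr_norml => /andP[]; lra.
  have h4 : m <= phi z by exact: ltW.
  rewrite !vr // (_ : _ - _ = v2 z' - v2 z); last by ring.
  exact: Hd.
- have lz : phi z <= m by rewrite zm.
  have rz : m <= phi z by rewrite zm.
  have [d d0 Hd] := c1 z (conj Qz lz) e e0.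
  have [d' d'0 Hd'] := c2 z (conj Qz rz) e e0.
  exists (Num.min d d'); first by rewrite lt_min d0.
  move=> z' Qz'; rewrite lt_min => /andP[h1 h2].
  have [h3|/ltW h3] := leP (phi z') m.
    exact: Hd.
  by rewrite (Hk z) // (_ : _ - _ = v2 z' - v2 z); [exact: Hd'|ring].
Qed.

Lemma between_cvx (x y p q s : R) : x <= p <= y -> x <= q <= y -> 0 <= s <= 1 ->
  x <= p + s * (q - p) <= y.
Proof.
move=> /andP[p1 p2] /andP[q1 q2] /andP[s0 s1].
have h1 : 0 <= (1 - s) * (p - x) by rewrite mulr_ge0 // subr_ge0.
have h2 : 0 <= s * (q - x) by rewrite mulr_ge0 // subr_ge0.
have h3 : 0 <= (1 - s) * (y - p) by rewrite mulr_ge0 // subr_ge0.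
have h4 : 0 <= s * (y - q) by rewrite mulr_ge0 // subr_ge0.
by apply/andP; split; lra.
Qed.

(** Lifts on the four quarters are glued across the vertical seam within each row, and the rows
    across the horizontal one. *)
Lemma lift_rect (a b c d : R) : a < b -> c < d ->
  (forall z, exists2 e : R, 0 < e & lift [set z' | normc (z' - z) < e]) -> lift (rect a b c d).
Proof.
move=> ab cd loc.
apply: (@rect_ind R a b c d (fun a b c d => lift (rect a b c d)) ab cd).
  move=> x1 x2 m y1 y2 n /andP[xm1 xm2] /andP[ym1 ym2] H1 H2 H3 H4.
  have RE (z z' : C) : `|complex.Re z - complex.Re z'| <= normc (z - z').
    by rewrite -ReN -ReD; exact: nm_Re.
  have IE (z z' : C) : `|complex.Im z - complex.Im z'| <= normc (z - z').
    by rewrite -ImN -ImD; exact: nm_Im.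
  have row y y' : lift (rect x1 m y y') -> lift (rect m x2 y y') -> lift (rect x1 x2 y y').
    move=> L1 L2; apply: (lift_glue (phi := @complex.Re R) (m := m)) => //.
    - move=> [x0 y0] [x0' y0'] [/= [_ h1] e1] [/= [_ h2] e2] s hs.
      rewrite /mkset /rect /= !mul0r !subr0 !addr0 e1 e2 subrr mulr0 addr0; split => //; split.
        by apply/andP; split; lra.
      exact: between_cvx.
    - apply: lift_sub L1 => z [[/andP[h1 h2] h3] h4]; split => //; by rewrite h1 h4.
    - apply: lift_sub L2 => z [[/andP[h1 h2] h3] h4]; split => //; by rewrite h2 h4.
  apply: (lift_glue (phi := @complex.Im R) (m := n)) => //.
  - move=> [x0 y0] [x0' y0'] [/= [h1 _] e1] [/= [h2 _] e2] s hs.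
    rewrite /mkset /rect /= !mul0r !subr0 !addr0 e1 e2 subrr mulr0 addr0; split => //; split.
      exact: between_cvx.
    by apply/andP; split; lra.
  - apply: lift_sub (row _ _ H1 H2) => z [[h3 /andP[h1 h2]] h4]; split => //; by rewrite h1 h4.
  - apply: lift_sub (row _ _ H3 H4) => z [[h3 /andP[h1 h2]] h4]; split => //; by rewrite h2 h4.
move=> x y _ _; have [e e0 He] := loc (x +i* y).
exists (e / 2); first by rewrite divr_gt0.
move=> k a' b' c' d' _ _ _ _ /andP[h1 h2] /andP[h3 h4] _ _ _ _ h5 h6.
apply: lift_sub He => z [/andP[h7 h8] /andP[h9 h10]] /=.
apply: le_lt_trans (nm_le_ReIm _) _; rewrite !ReImE /= [e]splitr.
by apply: ltrD; rewrite ltr_norml; apply/andP; split; lra.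
Qed.

End lifting.

Section real_valued.
Context {R : realType}.
Local Notation C := R[i].
Local Open Scope complex_scope.
Implicit Types (f g : C -> R).

Lemma rcont_ccont f z : rcont f z <-> ccont (fun u => (f u)%:C) z.
Proof.
split=> H e /H[r r0 Hr]; exists r => // u.
  by have := Hr (z + u); rewrite addrAC subrr add0r -rmorphB nm_real; apply.
by have := Hr (u - z); rewrite (addrC z) subrK -rmorphB nm_real; apply.
Qed.

Lemma rcontM f g z : rcont f z -> rcont g z -> rcont (fun u => f u * g u) z.
Proof.
move=> /rcont_ccont fc /rcont_ccont gc; apply/rcont_ccont.
rewrite (_ : (fun u => _) = fun u => (f u)%:C * (g u)%:C); first exact: ccontM.
by apply/funext => u; rewrite rmorphM.
Qed.

Lemma rcontV f z : f z != 0 -> rcont f z -> rcont (fun u => (f u)^-1) z.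
Proof.
move=> fz /rcont_ccont fc; apply/rcont_ccont.
have fz' : (f z)%:C != 0 by rewrite -nm_gt0 nm_real normr_gt0.
have := ccont_comp (f := GRing.inv) (cder_ccont (cder_inv fz')) fc.
apply: (@ccont_near _ _ _ _ 1) => // h _.
by apply/esym; exact: fmorphV.
Qed.

Lemma rcontD f g z : rcont f z -> rcont g z -> rcont (fun u => f u + g u) z.
Proof.
move=> fc gc e e0; have e2 : 0 < e / 2 by rewrite divr_gt0.
have [r r0 Hr] := fc _ e2; have [s s0 Hs] := gc _ e2.
exists (Num.min r s); first by rewrite lt_min r0.
move=> u; rewrite lt_min => /andP[/Hr h1 /Hs h2].
rewrite (_ : _ - _ = (f u - f z) + (g u - g z)); last by ring.
by apply: le_lt_trans (ler_normD _ _) _; rewrite [e]splitr ltrD.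
Qed.

Lemma rcont_cst (c : R) z : rcont (fun=> c) z.
Proof. by move=> e e0; exists 1 => // u _; rewrite subrr normr0. Qed.

Lemma rcont_Re z : rcont (@complex.Re R) z.
Proof.
move=> e e0; exists e => // u; rewrite -ReN -ReD; apply: le_lt_trans; exact: nm_Re.
Qed.

Lemma rcont_Im z : rcont (@complex.Im R) z.
Proof.
move=> e e0; exists e => // u; rewrite -ImN -ImD; apply: le_lt_trans; exact: nm_Im.
Qed.

Definition clamp (x : R) := Num.max 0 (Num.min 1 x).

Lemma clampP (x : R) : [\/ x <= 0 /\ clamp x = 0, 0 <= x <= 1 /\ clamp x = x | 1 <= x /\ clamp x = 1].
Proof.
have [x0|x0] := leP x 0.
  by apply: Or31; split => //; rewrite /clamp (min_idPr _) ?(max_idPl _) //; lra.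
have [x1|x1] := leP x 1.
  apply: Or32; split; first by rewrite ltW.
  by rewrite /clamp (min_idPr _) ?(max_idPr _) // ltW.
apply: Or33; split; first exact: ltW.
by rewrite /clamp (min_idPl _) ?(max_idPr _) // ltW.
Qed.

(** [2^-1 + x / (2 * y)] maps the interval from [- y] to [y] affinely onto that from 0 to 1. *)
Lemma clamp_hi (x y : R) : 0 < y -> y <= x -> clamp (2^-1 + x / (2 * y)) = 1.
Proof.
move=> y0 xy; have : 2^-1 <= x / (2 * y) by rewrite ler_pdivlMr ?mulr_gt0 //; lra.
by move=> h; rewrite /clamp (min_idPl _) ?(max_idPr _) //; lra.
Qed.

Lemma clamp_lo (x y : R) : 0 < y -> x <= - y -> clamp (2^-1 + x / (2 * y)) = 0.
Proof.
move=> y0 xy; have : x / (2 * y) <= - 2^-1 by rewrite ler_pdivrMr ?mulr_gt0 //; lra.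
by move=> h; rewrite /clamp (min_idPr _) ?(max_idPl _) //; lra.
Qed.

Lemma rcont_clamp f z : rcont f z -> rcont (fun u => clamp (f u)) z.
Proof.
move=> fc e /fc[r r0 Hr]; exists r => // u /Hr; apply: le_lt_trans.
rewrite ler_norml; have := ler_norm (f u - f z); have := ler_norm (- (f u - f z)).
rewrite normrN => h1 h2; have := clampP (f u); have := clampP (f z).
by case=> [[k1 ->]|[k1 ->]|[k1 ->]] [[k2 ->]|[k2 ->]|[k2 ->]]; apply/andP; split; lra.
Qed.

End real_valued.

(** * No heteroclinic orbit outside the image of the strip *)

Section separation.
Context {R : realType}.
Local Notation C := R[i].
Local Open Scope complex_scope.
Variables (F : C -> C) (ap am : C).
Hypothesis F_cder : forall z, exists d, cder F z d.
Hypothesis apm : ap <> am.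
Hypothesis Fap : F ap = 0.
Hypothesis Fam : F am = 0.
Local Notation het := (heteroclinic F ap am).
Local Notation hsol := (hsol F).

Section over_band.
Variables (a b : R) (S : C -> C).
Hypothesis a0 : a < 0.
Hypothesis b0 : 0 < b.
Hypothesis S_hsol : hsol (band a b) S.
Hypothesis S0_het : het (S 0).

Lemma band0 : [set y : R | a < y < b] 0.
Proof. by rewrite /= a0 b0. Qed.

Lemma band_seg u v : band a b u -> band a b v -> seg F S u v.
Proof. exact: (strip_seg (@ivl_oo R a b) S_hsol). Qed.

Lemma band_het u : band a b u -> het (S u).
Proof. exact: (strip_het F_cder apm Fap Fam (@ivl_oo R a b) band0 S_hsol S0_het). Qed.

Lemma band_nz u : band a b u -> F (S u) != 0.
Proof. exact: (strip_nz F_cder apm Fap Fam (@ivl_oo R a b) band0 S_hsol S0_het). Qed.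

Lemma band_inj u v : band a b u -> band a b v -> S u = S v -> u = v.
Proof. exact: (strip_inj F_cder apm Fap Fam (@ivl_oo R a b) (@open_oo R a b) band0 S_hsol S0_het). Qed.

(** By the last clause of [flow_box], a value near [S u] is reached after a complex time at most [K]
    times its distance, hence short enough to stay in the band. *)
Lemma band_inv_cont u : band a b u -> forall e : R, 0 < e -> exists2 d : R, 0 < d &
  forall z, normc (z - S u) < d -> exists v, [/\ band a b v, normc (v - u) < e & S v = z].
Proof.
move=> hu e e0; have [d [k [K [d0 k0 K0 H]]]] := flow_box F_cder (band_nz hu).
have [c c0 Hc] := open_oo hu.
have m0 : 0 < Num.min d (Num.min e c / K) by rewrite lt_min d0 divr_gt0 // lt_min e0.
exists (Num.min d (Num.min e c / K)) => // z; rewrite lt_min => /andP[h1 h2].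
have [|f [f0 fs fE]] := H (S u); first by rewrite subrr nm00.
have [x [x1 x2 x3]] := fE z h1.
have xs : normc x < Num.min e c.
  apply: le_lt_trans x2 _; rewrite mulrC -ltr_pdivlMr //.
  by rewrite nmBC.
rewrite lt_min in xs; case/andP: xs => xe xc.
have hv : band a b (u + x).
  rewrite /band /strip /=; apply: Hc; rewrite ImD addrAC subrr add0r.
  exact: le_lt_trans (nm_Im _) xc.
exists (u + x); split => //; first by rewrite addrAC subrr add0r.
rewrite -x3; apply: (seg_unique (u' := 0) F_cder (band_seg hu hv)); last by rewrite f0.
  apply: (hsol_seg fs) => s hs; apply: cvx_ball0 => //.
  by rewrite /mkset nm00.
by rewrite subr0 addrAC subrr add0r.
Qed.

Lemma band_rcont (p : R) (q : C) u : band a b u -> rcont (fun v => normc (S v - q)) u.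
Proof.
move=> hu e e0; have [r r0 Hr] := gder_cont (S_hsol hu) e0.
exists r => // v hv; have := Hr (v - u) hv; rewrite (addrC u) subrK; apply: le_lt_trans.
rewrite ler_norml; have h1 := nm_tri (S u) (S v) q; have := nm_tri (S v) (S u) q.
by rewrite (nmBC (S u) (S v)) => h2; apply/andP; split; lra.
Qed.

Section with_escape.
Variables (t1 t2 : R).
Hypothesis top : forall M, exists2 d : R, 0 < d &
  forall u, band a b u -> normc (u - (t1 +i* b)) < d -> M < normc (S u).
Hypothesis bot : forall M, exists2 d : R, 0 < d &
  forall u, band a b u -> normc (u - (t2 +i* a)) < d -> M < normc (S u).

(* The cut: a neighbourhood of the segment from [t2 + i a] to [t1 + i b], pinched
   at its two ends, where [S] escapes to infinity. Across it [theta] climbs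
   from 0 to 1. *)
Let ell (y : R) := t2 + (y - a) / (b - a) * (t1 - t2).
Let wid (y : R) := (y - a) * (b - y).
Let theta (u : C) := clamp (2^-1 + (complex.Re u - ell (complex.Im u)) / (2 * wid (complex.Im u))).

Let ab0 : 0 < b - a. Proof. by have := a0; have := b0; lra. Qed.

Let wid_gt0 u : band a b u -> 0 < wid (complex.Im u).
Proof. by move=> /andP[h1 h2]; rewrite /wid mulr_gt0 // subr_gt0. Qed.

Let theta_cont u : band a b u -> rcont theta u.
Proof.
move=> hu; apply: rcont_clamp; apply: rcontD; first exact: rcont_cst.
have c1 := @rcont_cst R.
have cI (c : R) : rcont (fun v => complex.Im v + c) u by apply: rcontD; [exact: rcont_Im|].
apply: rcontM.
  apply: rcontD; first exact: rcont_Re.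
  have -> : (fun v => - ell (complex.Im v)) =
      (fun v : C => - t2 + (complex.Im v + - a) * (- (b - a)^-1 * (t1 - t2))).
    by apply/funext => v; rewrite /ell; field; rewrite gt_eqF.
  by apply: rcontD => //; apply: rcontM.
have wu := wid_gt0 hu.
apply: rcontV; first by rewrite gt_eqF // mulr_gt0.
rewrite /wid; apply: rcontM => //; apply: rcontM; first exact: cI.
have -> : (fun v => b - complex.Im v) = (fun v : C => b + -1 * complex.Im v).
  by apply/funext => v; rewrite mulN1r.
by apply: rcontD => //; apply: rcontM => //; exact: rcont_Im.
Qed.

Let theta_int u : band a b u -> wid (complex.Im u) <= `|complex.Re u - ell (complex.Im u)| ->
  theta u = 0 \/ theta u = 1.
Proof.
move=> hu; have wu := wid_gt0 hu.
set x := complex.Re u - _; set y := wid _ in wu *; rewrite /theta -/x -/y => h; clearbody x y.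
have [x0|x0] := leP 0 x.
  by rewrite ger0_norm // in h; right; exact: clamp_hi.
by rewrite ltr0_norm // in h; left; apply: clamp_lo => //; lra.
Qed.

(** Near its two pinched ends the cut is mapped outside the disc of radius [|z| + 1]; what remains
    lies in a compact rectangle, on which the distance to [z] is bounded below. *)
Let cut_closed z : (forall u, band a b u -> S u <> z) -> exists2 d : R, 0 < d &
  forall u, band a b u -> `|complex.Re u - ell (complex.Im u)| < wid (complex.Im u) ->
    d <= normc (S u - z).
Proof.
move=> nz.
have ha0 := a0; have hb0 := b0; have hab := ab0.
have [d1 d10 H1] := top (normc z + 1); have [d2 d20 H2] := bot (normc z + 1).
pose t12 := `|t1 - t2|; have t120 : 0 <= t12 by exact: normr_ge0.
(* On the cut at height [y] the distance to [t1 + i b] is below [(b - y) * K], the summands coming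
   from the width, from the slope of the axis and from the height; likewise at the lower end. *)
pose K := (b - a) + t12 / (b - a) + 1.
have K0 : 0 < K by rewrite /K; have := divr_ge0 t120 (ltW ab0); lra.
pose e1 := Num.min (d1 / K) ((b - a) / 4).
pose e2 := Num.min (d2 / K) ((b - a) / 4).
have e10 : 0 < e1 by rewrite lt_min !divr_gt0.
have e20 : 0 < e2 by rewrite lt_min !divr_gt0.
have e1K : e1 * K <= d1 by rewrite -ler_pdivlMr // /e1 ge_min lexx.
have e2K : e2 * K <= d2 by rewrite -ler_pdivlMr // /e2 ge_min lexx.
have e14 : e1 <= (b - a) / 4 by rewrite /e1 ge_min lexx orbT.
have e24 : e2 <= (b - a) / 4 by rewrite /e2 ge_min lexx orbT.
clearbody e1 e2.
have far u : normc z + 1 < normc (S u) -> 1 <= normc (S u - z).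
  by have := nm_le_add z (S u); lra.
have ellb y : ell y - t1 = (y - b) * ((t1 - t2) / (b - a)) by rewrite /ell; field; rewrite gt_eqF.
have ella y : ell y - t2 = (y - a) * ((t1 - t2) / (b - a)) by rewrite /ell; field; rewrite gt_eqF.
have nq : `|(t1 - t2) / (b - a)| = t12 / (b - a) by rewrite normrM normfV (gtr0_norm ab0).
set q := t12 / (b - a) in nq K K0 e1K e2K.
have q0 : 0 <= q by exact: divr_ge0 t120 (ltW ab0).
clearbody q.
(* Exceeds every real part on the cut in modulus: the half-width is at most [(b - a) ^ 2], and the
   axis is within [(b - a) * q] of [t2]. *)
pose T := `|t2| + (b - a) * q + (b - a) * (b - a) + 1.
have nt2 := normr_ge0 t2.
have T0 : 0 < T.
  have := mulr_ge0 (ltW ab0) q0; have := mulr_gt0 ab0 ab0; rewrite /T; lra.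
have ltT : - T < T by lra.
have lte : a + e2 < b - e1 by lra.
have inb u : rect (- T) T (a + e2) (b - e1) u -> band a b u.
  by move=> [_ /andP[h1 h2]]; apply/andP; split; lra.
have [|||d d0 Hd] := @rect_cover R (- T) T (a + e2) (b - e1) (fun A => exists2 d : R, 0 < d &
    forall u, rect (- T) T (a + e2) (b - e1) u -> A u -> d <= normc (S u - z)) ltT lte.
- by move=> A B AB [d d0 H]; exists d => // u hu /AB; exact: H.
- move=> A B [d d0 H] [d' d'0 H']; exists (Num.min d d'); first by rewrite lt_min d0.
  by move=> u hu; rewrite ge_min => -[/(H _ hu) ->|/(H' _ hu) ->]; rewrite ?orbT.
- move=> u hu; have n0 : 0 < normc (S u - z).
    by rewrite nm_gt0 subr_eq0; apply/eqP/nz/inb.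
  have [r r0 Hr] := band_rcont 0 z (inb _ hu) (ltac:(by rewrite divr_gt0) : 0 < normc (S u - z) / 2).
  exists r => //; exists (normc (S u - z) / 2); first by rewrite divr_gt0.
  by move=> v _ [_ /Hr]; rewrite ltr_norml => /andP[]; lra.
exists (Num.min 1 d); first by rewrite lt_min ltr01.
move=> u hu hw; rewrite ge_min; apply/orP.
case/andP: (hu) => hu1 hu2.
set x := complex.Re u in hw *; set y := complex.Im u in hw hu1 hu2 *.
move: hw; rewrite ltr_norml => /andP[w1 w2].
have [h1|h1] := ltP (b - e1) y.
  left; apply/far/H1 => //.
  apply: le_lt_trans (nm_le_ReIm _) _; rewrite !ReImE /= -/x -/y.
  have yb : `|y - b| = b - y by rewrite ltr0_norm ?subr_lt0 // opprB.
  have l1 : `|ell y - t1| = (b - y) * q by rewrite ellb normrM nq yb.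
  have wy : wid y <= (b - y) * (b - a) by rewrite /wid mulrC ler_pM2l ?subr_gt0 // lerD2r ltW.
  have lt : `|x - t1| <= `|x - ell y| + `|ell y - t1| by exact: ler_distD.
  have : `|x - ell y| < wid y by rewrite ltr_norml w1 w2.
  rewrite l1 in lt; rewrite yb.
  have : (b - y) * K < d1 by apply: lt_le_trans e1K; rewrite ltr_pM2r // ltrBlDr -ltrBlDl.
  rewrite /K; lra.
have [h2|h2] := ltP y (a + e2).
  left; apply/far/H2 => //.
  apply: le_lt_trans (nm_le_ReIm _) _; rewrite !ReImE /= -/x -/y.
  have yb : `|y - a| = y - a by rewrite gtr0_norm ?subr_gt0.
  have l1 : `|ell y - t2| = (y - a) * q by rewrite ella normrM nq yb.
  have wy : wid y <= (y - a) * (b - a) by rewrite /wid ler_pM2l ?subr_gt0 // lerD2l lerN2 ltW.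
  have lt : `|x - t2| <= `|x - ell y| + `|ell y - t2| by exact: ler_distD.
  have : `|x - ell y| < wid y by rewrite ltr_norml w1 w2.
  rewrite l1 in lt; rewrite yb.
  have : (y - a) * K < d2 by apply: lt_le_trans e2K; rewrite ltr_pM2r // ltrBlDl.
  rewrite /K; lra.
right; have hr : rect (- T) T (a + e2) (b - e1) u.
  split; last by rewrite -/y h1 h2.
  rewrite -/x -ler_norml /T.
  have : `|x| <= `|x - ell y| + (`|ell y - t2| + `|t2|).
    rewrite -[X in `|X| <= _](_ : (x - ell y) + ((ell y - t2) + t2) = x); last by ring.
    by apply: le_trans (ler_normD _ _) _; rewrite lerD2l; exact: ler_normD.
  have : `|x - ell y| < wid y by rewrite ltr_norml w1 w2.
  have yb : `|y - a| = y - a by rewrite gtr0_norm ?subr_gt0.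
  rewrite ella normrM nq yb.
  have : wid y <= (b - a) * (b - a) by rewrite /wid ler_pM ?subr_ge0 ?lerD2r ?lerD2l ?lerN2 ?(ltW hu1) ?(ltW hu2).
  have : (y - a) * q <= (b - a) * q by rewrite ler_wpM2r // lerD2r ltW.
  lra.
exact: (Hd u hr hr).
Qed.

(** [theta] carried to the plane by [S]. It may jump between 1 and the default 0 where the image of
    the strip ends, but only by an integer, because the cut does not come near such points. *)
Let ww (z : C) : R := if pselect (exists u, band a b u /\ S u = z) is left h
  then theta (projT1 (cid h)) else 0.

Let ww_S u : band a b u -> ww (S u) = theta u.
Proof.
move=> hu; rewrite /ww; case: pselect => [h|]; last by case; exists u.
by case: (cid h) => v /= [hv /band_inj ->].
Qed.

Let ww_out z : (forall u, band a b u -> S u <> z) -> ww z = 0.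
Proof.
move=> nz; rewrite /ww; case: pselect => // -[u [hu E]].
by exfalso; exact: nz E.
Qed.

(** At a point of the image [ww] is itself continuous. Around any other point the cut keeps away,
    [ww] takes integer values, and the constant 0 is a lift. *)
Let ww_lift z : exists2 e : R, 0 < e & lift ww [set z' | normc (z' - z) < e].
Proof.
have [[u [hu <-]]|nz] := pselect (exists u, band a b u /\ S u = z).
  have [e e0 He] := band_inv_cont hu ltr01.
  exists e => //; exists ww; split; first by move=> z' _; exists 0; rewrite addr0.
  move=> z' /= /He[v [hv _ <-]] e' e'0.
  have [r r0 Hr] := theta_cont hv e'0.
  have [d d0 Hd] := band_inv_cont hv r0.
  exists d => // x _ /Hd[v' [hv' v'r <-]].
  by rewrite !ww_S //; exact: Hr.
have nz' u : band a b u -> S u <> z by move=> hu E; apply: nz; exists u.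
have [d d0 Hd] := cut_closed nz'.
exists d => //; exists (fun=> 0); split; last first.
  by move=> z1 _ e e0; exists 1 => // z' _ _; rewrite subrr normr0.
move=> z' /= hz'; have [[u [hu E]]|nu] := pselect (exists u, band a b u /\ S u = z').
  rewrite -E ww_S //.
  have [|->|->] := @theta_int u hu.
  - rewrite leNgt; apply/negP => /(Hd _ hu); rewrite E; lra.
  - by exists 0; rewrite addr0.
  - by exists (-1); rewrite rmorphN rmorph1 subrr.
rewrite ww_out; first by exists 0; rewrite addr0.
by move=> u hu E; apply: nu; exists u.
Qed.

Let het_bounded z : (forall t, rder z t (F (z t))) -> limp z ap -> limm z am ->
  exists M, forall t, normc (z t) <= M.
Proof.
move=> Hz Lp Lm; have [N1 HN1] := Lp 1 ltr01; have [N2 HN2] := Lm 1 ltr01.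
pose N := Num.max `|N1| `|N2|.
have N0 : 0 <= N by rewrite le_max normr_ge0.
have NN : - N <= N by lra.
have [|c _ Hc] := @EVT_max R (fun t => normc (z t)) (- N) N NN.
  apply: continuous_subspaceT => t; apply/econtP => e e0.
  have [r r0 Hr] := gder_cont (Hz t) e0; exists r => // h hr.
  have := Hr h; rewrite nm_real => /(_ hr); apply: le_lt_trans.
  rewrite ler_norml; have := nm_le_add (z t) (z (t + h)); have := nm_le_add (z (t + h)) (z t).
  by rewrite (nmBC (z t)) => h1 h2; apply/andP; split; lra.
exists (Num.max (normc (z c)) (Num.max (normc ap + 1) (normc am + 1))) => t.
rewrite !le_max; have [h1|h1] := leP N1 t.
  have := HN1 t h1; have := nm_le_add ap (z t) => h2 h3.
  by apply/orP; right; apply/orP; left; lra.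
have [h2|h2] := leP t (- N2).
  have := HN2 t h2; have := nm_le_add am (z t) => h3 h4.
  by apply/orP; right; apply/orP; right; lra.
apply/orP; left; apply: Hc; rewrite in_itv /=.
have l1 : `|N1| <= N by rewrite le_max lexx.
have l2 : `|N2| <= N by rewrite le_max lexx orbT.
have := ler_norm N1; have := ler_norm N2; move=> h3 h4; apply/andP; split; lra.
Qed.

Lemma band_onto_escape q : het q -> exists u, band a b u /\ S u = q.
Proof.
move=> hq; apply: contrapT => nq.
have B0 : band a b 0 by exact: band0.
have [z [z0 Hz Lp Lm]] := hq.
have [y [y0 Hy Yp Ym]] := band_het B0.
have yE t : y t = S t%:C.
  have H := fun t => strip_line S_hsol t B0.
  have := flow_unique (t0 := 0) F_cder Hy H; rewrite addr0 y0 => /(_ erefl t) ->.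
  by rewrite add0r.
(* An orbit that meets the image of the strip stays in it, and [q] would be attained. *)
have zout t u : band a b u -> S u <> z t.
  move=> hu E; apply: nq; exists (u + (- t)%:C).
  have H := fun s => strip_line S_hsol s hu.
  split; first by move: hu; rewrite /band /strip /= ImD /= addr0.
  have Hz' s : rder (fun s => z (s + t)) s (F (z (s + t))).
    have := @rder_reparam R z t 1 s (F (z (s + t))); rewrite mulr1 rmorph1 mul1r (addrC t).
    move=> /(_ (Hz _)).
    by rewrite (_ : (fun s => _) = (fun s => z (s + t))) //; apply/funext => x; rewrite mulr1 addrC.
  have := flow_unique (t0 := 0) F_cder H Hz'; rewrite addr0 add0r => /(_ E (- t)) ->.
  by rewrite addNr.
have [M1 HM1] := het_bounded Hz Lp Lm; have [M2 HM2] := het_bounded Hy Yp Ym.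
(* A square around both orbits and both equilibria; the lift is needed nowhere else. *)
pose M := Num.max (Num.max M1 M2) (Num.max (normc ap) (normc am)) + 1.
have M10 : 0 <= M1 by apply: le_trans (HM1 0); exact: nm_ge0.
have [m1 m2 m3 m4] : [/\ M1 < M, M2 < M, normc ap < M & normc am < M].
  by split; rewrite /M ltr_pwDr // !le_max lexx ?orbT.
have M0 : - M < M by lra.
have [v [v1 v2]] := lift_rect M0 M0 ww_lift.
have inr x : normc x < M -> rect (- M) M (- M) M x.
  by move=> h; split; rewrite -ler_norml; [have := nm_Re x|have := nm_Im x]; lra.
have zin t : rect (- M) M (- M) M (z t) by apply: inr; exact: le_lt_trans (HM1 t) m1.
have yin t : rect (- M) M (- M) M (y t) by apply: inr; exact: le_lt_trans (HM2 t) m2.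
have apin := inr _ m3; have amin := inr _ m4.
have vcurve g : (forall t, rder g t (F (g t))) -> (forall t, rect (- M) M (- M) M (g t)) ->
    forall t (e : R), 0 < e -> exists2 d : R, 0 < d & forall s, `|s - t| < d -> `|v (g s) - v (g t)| < e.
  move=> Hg gin t e e0; have [d d0 Hd] := v2 _ (gin t) e e0.
  have [r r0 Hr] := rder_cont (Hg t) d0.
  by exists r => // s /Hr; apply: Hd.
have vlim g c : (forall t, rect (- M) M (- M) M (g t)) -> rect (- M) M (- M) M c -> limp g c ->
    forall e : R, 0 < e -> exists N, forall t, N <= t -> `|v (g t) - v c| < e.
  move=> gin cin Lg e e0; have [d d0 Hd] := v2 _ cin e e0.
  by have [N HN] := Lg d d0; exists N => t /HN; apply: Hd.
have vlimm g c : (forall t, rect (- M) M (- M) M (g t)) -> rect (- M) M (- M) M c -> limm g c ->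
    forall e : R, 0 < e -> exists N, forall t, t <= - N -> `|v (g t) - v c| < e.
  move=> gin cin Lg e e0; have [d d0 Hd] := v2 _ cin e e0.
  by have [N HN] := Lg d d0; exists N => t /HN; apply: Hd.
have e4 : 0 < (4^-1 : R) by rewrite invr_gt0.
(* Both orbits run from [am] to [ap], but [v] is constant along the orbit of [q],
   which avoids the cut, while it climbs by 1 along the orbit of [S 0]. *)
have zc s t : s <= t -> v (z t) = v (z s).
  move=> st; apply: (@int_valued_cst R (fun t => v (z t)) s t st).
    move=> x _; have [k ->] := v1 _ (zin x); rewrite ww_out; first by exists k; rewrite add0r.
    by move=> u hu; exact: zout.
  by move=> x _; have [d d0 Hd] := vcurve _ Hz zin x 1 ltr01; exists d => // x' _; exact: Hd.
have tin t : band a b t%:C by exact: band0.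
have yc s t : s <= t -> v (y t) - theta t%:C = v (y s) - theta s%:C.
  move=> st; apply: (@int_valued_cst R (fun t => v (y t) - theta t%:C) s t st).
    by move=> x _; have [k ->] := v1 _ (yin x); exists k; rewrite yE ww_S //; ring.
  move=> x _; have h2 : 0 < (2^-1 : R) by rewrite invr_gt0.
  have [d d0 Hd] := vcurve _ Hy yin x _ h2.
  have [d' d'0 Hd'] := theta_cont (tin x) h2.
  exists (Num.min d d'); first by rewrite lt_min d0.
  move=> x' _; rewrite lt_min => /andP[/Hd k1 k2].
  have := Hd' x'%:C; rewrite -rmorphB nm_real => /(_ k2).
  move: k1; rewrite !ltr_norml => /andP[k3 k4] /andP[k5 k6]; apply/andP; split; lra.
have w0 := wid_gt0 B0; rewrite /= in w0.
have th1 t : ell 0 + wid 0 <= t -> theta t%:C = 1.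
  by move=> ht; rewrite /theta /=; apply: clamp_hi => //; lra.
have th0 t : t <= ell 0 - wid 0 -> theta t%:C = 0.
  by move=> ht; rewrite /theta /=; apply: clamp_lo => //; lra.
have [N1 H1] := vlim _ _ zin apin Lp _ e4; have [N2 H2] := vlimm _ _ zin amin Lm _ e4.
have [N3 H3] := vlim _ _ yin apin Yp _ e4; have [N4 H4] := vlimm _ _ yin amin Ym _ e4.
(* At the times [s] and [t] both orbits are, under [v], within [1/4] of their limits, and the orbit
   of [S 0] crosses the cut in between; four such errors cannot bridge the difference 1. *)
pose t := Num.max (Num.max (ell 0 + wid 0) (- N2)) (Num.max N1 N3).
pose s := Num.min (Num.min (ell 0 - wid 0) (Num.min (- N2) (- N4))) t.
have st : s <= t by rewrite /s ge_min lexx orbT.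
have t1' : ell 0 + wid 0 <= t by rewrite /t !le_max lexx.
have t3 : N1 <= t by rewrite /t !le_max lexx !orbT.
have t4 : N3 <= t by rewrite /t !le_max lexx !orbT.
have s1 : s <= ell 0 - wid 0 by rewrite /s !ge_min lexx.
have s2 : s <= - N2 by rewrite /s !ge_min lexx !orbT.
have s3 : s <= - N4 by rewrite /s !ge_min lexx !orbT.
have := zc s t st; have := yc s t st; rewrite th1 // th0 //.
have := H1 t t3; have := H2 s s2; have := H3 t t4; have := H4 s s3.
rewrite !ltr_norml => /andP[x1 x2] /andP[x3 x4] /andP[x5 x6] /andP[x7 x8]; lra.
Qed.

End with_escape.
End over_band.

Theorem heteroclinic_strip p : het p -> exists a b S, [/\ a < 0, 0 < b, S 0 = p,
  hsol (band a b) S & forall q, het q <-> exists u, band a b u /\ S u = q].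
Proof.
move=> hp.
have [a [b [S [[a0 b0 S0] HS [t1 H1] [t2 H2]]]]] := escape_strip F_cder apm Fap Fam hp.
have S0h : het (S 0) by rewrite S0.
exists a, b, S; split => // q; split; first exact: band_onto_escape H1 H2 q.
by move=> [u [hu <-]]; exact: (band_het a0 b0 HS S0h hu).
Qed.

End separation.

(** * The flow in the topology of the plane *)

Section plane_topology.
Context {R : realType}.
Local Notation C := R[i].
Local Open Scope complex_scope.

Lemma plane_nbhsP (z : plane R) (A : set (plane R)) : nbhs z A <->
  exists2 e : R, 0 < e & forall w : plane R, normc (w - z) < e -> A w.
Proof.
split=> [/nbhs_ballP[e /= e0 He]|[e e0 He]].
  (* Radii of balls are elements of [R[i]]; being positive means having imaginary part 0 and
     positive real part. *)
  have [e1 e2] : complex.Im e = 0 /\ 0 < complex.Re e.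
    by move: e0; rewrite ltcE /= => /andP[/eqP ? ?].
  exists (complex.Re e) => // w wz; apply: He; rewrite /ball /= /ball_ /=.
  by rewrite ltcE /= e1 eqxx /= nmBC.
apply/nbhs_ballP; exists e%:C; first by rewrite /= ltcR.
by move=> w; rewrite /ball /= ltcE /= eqxx /= => h; apply: He; rewrite nmBC.
Qed.

Lemma plane_cvgP (T : Type) (G : set_system T) (f : T -> plane R) (l : plane R) : Filter G ->
  (f @ G --> l) <-> forall e : R, 0 < e -> G [set t | normc (f t - l) < e].
Proof.
move=> FG; split=> [H e e0|H A /plane_nbhsP[e e0 He]].
  by apply: (H [set w | normc (w - l) < e]); apply/plane_nbhsP; exists e.
by apply: filterS (H e e0) => t /=; exact: He.
Qed.

Lemma plane_openP (A : set (plane R)) : open A <->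
  forall z, A z -> exists2 e : R, 0 < e & forall w : plane R, normc (w - z) < e -> A w.
Proof.
rewrite openE; split=> H z Az; first by apply/plane_nbhsP; exact: H.
by apply/plane_nbhsP; exact: H.
Qed.

Lemma plane_closureP (A : set (plane R)) z : closure A z <->
  forall e : R, 0 < e -> exists w, A w /\ normc (w - z) < e.
Proof.
split=> [H e e0|H B /plane_nbhsP[e e0 He]].
  have [|w [Aw Bw]] := H [set w | normc (w - z) < e]; last by exists w.
  by apply/plane_nbhsP; exists e.
by have [w [Aw wz]] := H e e0; exists w; split => //; exact: He.
Qed.

Lemma plane_within (T : topologicalType) (U : set T) (f : T -> plane R) :
  (forall x, U x -> forall e : R, 0 < e -> exists2 V, nbhs x V &
     forall y, U y -> V y -> normc (f y - f x) < e) ->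
  {within U, continuous f}.
Proof.
move=> H; apply/subspace_continuousP => x Ux; apply/plane_cvgP => e e0.
have [V nV HV] := H x Ux e e0.
by rewrite /within /=; apply: filterS nV => y Vy Uy; exact: HV.
Qed.

Lemma withinE (T : topologicalType) (U : set T) (f : T -> plane R) x :
  {within U, continuous f} -> U x -> forall e : R, 0 < e ->
  nbhs x [set y | U y -> normc (f y - f x) < e].
Proof.
move=> /subspace_continuousP/(_ x) H Ux e e0.
by have /plane_cvgP/(_ e e0) := H Ux.
Qed.

Lemma real_nbhsP (t : R) (A : set R) : nbhs t A <->
  exists2 e : R, 0 < e & forall s, `|s - t| < e -> A s.
Proof.
split=> [/nbhs_ballP[e /= e0 He]|[e e0 He]].
  by exists e => // s h; apply: He; rewrite /ball /= distrC.
by apply/nbhs_ballP; exists e => // s; rewrite /ball /= distrC; exact: He.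
Qed.

Lemma entire_cder (F : plane R -> plane R) : entire F -> forall z : C, exists d, cder F z d.
Proof.
move=> HF z; have /cvg_ex[d Hd] := HF z; exists d => e e0.
have /plane_cvgP/(_ e e0) := Hd.
move=> /nbhs_ballP[r /= r0 Hr].
have [r1 r2] : complex.Im r = 0 /\ 0 < complex.Re r.
  by move: r0; rewrite ltcE /= => /andP[/eqP ? ?].
exists (complex.Re r) => // h hr.
have [->|h0] := eqVneq h 0; first by rewrite addr0 subrr mulr0 subrr nm00 mulr0.
have := Hr h; rewrite /ball /= sub0r normrN ltcE /= r1 eqxx /= => /(_ hr h0).
rewrite /GRing.scale /= mulr1 (addrC h z) => H.
have nh : 0 < normc h by rewrite nm_gt0.
rewrite (_ : _ - _ = (h^-1 * (F (z + h) - F z) - d) * h); last by field.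
by rewrite normcM ler_pM2r // ltW.
Qed.

End plane_topology.

(** * Maximal solutions, time reversal and limit sets *)

Section flows.
Context {R : realType}.
Local Notation C := R[i].
Local Open Scope complex_scope.
Implicit Types (F : C -> C).

Lemma solutionP F x I g : solution F x I g <->
  [/\ open I, is_interval I, I 0, g 0 = x & forall t, I t -> rder g t (F (g t))].
Proof.
by split=> -[H1 H2 H3 H4 H5]; split => // t It; apply/rderP; exact: H5.
Qed.

Lemma unique_on F (J : set R) (g1 g2 : R -> C) t0 : (forall z, exists d, cder F z d) ->
  is_interval J -> (forall t, J t -> rder g1 t (F (g1 t))) ->
  (forall t, J t -> rder g2 t (F (g2 t))) -> J t0 -> g1 t0 = g2 t0 ->
  forall t, J t -> g1 t = g2 t.
Proof.
move=> Fd Ji H1 H2 J0 E t Jt.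
have Js s : 0 <= s <= 1 -> J (t0 + s * (t - t0)).
  move=> hs; have [h|h] := leP t0 t.
    have ht : t0 <= t <= t by rewrite h lexx.
    have h0 : t0 <= t0 <= t by rewrite h lexx.
    exact: (Ji _ _ J0 Jt) (between_cvx h0 ht hs).
  have ht : t <= t <= t0 by rewrite lexx ltW.
  have h0 : t <= t0 <= t0 by rewrite lexx ltW.
  exact: (Ji _ _ Jt J0) (between_cvx h0 ht hs).
have cur g : (forall t, J t -> rder g t (F (g t))) -> curve F (fun s => g (t0 + s * (t - t0))) (t - t0)%:C.
  by move=> Hg s hs; apply: rder_reparam; apply: Hg; exact: Js.
have := ode_unique Fd (cur _ H1) (cur _ H2); rewrite mul0r addr0 => /(_ E 1).
by rewrite mul1r addrC subrK; apply; rewrite lexx ler01.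
Qed.

Lemma flow_eq F x I g t : (forall z, exists d, cder F z d) -> solution F x I g -> I t ->
  flow F x t = g t.
Proof.
move=> Fd Hg It; rewrite /flow.
have ex : [set y | exists I g, [/\ solution F x I g, I t & g t = y]] (g t) by exists I, g.
have [I' [g' [Hg' It' <-]]] := xgetPex x (ex_intro _ _ ex).
have /solutionP[io1 J1 Z1 E1 D1] := Hg; have /solutionP[io2 J2 Z2 E2 D2] := Hg'.
have JJ : is_interval (I `&` I').
  by move=> u v [u1 u2] [v1 v2] s hs; split; [exact: J1 hs|exact: J2 hs].
apply: (unique_on (J := I `&` I') (t0 := 0) Fd JJ) => //.
- by move=> s [s1 s2]; exact: D2.
- by move=> s [s1 s2]; exact: D1.
- by rewrite E1 E2.
Qed.

Lemma max_interval_interval F x : is_interval (max_interval F x).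
Proof.
move=> u v [I [g [Hg Iu]]] [J [k [Hk Jv]]] s /andP[us sv].
have /solutionP[io1 J1 Z1 E1 D1] := Hg; have /solutionP[io2 J2 Z2 E2 D2] := Hk.
have [s0|s0] := leP s 0.
  by exists I, g; split => //; apply: (J1 _ _ Iu Z1); rewrite us s0.
by exists J, k; split => //; apply: (J2 _ _ Z2 Jv); rewrite sv (ltW s0).
Qed.

Lemma max_interval_open F x t : max_interval F x t ->
  exists2 e : R, 0 < e & forall s, `|s - t| < e -> max_interval F x s.
Proof.
move=> [I [g [Hg It]]]; have [Io _ _ _ _] := Hg.
have /real_nbhsP[e e0 He] : nbhs t I by exact: open_nbhs_nbhs.
by exists e => // s /He Is; exists I, g.
Qed.

Lemma flow_rder F x t : (forall z, exists d, cder F z d) -> max_interval F x t ->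
  rder (flow F x) t (F (flow F x t)).
Proof.
move=> Fd [I [g [Hg It]]]; have [Io _ _ _ _] := Hg.
have /real_nbhsP[e e0 He] : nbhs t I by exact: open_nbhs_nbhs.
have fg s : I s -> flow F x s = g s by exact: flow_eq.
have /solutionP[_ _ _ _ /(_ t It) D] := Hg.
rewrite fg //; apply: (gder_ext e0 _ _ D); last by rewrite fg.
by move=> h; rewrite nm_real => hr; rewrite fg //; apply: He; rewrite addrAC subrr add0r.
Qed.

Lemma flow0 F x : (forall z, exists d, cder F z d) -> max_interval F x 0 -> flow F x 0 = x.
Proof. by move=> Fd [I [g [Hg It]]]; rewrite (flow_eq Fd Hg It); case: Hg. Qed.

Lemma global_solution F x (z : R -> C) : z 0 = x -> (forall t, rder z t (F (z t))) ->
  solution F x setT z.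
Proof. by move=> z0 Hz; apply/solutionP; split => //; exact: openT. Qed.

Lemma global_max F x (z : R -> C) : z 0 = x -> (forall t, rder z t (F (z t))) ->
  max_interval F x = setT.
Proof.
move=> z0 Hz; apply/seteqP; split => // t _; exists setT, z; split => //.
exact: global_solution.
Qed.

Lemma global_flow F x (z : R -> C) : (forall z, exists d, cder F z d) -> z 0 = x ->
  (forall t, rder z t (F (z t))) -> forall t, flow F x t = z t.
Proof. by move=> Fd z0 Hz t; apply: (flow_eq Fd (global_solution z0 Hz)). Qed.

Lemma solution_opp F x I g : solution F x I g ->
  solution (fun z => - F z) x [set t | I (- t)] (fun t => g (- t)).
Proof.
move=> /solutionP[io J Z E D]; apply/solutionP; split.
- rewrite openE => t /= It.
  have /real_nbhsP[e e0 He] : nbhs (- t) I by exact: open_nbhs_nbhs.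
  by apply/real_nbhsP; exists e => // s h; apply: He; rewrite -opprD normrN.
- by move=> u v /= Iu Iv s /andP[h1 h2]; apply: (J _ _ Iv Iu); rewrite !lerN2 h1 h2.
- by rewrite /= oppr0.
- by rewrite oppr0.
- by move=> t /= It; apply: opp_rder; exact: D.
Qed.

Lemma oppK_field F : (fun z => - - F z) = F.
Proof. by apply/funext => z; rewrite opprK. Qed.

Lemma max_interval_opp F x t : max_interval (fun z => - F z) x t <-> max_interval F x (- t).
Proof.
split=> -[I [g [Hg It]]].
  have := solution_opp Hg; rewrite oppK_field => H.
  by exists [set t | I (- t)], (fun t => g (- t)); split; rewrite //= opprK.
have H := solution_opp Hg.
by exists [set t | I (- t)], (fun t => g (- t)).
Qed.

Lemma flow_opp F x t : (forall z, exists d, cder F z d) -> max_interval F x (- t) ->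
  flow (fun z => - F z) x t = flow F x (- t).
Proof.
move=> Fd [I [g [Hg It]]]; rewrite (flow_eq Fd Hg It).
exact: (flow_eq (opp_cder Fd) (solution_opp Hg)).
Qed.

(** As [I] has no largest element, tending to its right endpoint, finite or infinite, means passing
    every element of [I]. *)
Lemma cvg_esup (I : set R) (s : nat -> R) : (forall n, I (s n)) ->
  (forall c, I c -> exists2 c', I c' & c < c') ->
  ((s n)%:E @[n --> \oo] --> ereal_sup (EFin @` I)) <->
  (forall c, I c -> exists N, forall n, (N <= n)%N -> c < s n).
Proof.
move=> Is Imax; split.
  move=> H c Ic; have [c' Ic' cc'] := Imax c Ic.
  have cs : (c%:E < ereal_sup (EFin @` I))%E.
    by apply: (@lt_le_trans _ _ c'%:E); rewrite ?lte_fin //; apply: ereal_sup_ubound; exists c'.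
  have := H [set y | (c%:E < y)%E].
  have nb : nbhs (ereal_sup (EFin @` I)) [set y | (c%:E < y)%E].
    by apply: open_nbhs_nbhs; split => //; exact: open_ereal_gt_ereal.
  move=> /(_ nb)[N _ HN]; exists N => n /HN /=.
  by rewrite lte_fin.
move=> H; have ub : ((s 0%N)%:E <= ereal_sup (EFin @` I))%E.
  by apply: ereal_sup_ubound; exists (s 0%N).
case E : (ereal_sup (EFin @` I)) ub => [r| |] // _.
  move=> A nA; have : nbhs r [set x : R | A x%:E] by exact: nA.
  move=> /real_nbhsP[e e0 He].
  have /ereal_sup_gt[_ [c Ic <-]] : (((r - e)%:E : \bar R) < ereal_sup (EFin @` I))%E.
    by rewrite E lte_fin; lra.
  rewrite lte_fin => rc; have [N HN] := H c Ic.
  exists N => // n Nn; apply: He.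
  have sr : s n <= r.
    by rewrite -lee_fin -E; apply: ereal_sup_ubound; exists (s n).
  by have := HN n Nn; rewrite ltr_norml => cs; apply/andP; split; lra.
apply/cvgeyPgt => B.
have /ereal_sup_gt[_ [c Ic <-]] : ((B%:E : \bar R) < ereal_sup (EFin @` I))%E by rewrite E ltry.
rewrite lte_fin => Bc; have [N HN] := H c Ic.
exists N => // n Nn; rewrite /= lte_fin; exact: lt_trans (HN n Nn).
Qed.

(** Time reversal turns the left endpoint into the right one, so that only positive limit sets need
    to be analysed. *)
Lemma neg_limit_setE F x : (forall z, exists d, cder F z d) ->
  neg_limit_set F x = pos_limit_set (fun z => - F z) x.
Proof.
move=> Fd.
have IE : ereal_inf (EFin @` max_interval F x) = (- ereal_sup (EFin @` max_interval (fun z => (- F z)%R) x))%E.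
  rewrite /ereal_inf; congr (- ereal_sup _)%E; apply/seteqP; split=> y.
    move=> [_ [t Ht <-] <-]; exists (- t) => //.
    by apply/max_interval_opp; rewrite opprK.
  move=> [t /max_interval_opp Ht <-]; exists (- t)%:E; last by rewrite -EFinN opprK.
  by exists (- t).
apply/seteqP; split=> y [s [Hs Hl Hf]]; exists (fun n => - s n); split.
- by move=> n; apply/max_interval_opp; rewrite opprK.
- rewrite IE in Hl; have := cvgeN Hl; rewrite oppeK; exact.
- by under eq_fun do rewrite flow_opp ?opprK //.
- by move=> n; apply/max_interval_opp.
- by rewrite IE; exact: (cvgeN Hl).
- have E n : flow (fun z => - F z) x (s n) = flow F x (- s n).
    by apply: flow_opp => //; apply/max_interval_opp.
  by under eq_fun do rewrite -E.
Qed.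

Lemma max_interval0 F x t : max_interval F x t -> max_interval F x 0.
Proof. by move=> [I [g [Hg _]]]; exists I, g; split => //; case: Hg. Qed.

Lemma max_interval_next F x c : max_interval F x c ->
  exists2 c', max_interval F x c' & c < c'.
Proof.
move=> /max_interval_open[e e0 He]; exists (c + e / 2); last lra.
by apply: He; rewrite addrAC subrr add0r gtr0_norm; lra.
Qed.

(** [s n] is chosen within [1 / (n + 1)] of the supremum of the elements up to [n], which treats
    bounded and unbounded [I] alike. *)
Lemma cofinal_sequence (I : set R) c0 : I c0 -> (forall c, I c -> exists2 c', I c' & c < c') ->
  exists2 s : nat -> R, (forall n, I (s n)) &
    forall c, I c -> exists N, forall n, (N <= n)%N -> c < s n.
Proof.
move=> I0 Imax.
have [|s Hs] := @boolp.choice nat R (fun n u => I u /\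
    forall c, I c -> c <= n%:R -> c < u + (n.+1%:R)^-1).
  move=> n; have [[c1 [Ic1 c1n]]|none] := pselect (exists c, I c /\ c <= n%:R); last first.
    by exists c0; split => // c Ic cn; exfalso; apply: none; exists c.
  pose A := [set c | I c /\ c <= n%:R].
  have hA : has_sup A by split; [exists c1|exists n%:R => c []].
  have n0 : 0 < (n.+1%:R)^-1 :> R by rewrite invr_gt0 ltr0n.
  have [u [Iu un] su] := sup_adherent n0 hA.
  exists u; split => // c Ic cn.
  have : c <= sup A by apply: sup_upper_bound.
  by move: (sup A) (_^-1) su => M k su h; lra.
exists s => [n|c Ic]; first by have [] := Hs n.
have [c' Ic' cc'] := Imax c Ic.
have [N1 hN1] : exists N : nat, c' <= N%:R.
  by exists (Num.bound `|c'|); apply: le_trans (ler_norm _) (ltW (archi_boundP _)).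
have d0 : 0 < c' - c by rewrite subr_gt0.
have [N2 hN2] : exists N : nat, (c' - c)^-1 <= N%:R.
  by exists (Num.bound (c' - c)^-1); apply/ltW/archi_boundP; rewrite invr_ge0 ltW.
exists (maxn N1 N2) => n; rewrite geq_max => /andP[n1 n2].
have [_ /(_ c' Ic')] := Hs n.
have h1 : c' <= n%:R by apply: le_trans hN1 _; rewrite ler_nat.
have h2 : (n.+1%:R)^-1 <= c' - c.
  rewrite -[c' - c]invrK lef_pV2 ?posrE ?invr_gt0 ?ltr0n //.
  by apply: le_trans hN2 _; rewrite ler_nat leqW.
by move=> /(_ h1); move: (n.+1%:R^-1) h2 => k h2 h; lra.
Qed.

Lemma pos_limit_setP F x y : max_interval F x 0 -> pos_limit_set F x y <->
  forall e : R, 0 < e -> forall c, max_interval F x c ->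
    exists t, [/\ max_interval F x t, c < t & normc (flow F x t - y) < e].
Proof.
move=> M0; have Mn := @max_interval_next F x.
split=> [[s [Ms sl /plane_cvgP fl]] e e0 c Mc|H].
  have [N1 HN1] := (cvg_esup Ms Mn).1 sl c Mc.
  have [N2 _ HN2] := fl e e0.
  exists (s (maxn N1 N2)); split => //; first by apply: HN1; rewrite leq_maxl.
  by apply: HN2; rewrite /= leq_maxr.
have [c Mc cc] := cofinal_sequence M0 Mn.
have [|s Hs] := @boolp.choice nat R (fun n t => [/\ max_interval F x t, c n < t &
   normc (flow F x t - y) < (n.+1%:R)^-1]).
  by move=> n; apply: H => //; rewrite invr_gt0 ltr0n.
exists s; split.
- by move=> n; have [] := Hs n.
- apply/cvg_esup => // [n|d Md]; first by have [] := Hs n.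
  have [N HN] := cc d Md; exists N => n Nn; have [_ + _] := Hs n.
  exact: lt_trans (HN n Nn).
- apply/plane_cvgP => e e0.
  have [N hN] : exists N : nat, e^-1 <= N%:R.
    by exists (Num.bound e^-1); apply/ltW/archi_boundP; rewrite invr_ge0 ltW.
  exists N => // n /= Nn; have [_ _ h] := Hs n; apply: lt_le_trans h _.
  rewrite -[e]invrK lef_pV2 ?posrE ?invr_gt0 ?ltr0n //.
  by apply: le_trans hN _; rewrite ler_nat leqW.
Qed.

(** A limit set consisting of [a] alone does not by itself exclude excursions. But a solution that
    keeps returning near [a] and leaving the disc of radius [e] crosses the boundary circle at
    arbitrarily late times, and by compactness the crossings have a limit point other than [a]. *)
Lemma pos_limit_tail F x a : (forall z, exists d, cder F z d) -> pos_limit_set F x = [set a] ->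
  forall e : R, 0 < e -> exists2 c, max_interval F x c &
    forall t, max_interval F x t -> c < t -> normc (flow F x t - a) < e.
Proof.
move=> Fd La e e0.
have [s0 [Ms0 _ _]] : pos_limit_set F x a by rewrite La.
have M0 := max_interval0 (Ms0 0%N).
have Mn := @max_interval_next F x.
have Mmax c d : max_interval F x c -> max_interval F x d ->
    exists k, [/\ max_interval F x k, c <= k & d <= k].
  move=> Mc Md; have [cd|dc] := leP c d; first by exists d.
  by exists c; split => //; exact: ltW.
apply: contrapT => none.
have far c : max_interval F x c -> exists t, [/\ max_interval F x t, c < t & e <= normc (flow F x t - a)].
  move=> Mc; apply: contrapT => no; apply: none; exists c => // t Mt ct.
  by rewrite ltNge; apply/negP => h; apply: no; exists t.
have cross c : max_interval F x c -> exists t, [/\ max_interval F x t, c < t & normc (flow F x t - a) = e].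
  move=> Mc; have [|s [Ms cs hs]] := (pos_limit_setP a M0).1 _ e e0 c Mc; first by rewrite La.
  have [t [Mt st ht]] := far s Ms.
  have Mu u : s <= u <= t -> max_interval F x u by exact: max_interval_interval.
  have [||u us hu] := @IVT R (fun u => normc (flow F x u - a)) s t e (ltW st).
  - apply: continuous_in_subspaceT => u; rewrite inE /= in_itv /= => /Mu/(flow_rder Fd) D.
    apply/econtP => e1 /(rder_cont D)[r r0 Hr]; exists r => // h hr.
    apply: le_lt_trans (Hr (u + h) _); last by rewrite addrAC subrr add0r.
    have := nm_tri (flow F x u) (flow F x (u + h)) a.
    have := nm_tri (flow F x (u + h)) (flow F x u) a.
    rewrite (nmBC (flow F x u) (flow F x (u + h))) => h1 h2.
    by rewrite ler_norml; apply/andP; split; lra.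
  - by rewrite ge_min le_max (ltW hs) ht orbT.
  move: us; rewrite in_itv /= => us.
  by exists u; split => //; [exact: Mu|case/andP: us => + _; exact: lt_le_trans].
have [|||c Mc Hc] := @bounded_ind R a e (fun A => exists2 c, max_interval F x c &
   forall t, max_interval F x t -> c < t -> normc (flow F x t - a) = e -> ~ A (flow F x t)).
- by move=> A B AB [c Mc Hc]; exists c => // t Mt ct te /AB; exact: Hc.
- move=> A B [c Mc Hc] [d Md Hd]; have [k [Mk ck dk]] := Mmax c d Mc Md.
  exists k => // t Mt kt te [|]; first by apply: Hc => //; exact: le_lt_trans kt.
  by apply: Hd => //; exact: le_lt_trans kt.
- move=> z; have [->|/eqP za] := eqVneq z a.
    by exists e => //; exists 0 => // t _ _ te /=; rewrite te ltxx.
  apply: contrapT => no; apply: za.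
  suff : pos_limit_set F x z by rewrite La.
  apply/(pos_limit_setP z M0) => e1 e10 c Mc; apply: contrapT => no2; apply: no.
  by exists e1 => //; exists c => // t Mt ct _ h; apply: no2; exists t.
have [t [Mt ct te]] := cross c Mc.
by apply: (Hc t Mt ct te); rewrite /= te.
Qed.

(* A solution converging to an equilibrium cannot do so in finite time: read
   backwards, it would have left the equilibrium in finite time. *)
Lemma pos_limit_global F x a t : (forall z, exists d, cder F z d) -> F a = 0 ->
  pos_limit_set F x = [set a] -> 0 <= t -> max_interval F x t.
Proof.
move=> Fd Fa La t0; apply: contrapT => nt.
have [s0 [Ms0 _ _]] : pos_limit_set F x a by rewrite La.
have M0 := max_interval0 (Ms0 0%N).
have Mt s : max_interval F x s -> s < t.
  move=> Ms; rewrite ltNge; apply/negP => ts; apply: nt.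
  by apply: (max_interval_interval M0 Ms); rewrite t0.
have [L [r [L0 r0 HL]]] := lip_zeroP Fd Fa.
pose T := sup (max_interval F x).
have hs : has_sup (max_interval F x) by split; [exists 0|exists t => s /Mt/ltW].
have d0 : 0 < (2 * L)^-1 by rewrite invr_gt0 mulr_gt0.
have [u Mu uT] := sup_adherent d0 hs.
(* [u] is less than [(2 * L)^-1] before the endpoint, so from any later time [k] the way back to [u]
   at most doubles the distance to [a], which is arbitrarily small at [k]. *)
have Fu : flow F x u = a.
  apply: nm_small_eq => e e0.
  have m0 : 0 < Num.min (e / 2) (r / 2) by rewrite lt_min !divr_gt0.
  have [c Mc Hc] := pos_limit_tail Fd La m0.
  have [k [Mk ck uk]] : exists k, [/\ max_interval F x k, c < k & u < k].
    have [cu|uc] := leP c u; first by have [k Mk uk] := max_interval_next Mu; exists k; split => //; exact: le_lt_trans uk.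
    by have [k Mk ck] := max_interval_next Mc; exists k; split => //; exact: lt_trans ck.
  have kT : k <= sup (max_interval F x) by exact: sup_upper_bound.
  have := Hc k Mk ck; rewrite lt_min => /andP[h1 h2].
  have := @short_time R F a L r (fun s => flow F x (k + s * (u - k))) (u - k)%:C L0 HL.
  rewrite mul0r addr0 => S0.
  have S C1 C2 C3 := S0 C1 C2 C3 1; rewrite mul1r subrKC in S.
  apply: (le_lt_trans (S _ _ _ _)); last by lra.
  - move=> s hs'; apply: rder_reparam; apply: (flow_rder Fd).
    have uku : u <= u <= k by rewrite lexx ltW.
    have ukk : u <= k <= k by rewrite lexx ltW.
    exact: (max_interval_interval Mu Mk) (between_cvx ukk uku hs').
  - rewrite nm_real ler0_norm; last lra.
    have : L * - (u - k) <= L * (2 * L)^-1 by rewrite ler_wpM2l //; lra.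
    by rewrite invfM mulrCA divff ?gt_eqF // mulr1.
  - by lra.
  - by rewrite ler01 lexx.
have cst s : max_interval F x s -> flow F x s = a.
  move=> Ms; apply: (unique_on (J := max_interval F x) (t0 := u) (g2 := fun=> a) Fd) => //.
  - exact: max_interval_interval.
  - by move=> k; exact: flow_rder.
  - by move=> k _; rewrite Fa; exact: gder_cst.
apply: nt; rewrite (@global_max F x (fun=> a)) //; first by rewrite -(cst 0) // flow0.
by move=> k; rewrite Fa; exact: gder_cst.
Qed.

Lemma limit_set_het F x ap am : (forall z, exists d, cder F z d) -> F ap = 0 -> F am = 0 ->
  pos_limit_set F x = [set ap] -> neg_limit_set F x = [set am] -> heteroclinic F ap am x.
Proof.
move=> Fd Fp Fm Lp; rewrite neg_limit_setE // => Lm.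
have Fdo := opp_cder Fd.
have Fmo : - F am = 0 by rewrite Fm oppr0.
have M t : max_interval F x t.
  have [t0|t0] := leP 0 t; first exact: pos_limit_global Lp t0.
  rewrite -[t]opprK; apply/max_interval_opp.
  by apply: (pos_limit_global Fdo Fmo Lm); lra.
exists (flow F x); split.
- exact: flow0.
- by move=> t; exact: flow_rder.
- move=> e e0; have [c Mc Hc] := pos_limit_tail Fd Lp e0.
  by exists (c + 1) => t ct; apply: Hc => //; lra.
- move=> e e0; have [c Mc Hc] := pos_limit_tail Fdo Lm e0.
  exists (c + 1) => t ct; have := Hc (- t).
  by rewrite flow_opp // opprK; apply; [apply/max_interval_opp; rewrite opprK|lra].
Qed.

Lemma het_pos_limit F ap am x : (forall z, exists d, cder F z d) ->
  heteroclinic F ap am x -> pos_limit_set F x = [set ap].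
Proof.
move=> Fd [z [z0 Hz Lp Lm]].
have M : max_interval F x = setT by exact: global_max Hz.
have M0 : max_interval F x 0 by rewrite M.
apply/seteqP; split=> y; last first.
  move=> ->; apply/(pos_limit_setP _ M0) => e /Lp[N HN] c _.
  exists (Num.max N (c + 1)); rewrite M; split => //; first by rewrite lt_max; apply/orP; right; lra.
  by rewrite (global_flow Fd z0 Hz); apply: HN; rewrite le_max lexx.
move=> /(pos_limit_setP _ M0) H; apply: (@nm_small_eq R y ap) => e e0.
have e2 : 0 < e / 2 by rewrite divr_gt0.
have [N HN] := Lp _ e2; have [|t [_ Nt]] := H _ e2 N; first by rewrite M.
rewrite (global_flow Fd z0 Hz) => h1; have h2 := HN t (ltW Nt).
apply: le_lt_trans (nm_tri (z t) y ap) _; rewrite [e]splitr.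
by apply: ltrD => //; rewrite nmBC.
Qed.

Lemma het_neg_limit F ap am x : (forall z, exists d, cder F z d) ->
  heteroclinic F ap am x -> neg_limit_set F x = [set am].
Proof.
move=> Fd Hx; rewrite neg_limit_setE //; apply: (het_pos_limit (opp_cder Fd)).
exact: opp_het Hx.
Qed.

End flows.

(** * The heteroclinic region *)

Section convex_images.
Context {R : realType}.
Local Notation C := R[i].
Local Open Scope complex_scope.

Lemma path_connected_connected (A : set (plane R)) : path_connected A -> connected A.
Proof.
move=> H; have [->|/set0P[x Ax]] := eqVneq A set0; first exact: connected0.
rewrite (_ : A = \bigcup_(g in [set g : R -> plane R | exists y, path_in A g x y]) (g @` `[0, 1])).
  apply: bigcup_connected.
    exists x => g [y [_ _ g0 _]]; exists 0 => //.
    by rewrite /= in_itv /= lexx ler01.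
  move=> g [y [gc _ _ _]]; apply: connected_continuous_connected gc.
  exact: segment_connected.
apply/seteqP; split=> [y Ay|y [g [w [_ gA _ _]] gy]]; last exact: gA.
have [g Hg] := H x y Ax Ay; exists g; first by exists y.
have [_ _ _ g1] := Hg; exists 1 => //.
by rewrite /= in_itv /= lexx ler01.
Qed.

Lemma cvx_image_path (U : set C) (S : C -> C) u v : cvx U -> (forall w, U w -> ccont S w) ->
  U u -> U v -> path_in (S @` U : set (plane R)) (fun t => S (u + t%:C * (v - u))) (S u) (S v).
Proof.
move=> Uc Sc Uu Uv.
have Ut t : `[0, 1]%classic t -> U (u + t%:C * (v - u)).
  by rewrite /= in_itv /= => ht; exact: Uc.
split; last 2 first.
- by rewrite mul0r addr0.
- by rewrite mul1r addrC subrK.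
- apply: plane_within => t It e e0; have [r r0 Hr] := Sc _ (Ut t It) e e0.
  have n1 : 0 < normc (v - u) + 1 by have := nm_ge0 (v - u); lra.
  exists [set s | `|s - t| < r / (normc (v - u) + 1)].
    by apply/real_nbhsP; exists (r / (normc (v - u) + 1)) => //; rewrite divr_gt0.
  move=> s _ /=; rewrite ltr_pdivlMr // => hs.
  have := Hr ((s - t)%:C * (v - u)).
  rewrite (_ : u + t%:C * (v - u) + _ = u + s%:C * (v - u)); last by rewrite rmorphB /=; ring.
  apply; apply: le_lt_trans hs; rewrite normcM nm_real ler_wpM2l //; lra.
- by move=> _ [t It <-]; exists (u + t%:C * (v - u)) => //; exact: Ut.
Qed.

Lemma cvx_image_path_connected (U : set C) (S : C -> C) : cvx U ->
  (forall w, U w -> ccont S w) -> path_connected (S @` U : set (plane R)).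
Proof.
move=> Uc Sc _ _ [u Uu <-] [v Uv <-]; exists (fun t => S (u + t%:C * (v - u))).
exact: cvx_image_path.
Qed.

(** The loop is pulled back to [U] by [J], contracted linearly to its base point, which convexity
    allows, and pushed forward again by [S]. *)
Lemma cvx_image_simply_connected (U : set C) (S J : C -> C) : cvx U ->
  (forall w, U w -> ccont S w) -> (forall u, U u -> J (S u) = u) ->
  (forall u, U u -> forall e : R, 0 < e -> exists2 d : R, 0 < d &
     forall z, (S @` U) z -> normc (z - S u) < d -> normc (J z - u) < e) ->
  simply_connected (S @` U : set (plane R)).
Proof.
move=> Uc Sc JS Jc; split; first exact: cvx_image_path_connected.
move=> x g [gc gU g0 g1].
have I0 : `[0, 1]%classic (0 : R) by rewrite /= in_itv /= lexx ler01.
have gS t : `[0, 1]%classic t -> U (J (g t)) /\ S (J (g t)) = g t.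
  by move=> It; have [|u Uu <-] := gU (g t); [exists t|rewrite JS].
pose w0 := J (g 0).
have Uw0 : U w0 by have [] := gS 0 I0.
pose m (p : R * R) := J (g p.2) + p.1%:C * (w0 - J (g p.2)).
have Um s t : 0 <= s <= 1 -> `[0, 1]%classic t -> U (m (s, t)).
  by move=> hs /gS[Ug _]; exact: Uc.
have inI (t : R) : 0 <= t <= 1 -> `[0, 1]%classic t by rewrite /= in_itv.
exists (fun p => S (m p)); split.
- apply: plane_within => -[s t] [/=]; rewrite in_itv /= => hs It e e0.
  have [r r0 Hr] := Sc _ (Um s t hs It) e e0.
  have [Ut St] := gS t It.
  have r2 : 0 < r / 2 by rewrite divr_gt0.
  have [d d0 Hd] := Jc _ Ut _ r2.
  have n1 : 0 < normc (w0 - J (g t)) + 1 by have := nm_ge0 (w0 - J (g t)); lra.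
  set k := r / 2 / (normc (w0 - J (g t)) + 1).
  have k0 : 0 < k by rewrite divr_gt0.
  exists ([set s' | `|s' - s| < k] `*` [set t' | `[0, 1]%classic t' -> normc (g t' - g t) < d]).
    exists ([set s' | `|s' - s| < k], [set t' | `[0, 1]%classic t' -> normc (g t' - g t) < d]) => //=.
    split; first by apply/real_nbhsP; exists k.
    exact: (withinE gc It d0).
  move=> [s' t'] /= [+ It'] [ss' /(_ It') tt']; rewrite in_itv /= => hs'.
  have hJ : normc (J (g t') - J (g t)) < r / 2.
    by apply: Hd; [exact: gU (ex_intro2 _ _ t' It' erefl)|rewrite St].
  have := Hr (m (s', t') - m (s, t)); rewrite (addrC (m (s, t))) subrK; apply.
  rewrite (_ : m (s', t') - m (s, t) = (1 - s')%:C * (J (g t') - J (g t)) + (s' - s)%:C * (w0 - J (g t))); last first.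
    by rewrite /m /= !rmorphB /= rmorph1; ring.
  apply: le_lt_trans (nmD _ _) _; rewrite [r]splitr; apply: ler_ltD.
    apply: le_trans (ltW hJ); rewrite normcM nm_real ler_piMl ?nm_ge0 // ler_norml.
    by apply/andP; split; lra.
  move: ss'; rewrite /k ltr_pdivlMr // => ss'; apply: le_lt_trans ss'.
  rewrite normcM nm_real ler_wpM2l //; lra.
- move=> _ [[s t] [/= hs It] <-]; rewrite in_itv /= in hs.
  by exists (m (s, t)) => //; exact: Um.
- by move=> t /inI It; rewrite /m /= mul0r addr0; have [] := gS t It.
- move=> t /inI It; rewrite /m /= mul1r addrC subrK.
  by have [] := gS 0 I0.
- move=> s hs; have E01 : g 1 = g 0 by rewrite g0 g1.
  by rewrite /m /= E01 -/w0 subrr mulr0 addr0; have [] := gS 0 I0.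
Qed.

End convex_images.

(** * The image of a band: orbits, closure, parallel structure *)

Section band_image.
Context {R : realType}.
Local Notation C := R[i].
Local Open Scope complex_scope.
Variables (F : C -> C) (ap am : C).
Local Notation orbit := (@Defs.orbit R).
Hypothesis F_cder : forall z, exists d, cder F z d.
Hypothesis apm : ap <> am.
Hypothesis Fap : F ap = 0.
Hypothesis Fam : F am = 0.
Variables (a b : R) (S : C -> C).
Hypothesis a0 : a < 0.
Hypothesis b0 : 0 < b.
Hypothesis S_hsol : hsol F (band a b) S.
Hypothesis S_het : heteroclinic F ap am (S 0).

Let inj u v : band a b u -> band a b v -> S u = S v -> u = v.
Proof. exact: (band_inj F_cder apm Fap Fam a0 b0 S_hsol S_het). Qed.

Lemma band_shift (c d : R) (u : C) (t : R) : band c d u -> band c d (u + t%:C).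
Proof. by rewrite /band /strip /= ImD /= addr0. Qed.

Lemma sub_band (c d : R) (u : C) : a <= c -> d <= b -> band c d u -> band a b u.
Proof.
rewrite /band /strip /= => ac db /andP[h1 h2].
by rewrite (le_lt_trans ac h1) (lt_le_trans h2 db).
Qed.

Lemma band_cvx (c d : R) : cvx (band c d).
Proof. by apply: cvx_strip; exact: ivl_oo. Qed.

Lemma band_ccont u : band a b u -> ccont S u.
Proof. by move=> hu; exact: cder_ccont (S_hsol hu). Qed.

Lemma band_line u t : band a b u -> rder (fun s => S (u + s%:C)) t (F (S (u + t%:C))).
Proof. exact: strip_line. Qed.

Lemma band_max u : band a b u -> max_interval F (S u) = setT.
Proof.
move=> hu; apply: (global_max (z := fun s => S (u + s%:C))); first by rewrite addr0.
by move=> t; exact: band_line.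
Qed.

Lemma band_flow u t : band a b u -> flow F (S u) t = S (u + t%:C).
Proof.
move=> hu; apply: (global_flow (z := fun s => S (u + s%:C)) F_cder); first by rewrite addr0.
by move=> s; exact: band_line.
Qed.

Lemma band_orbit u z : band a b u -> orbit F (S u) z <->
  exists2 v, complex.Im v = complex.Im u & S v = z.
Proof.
move=> hu; split=> [[t _ <-]|[v vu <-]].
  by exists (u + t%:C); rewrite ?band_flow // ImD /= addr0.
exists (complex.Re v - complex.Re u); first by rewrite band_max.
rewrite band_flow //; congr S; apply: complex_eqP; rewrite !ReImE /=; last by rewrite vu addr0.
by ring.
Qed.

(** Uniqueness is applied on the maximal interval of [x], which is not known beforehand to be all of
    [R]. A separatrix meeting the region is thereby shown to start in it. *)
Lemma band_backward x t u : max_interval F x t -> band a b u -> flow F x t = S u ->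
  exists2 v, complex.Im v = complex.Im u & S v = x.
Proof.
move=> Mt hu E; have M0 := max_interval0 Mt.
exists (u + (0 - t)%:C); first by rewrite ImD /= addr0.
have hv : band a b (u - t%:C) by rewrite -rmorphN; exact: band_shift.
rewrite sub0r rmorphN -{1}[u - _]addr0.
have := unique_on (g1 := flow F x) (g2 := fun s => S (u - t%:C + s%:C)) F_cder
  (@max_interval_interval R F x) _ _ Mt _ M0.
rewrite flow0 // => <- //.
- by move=> s; exact: flow_rder.
- by move=> s _; exact: band_line.
- by rewrite subrK.
Qed.

Definition band_coord (z : C) : C := xget 0 [set u | band a b u /\ S u = z].

Lemma band_coordK u : band a b u -> band_coord (S u) = u.
Proof.
move=> hu; rewrite /band_coord.
have [h E] := xgetPex 0 (ex_intro [set v | band a b v /\ S v = S u] u (conj hu erefl)).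
exact: inj E.
Qed.

Lemma band_coord_cont u : band a b u -> forall e : R, 0 < e -> exists2 d : R, 0 < d &
  forall z, normc (z - S u) < d -> normc (band_coord z - u) < e.
Proof.
move=> hu e e0; have [d d0 Hd] := band_inv_cont F_cder apm Fap Fam a0 b0 S_hsol S_het hu e0.
by exists d => // z /Hd[v [hv vu <-]]; rewrite band_coordK.
Qed.

Lemma band_image_open c d : a <= c -> d <= b -> open (S @` band c d : set (plane R)).
Proof.
move=> ac db; apply/plane_openP => _ [u hu <-].
have [e e0 He] := open_oo hu.
have [r r0 Hr] := band_inv_cont F_cder apm Fap Fam a0 b0 S_hsol S_het (sub_band ac db hu) e0.
exists r => // z /Hr[v [hv vu <-]]; exists v => //.
by apply: He; rewrite -ImN -ImD; apply: le_lt_trans vu; exact: nm_Im.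
Qed.

Lemma translation_rder (y : C) t : rder (fun s => y + s%:C) t ((fun=> 1 : C) (y + t%:C)).
Proof.
have := rder_affine y 1 t.
by rewrite (_ : (fun s => y + s%:C * 1) = (fun s => y + s%:C)) //; apply/funext => s; rewrite mulr1.
Qed.

Lemma cst_cder (c : C) : forall z, exists d, cder (fun=> c) z d.
Proof. by move=> z; exists 0; exact: gder_cst. Qed.

(** [S] conjugates translation to the flow, so the heights from [c] to [d] have only to be rescaled
    to those from 0 to 1, and time by the same factor. Proper substrips are included because they
    serve as the neighbourhoods of ordinary orbits. *)
Lemma band_parallel c d : a <= c -> c < d -> d <= b -> parallel_strip F (S @` band c d).
Proof.
move=> ac cd db; have sub := fun u => @sub_band c d u ac db.
have k0 : 0 < d - c by rewrite subr_gt0.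
have kn : (d - c)%:C != 0 by rewrite -nm_gt0 nm_real gtr0_norm.
split; first exact: band_image_open.
  move=> _ [u hu <-] _ /(band_orbit _ (sub _ hu))[v vu <-].
  by exists v => //; rewrite /band /strip /= vu.
pose h z := (d - c)^-1%:C * (band_coord z - c *i); pose k y := S (c *i + (d - c)%:C * y).
have hS u : band a b u -> h (S u) = (d - c)^-1%:C * (u - c *i) by move=> hu; rewrite /h band_coordK.
exists h, k; split.
- apply: plane_within => _ [u hu <-] e e0.
  have e1 : 0 < e * (d - c) by rewrite mulr_gt0.
  have [r r0 Hr] := band_coord_cont (sub _ hu) e1.
  exists [set z | normc (z - S u) < r]; first by apply/plane_nbhsP; exists r.
  move=> z _ /= /Hr hz; rewrite hS; last exact: sub.
  rewrite /h -mulrBr opprB addrA subrK normcM nm_real ger0_norm ?invr_ge0 ?ltW //.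
  by rewrite mulrC ltr_pdivrMr.
- apply: plane_within => y /= hy e e0.
  have hw : band a b (c *i + (d - c)%:C * y).
    apply: sub; rewrite /band /strip /= !ReImE /= mul0r addr0 ltrDl pmulr_rgt0 //.
    by case/andP: hy => h1 h2; rewrite h1 /=; nra.
  have [r r0 Hr] := band_ccont hw e0.
  exists [set z | normc (z - y) < r / (d - c)].
    by apply/plane_nbhsP; exists (r / (d - c)) => //; rewrite divr_gt0.
  move=> z _ /=; rewrite ltr_pdivlMr // => hz; have := Hr ((d - c)%:C * (z - y)).
  rewrite (_ : c *i + (d - c)%:C * y + _ = c *i + (d - c)%:C * z); last by ring.
  by apply; rewrite normcM nm_real gtr0_norm // mulrC.
- move=> _ [u hu <-]; rewrite hS; last exact: sub.
  split.
    move: hu; rewrite /band /strip /= !ReImE /= mul0r addr0 => /andP[h1 h2].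
    by rewrite mulrC divr_gt0 ?subr_gt0 //= ltr_pdivrMr // mul1r ltrD2r.
  rewrite /k fmorphV /= mulrA divff // mul1r addrC subrK //.
- move=> y /= hy.
  have hw : band c d (c *i + (d - c)%:C * y).
    rewrite /band /strip /= !ReImE /= mul0r addr0 ltrDl pmulr_rgt0 //.
    by case/andP: hy => h1 h2; rewrite h1 /=; nra.
  split; first by exists (c *i + (d - c)%:C * y).
  rewrite /k hS; last exact: sub.
  by rewrite addrAC subrr add0r fmorphV /= mulrA mulVf // mul1r.
- move=> _ [u hu <-]; have hu' := sub _ hu; exists (fun t => t / (d - c)).
  rewrite band_max // (@global_max R (fun=> 1) _ (fun s => h (S u) + s%:C)); last 2 first.
  + by rewrite addr0.
  + by move=> t; exact: translation_rder.
  split.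
  + by move=> s t _ _ st; rewrite ltr_pM2r // invr_gt0.
  + by apply/seteqP; split => // t _; exists (t * (d - c)) => //; rewrite mulfK // gt_eqF.
  + move=> t _; rewrite (@global_flow R (fun=> 1) _ (fun s => h (S u) + s%:C)); first last.
    * by move=> s; exact: translation_rder.
    * by rewrite addr0.
    * exact: cst_cder.
    rewrite band_flow // !hS //; last exact: band_shift.
    by rewrite rmorphM /= fmorphV; ring.
Qed.

Let ends (e : R) : 0 < e -> exists N : R, forall t y, a < y < b ->
  (N <= t -> normc (S (t +i* y) - ap) < e) /\ (t <= - N -> normc (S (t +i* y) - am) < e).
Proof.
move=> e0; have hb : [set y : R | a < y < b] 0 by rewrite /= a0 b0.
have [N HN] := strip_ends F_cder apm Fap Fam (@ivl_oo R a b) hb S_hsol S_het (`|a| + `|b|) e0.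
exists N => t y hy; apply: HN => //; case/andP: hy => h1 h2.
have := ler_norm b; have := ler_norm (- a); rewrite normrN.
by have := normr_ge0 b; have := normr_ge0 a; rewrite ler_norml => *; apply/andP; split; lra.
Qed.

(** Convergence to [ap] and [am] is uniform over the band, so values close to any other point come
    from a compact rectangle, on which [S] is continuous up to the heights [y1] and [y2]. *)
Lemma band_closure y1 y2 z : a < y1 -> y1 < y2 -> y2 < b ->
  closure (S @` band y1 y2 : set (plane R)) z <->
  [\/ z = ap, z = am | exists2 u, y1 <= complex.Im u <= y2 & S u = z].
Proof.
move=> ay1 y12 y2b.
have sub y : y1 <= y <= y2 -> a < y < b by move=> /andP[h1 h2]; apply/andP; split; lra.
have open_sub y : y1 < y < y2 -> a < y < b by move=> /andP[h1 h2]; apply/andP; split; lra.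
split=> [/plane_closureP H|H].
  apply: contrapT => no.
  have zp : 0 < normc (z - ap).
    by rewrite nm_gt0 subr_eq0; apply/eqP => E; apply: no; constructor 1.
  have zm : 0 < normc (z - am).
    by rewrite nm_gt0 subr_eq0; apply/eqP => E; apply: no; constructor 2.
  pose e := Num.min (normc (z - ap)) (normc (z - am)) / 2.
  have e0 : 0 < e by rewrite divr_gt0 // lt_min zp.
  have ep : e <= normc (z - ap) / 2 by rewrite ler_pM2r ?invr_gt0 // ge_min lexx.
  have em : e <= normc (z - am) / 2 by rewrite ler_pM2r ?invr_gt0 // ge_min lexx orbT.
  clearbody e; have [N HN] := ends e0; pose M := `|N| + 1.
  have M1 : - M < M by rewrite /M; have := normr_ge0 N; lra.
  have NM : N <= M by rewrite /M; have := ler_norm N; lra.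
  clearbody M.
  have [|||d d0 Hd] := @rect_cover R (- M) M y1 y2
    (fun A => exists2 d : R, 0 < d & forall u, A u -> y1 <= complex.Im u <= y2 -> d <= normc (S u - z)) M1 y12.
  - by move=> A B AB [d d0 Hd]; exists d => // u /AB; exact: Hd.
  - move=> A B [d d0 Hd] [d' d'0 Hd']; exists (Num.min d d'); first by rewrite lt_min d0.
    move=> u [Au|Bu] hu; first by apply: le_trans (Hd u Au hu); rewrite ge_min lexx.
    by apply: le_trans (Hd' u Bu hu); rewrite ge_min lexx orbT.
  - move=> u [_ hu]; have uz : 0 < normc (S u - z).
      by rewrite nm_gt0 subr_eq0; apply/eqP => E; apply: no; constructor 3; exists u.
    have [|r r0 Hr] := band_ccont (u := u) _ (ltac:(by rewrite divr_gt0) : 0 < normc (S u - z) / 2).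
      exact: sub.
    exists r => //; exists (normc (S u - z) / 2); first by rewrite divr_gt0.
    move=> v [_ vu] _; have := Hr (v - u) vu; rewrite (addrC u) subrK (nmBC (S v) (S u)).
    have := nm_tri (S v) (S u) z; lra.
  have m0 : 0 < Num.min d e by rewrite lt_min d0.
  have [_ [[u hu <-]]] := H _ m0; rewrite lt_min => /andP[h1 h2].
  have hu' : a < complex.Im u < b by exact: open_sub.
  have [h3 h4] := HN (complex.Re u) (complex.Im u) hu'.
  have Eu : complex.Re u +i* complex.Im u = u by apply: complex_eqP.
  rewrite Eu in h3 h4.
  have [uM|uM] := lerP (complex.Re u) (- M).
    have := h4 (ltac:(lra)); have := nm_tri (S u) z am; rewrite (nmBC z (S u)); lra.
  have [Mu|Mu] := lerP M (complex.Re u).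
    have := h3 (ltac:(lra)); have := nm_tri (S u) z ap; rewrite (nmBC z (S u)); lra.
  have uy : y1 <= complex.Im u <= y2 by case/andP: hu => k1 k2; rewrite !ltW.
  have ru : rect (- M) M y1 y2 u by split => //; rewrite !ltW.
  by have := Hd u ru uy; lra.
apply/plane_closureP => e e0.
pose m := (y1 + y2) / 2.
have hm : y1 < m < y2 by rewrite /m; apply/andP; split; lra.
clearbody m; have [N HN] := ends e0; have hm' := open_sub _ hm.
case: H => [->|->|[u hu <-]].
- exists (S (N +i* m)); split; first by exists (N +i* m).
  by have [+ _] := HN N m hm'; apply.
- exists (S (- N +i* m)); split; first by exists (- N +i* m).
  by have [_ +] := HN (- N) m hm'; apply.
have [|r r0 Hr] := band_ccont (u := u) _ e0; first exact: sub.
(* The point [u], possibly on an edge, is moved towards the middle height by a fraction [s] small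
   enough for the continuity of [S]. *)
pose s := Num.min 1 (r / (`|m - complex.Im u| + 1)).
have n1 : 0 < `|m - complex.Im u| + 1 by have := normr_ge0 (m - complex.Im u); lra.
have s0 : 0 < s by rewrite lt_min ltr01 divr_gt0.
have s1 : s <= 1 by rewrite ge_min lexx.
have sr : s * (`|m - complex.Im u| + 1) <= r by rewrite -ler_pdivlMr // ge_min lexx orbT.
clearbody s.
exists (S (u + (s * (m - complex.Im u)) *i)); split.
  exists (u + (s * (m - complex.Im u)) *i) => //; rewrite /band /strip /= !ReImE /=.
  by case/andP: hu => h1 h2; case/andP: hm => h3 h4; apply/andP; split; nra.
apply: Hr; apply: le_lt_trans (nm_le_ReIm _) _; rewrite /= normr0 add0r normrM gtr0_norm //.
by apply: lt_le_trans sr; rewrite ltr_pM2l // ltrDl.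
Qed.

Lemma band_pos_limit u : band a b u -> pos_limit_set F (S u) = [set ap].
Proof.
by move=> hu; apply: het_pos_limit F_cder (band_het F_cder apm Fap Fam a0 b0 S_hsol S_het hu).
Qed.

Lemma band_neg_limit u : band a b u -> neg_limit_set F (S u) = [set am].
Proof.
by move=> hu; apply: het_neg_limit F_cder (band_het F_cder apm Fap Fam a0 b0 S_hsol S_het hu).
Qed.

Lemma band_not_periodic u : band a b u -> ~ Defs.periodic F (S u).
Proof.
move=> hu [_ [T [T0 _]]]; rewrite band_flow // => /inj -/(_ (band_shift T hu) hu) E.
by have /= := congr1 (@complex.Re R) E; rewrite ReD /=; lra.
Qed.

Lemma band_ordinary u : band a b u -> ordinary F (S u).
Proof.
move=> hu; left.
have nz v : band a b v -> F (S v) != 0 by move=> hv; exact: (band_nz F_cder apm Fap Fam a0 b0 S_hsol S_het hv).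
split; [exact/eqP/nz|exact: band_not_periodic|].
(* A substrip with both edges inside the band is bounded by the orbits at the heights [y1] and [y2],
   which are heteroclinic themselves; on the edges of the band [S] is not known to solve the
   equation. *)
pose y1 := (a + complex.Im u) / 2; pose y2 := (complex.Im u + b) / 2.
have [ay1 y1u uy2 y2b] : [/\ a < y1, y1 < complex.Im u, complex.Im u < y2 & y2 < b].
  by move: hu; rewrite /band /strip /y1 /y2 /= => /andP[h1 h2]; split; lra.
clearbody y1 y2.
have y12 : y1 < y2 by exact: lt_trans uy2.
have h1 : band a b (y1 *i) by rewrite /band /strip /= ay1 /=; lra.
have h2 : band a b (y2 *i) by rewrite /band /strip /= y2b andbT; lra.
have hN v : band y1 y2 v -> band a b v by apply: sub_band; exact: ltW.
have lim v w : band a b v -> band a b w -> same_limit_sets F (S v) (S w).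
  by move=> hv hw; split; rewrite ?band_pos_limit // ?band_neg_limit.
have hv v y : a < y < b -> complex.Im v = y -> band a b v by move=> hy E; rewrite /band /strip /= E.
exists (S @` band y1 y2); split.
- by apply: Or31; apply: band_parallel => //; exact: ltW.
- by exists u => //; rewrite /band /strip /= y1u uy2.
- by move=> _ [v hv' <-]; apply: lim => //; exact: hN.
exists (S (y1 *i)), (S (y2 *i)); split; try exact: lim.
- move=> E; have : orbit F (S (y1 *i)) (S (y1 *i)).
    by apply/(band_orbit _ h1); exists (y1 *i).
  rewrite E => /(band_orbit _ h2)[v /= vE] /inj.
  by move=> /(_ (hv v _ h2 vE) h1) E2; move: vE; rewrite E2 /=; lra.
- rewrite band_pos_limit // band_neg_limit //; apply/seteqP; split => // w [hw wa].
  have Fw : F w = 0 by case: wa => ->.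
  case: hw => [/(band_orbit _ h1)[v /= vE E]|/(band_orbit _ h2)[v /= vE E]].
    by have := nz v (hv v _ h1 vE); rewrite E Fw eqxx.
  by have := nz v (hv v _ h2 vE); rewrite E Fw eqxx.
rewrite /boundary band_pos_limit // band_neg_limit //.
have oN : open (S @` band y1 y2 : set (plane R)) by apply: band_image_open; exact: ltW.
rewrite (interior_id _).1 //.
apply/seteqP; split=> w.
  move=> [/(band_closure _ ay1 y12 y2b)[->|->|[v /andP[v1 v2] <-]] wN].
  - by left; left; left.
  - by left; left; right.
  - move: v1; rewrite le_eqVlt => /orP[/eqP vE|v1].
      by left; right; apply/(band_orbit _ h1); exists v.
    move: v2; rewrite le_eqVlt => /orP[/eqP vE|v2].
      by right; apply/(band_orbit _ h2); exists v.
    by exfalso; apply: wN; exists v => //; rewrite /band /strip /= v1 v2.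
case=> [[[->|->]|/(band_orbit _ h1)[v /= vE <-]]|/(band_orbit _ h2)[v /= vE <-]].
- split; first by apply/(band_closure _ ay1 y12 y2b); constructor 1.
  by move=> [v hv' E]; have := nz v (hN _ hv'); rewrite E Fap eqxx.
- split; first by apply/(band_closure _ ay1 y12 y2b); constructor 2.
  by move=> [v hv' E]; have := nz v (hN _ hv'); rewrite E Fam eqxx.
- split; first by apply/(band_closure _ ay1 y12 y2b); constructor 3; exists v => //; rewrite vE lexx ltW.
  move=> [v' hv' /inj] /(_ (hN _ hv') (hv v _ h1 vE)) E.
  by move: hv'; rewrite /band /strip /= E vE ltxx.
- split; first by apply/(band_closure _ ay1 y12 y2b); constructor 3; exists v => //; rewrite vE lexx ltW.
  move=> [v' hv' /inj] /(_ (hN _ hv') (hv v _ h2 vE)) E.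
  by move: hv'; rewrite /band /strip /= E vE ltxx andbF.
Qed.

End band_image.

(** * The region as a component of the complement of the separatrices *)

Section canonical.
Context {R : realType}.
Local Notation C := R[i].
Local Open Scope complex_scope.
Local Notation orbit := (@Defs.orbit R).
Variables (F : C -> C) (ap am : C).
Hypothesis F_cder : forall z, exists d, cder F z d.
Hypothesis apm : ap <> am.
Hypothesis Fap : F ap = 0.
Hypothesis Fam : F am = 0.

Lemma local_existence z : max_interval F z 0.
Proof.
have [Fz|Fz] := eqVneq (F z) 0.
  rewrite (@global_max R F z (fun=> z)) // => t.
  by rewrite Fz; exact: gder_cst.
have [e [k [e0 k0 H]]] := boxed_near F_cder Fz.
have [|f [f0 Hf]] := H z; first by rewrite subrr nm00.
exists [set t | `|t| < k], (fun t => f t%:C); split; last by rewrite /= normr0.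
apply/solutionP; split.
- move=> t /= tk; apply/real_nbhsP; exists (k - `|t|); first by rewrite subr_gt0.
  by move=> s; rewrite ltrBrDr; apply: le_lt_trans; rewrite -{1}(subrK t s) ler_normD.
- move=> u v /=; rewrite !ltr_norml => /andP[u1 u2] /andP[v1 v2] w /andP[uw wv].
  by rewrite ltr_norml; apply/andP; split; lra.
- by rewrite /= normr0.
- exact: f0.
- move=> t /= tk; rewrite -[X in rder _ _ X]mulr1.
  apply: (cder_curve (g := fun s => s%:C)); last exact: rder_id.
  by apply: Hf; rewrite /mkset nm_real.
Qed.

Lemma heteroclinic_regionE z : heteroclinic_region F ap am z <-> heteroclinic F ap am z.
Proof.
split=> [[/= Lp Lm]|hz]; first exact: limit_set_het.
by split; [exact: het_pos_limit hz|exact: het_neg_limit hz].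
Qed.

Lemma parallel_open (G : plane R -> plane R) N : parallel G N -> open N.
Proof. by case=> -[]. Qed.

Lemma region_is_strip : (exists z, heteroclinic F ap am z) ->
  exists a b S, [/\ a < 0, 0 < b, hsol F (band a b) S, heteroclinic F ap am (S 0) &
    heteroclinic_region F ap am = S @` band a b].
Proof.
move=> [z hz]; have [a [b [S [a0 b0 S0 HS onto]]]] := heteroclinic_strip F_cder apm Fap Fam hz.
exists a, b, S; rewrite S0; split => //; apply/seteqP; split=> q.
  by move=> /heteroclinic_regionE/onto[u [hu <-]]; exists u.
by move=> [u hu <-]; apply/heteroclinic_regionE/onto; exists u.
Qed.

(** The region is open and its orbits are ordinary, so it avoids the closure of the separatrices.
    For maximality it is shown to be relatively closed in a connected set [B] avoiding them: an
    ordinary point in its closure has a neighbourhood whose orbits all share its limit sets, or one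
    filled with periodic orbits, and the latter cannot meet the region. *)
Lemma region_canonical : (exists z, heteroclinic F ap am z) ->
  canonical_region F (heteroclinic_region F ap am).
Proof.
move=> /region_is_strip[a [b [S [a0 b0 HS Hh HE]]]].
have b00 : band a b 0 by rewrite /band /strip /= a0 b0.
have Ho : open (S @` band a b : set (plane R)).
  exact: (band_image_open F_cder apm Fap Fam a0 b0 HS Hh).
have Hsep : heteroclinic_region F ap am `<=` ~` closure (separatrices F).
  move=> z; rewrite HE => hz /(_ _ (open_nbhs_nbhs (conj Ho hz))).
  move=> [y [[x nx [t Mt xy]]]] [u hu uy].
  have [v vu vx] := band_backward F_cder HS Mt hu (etrans xy (esym uy)).
  apply: nx; rewrite /= -vx; apply: (band_ordinary F_cder apm Fap Fam a0 b0 HS Hh).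
  by rewrite /band /strip /= vu.
have Hs : heteroclinic_region F ap am (S 0) by rewrite HE; exists 0.
exists (S 0); first exact: Hsep.
apply/seteqP; split.
  apply: connected_component_max => //.
  rewrite HE; apply: path_connected_connected; apply: cvx_image_path_connected.
    exact: band_cvx.
  by move=> w hw; exact: (band_ccont HS).
apply: bigcup_sub => B [BS Bsep Bc].
(* The intersection contains [S 0] and is open and closed in the connected set [B]. *)
suff <- : B `&` heteroclinic_region F ap am = B by exact: subIsetr.
apply: Bc; first by exists (S 0).
- by exists (heteroclinic_region F ap am) => //; rewrite HE.
exists (closure (heteroclinic_region F ap am)); first exact: closed_closure.
apply/seteqP; split=> z [Bz zH]; split => //; first exact: subset_closure.
have oz : ordinary F z.
  apply: contrapT => nz; apply: (Bsep z Bz); apply: subset_closure; exists z => //.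
  by exists 0; [exact: local_existence|exact: flow0 F_cder (local_existence z)].
case: oz => [[_ _ [N [pN Nz lN _]]]|[_ [N [[oN _ _] Nz pN]]]].
  have [y [Hy Ny]] := zH _ (open_nbhs_nbhs (conj (parallel_open pN) Nz)).
  have [Ep Em] := lN y Ny; case: Hy => /= yp ym.
  by split; rewrite /= -?Ep -?Em.
have [y [+ Ny]] := zH _ (open_nbhs_nbhs (conj oN Nz)); rewrite HE => -[u hu uy].
have := pN y Ny; rewrite -uy => per; exfalso.
exact: (band_not_periodic F_cder apm Fap Fam a0 b0 HS Hh hu) per.
Qed.

End canonical.

Theorem theorem5p7 (R : realType) (F : plane R -> plane R) (ap am : plane R)
    (F_entire : entire F) (F_neq0 : exists z, F z <> 0)
    (ap_neq_am : ap <> am)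
    (ap_eq : equilibrium F ap) (am_eq : equilibrium F am)
    (het : exists x, pos_limit_set F x = [set ap] /\
                     neg_limit_set F x = [set am]) :
  [/\ connected (heteroclinic_region F ap am),
      path_connected (heteroclinic_region F ap am),
      simply_connected (heteroclinic_region F ap am) &
      strip_canonical_region F (heteroclinic_region F ap am)].
Proof.
have Fd := entire_cder F_entire.
have hz : exists z, heteroclinic F ap am z.
  by have [x [Lp Lm]] := het; exists x; exact: limit_set_het.
have can := region_canonical Fd ap_neq_am ap_eq am_eq hz.
have [a [b [S [a0 b0 HS Hh HE]]]] := region_is_strip Fd ap_neq_am ap_eq am_eq hz.
have ab : a < b by exact: lt_trans b0.
have Sc w : band a b w -> ccont S w by exact: band_ccont HS w.
have pc : path_connected (heteroclinic_region F ap am).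
  by rewrite HE; apply: cvx_image_path_connected => //; exact: band_cvx.
split => //.
- exact: path_connected_connected.
- rewrite HE; apply: (cvx_image_simply_connected (J := band_coord a b S)) => //.
  + exact: band_cvx.
  + by move=> u; exact: (band_coordK Fd ap_neq_am ap_eq am_eq a0 b0 HS Hh).
  + move=> u hu e e0.
    have [d d0 Hd] := band_coord_cont Fd ap_neq_am ap_eq am_eq a0 b0 HS Hh hu e0.
    by exists d => // z _; exact: Hd.
- split => //; rewrite HE.
  exact: (band_parallel Fd ap_neq_am ap_eq am_eq a0 b0 HS Hh).
Qed.
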